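(* Let $U\in\dot H^1(\mathbb{R}^4)$ be a divergence-free vector field, and let $2\leq p<4$. Then, for any $\varepsilon>0$, there exists a constant $C_{\varepsilon,p,U}>0$, depending only on $\varepsilon$, $p$ and $U$, such that for every $V\in W^{2,p}(\mathbb{R}^4)$ $$\|\operatorname{div}(U\otimes V)\|_{L^p(\mathbb{R}^4)}\leq\varepsilon\|V\|_{\dot W^{2,p}(\mathbb{R}^4)}+C_{\varepsilon,p,U}\|\nabla V\|_{L^p(\mathbb{R}^4)}.$$
   Context: $V$ is a vector field on $\mathbb{R}^4$, and $\operatorname{div}(U\otimes V)=(U\cdot\nabla)V$ since $\operatorname{div}U=0$. $\dot H^1$ and $\dot W^{2,p}$ are homogeneous Sobolev spaces; in particular $\dot H^1(\mathbb{R}^4)\hookrightarrow L^4(\mathbb{R}^4)$. *)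

(* Defs.v *)
From HB Require Import structures.
From mathcomp Require Import all_boot all_order all_algebra.
From mathcomp Require Import all_classical all_reals all_analysis.

Set Implicit Arguments.
Unset Strict Implicit.
Unset Printing Implicit Defensive.

Import Order.TTheory GRing.Theory Num.Theory.
Import numFieldNormedType.Exports.

Local Open Scope classical_set_scope.
Local Open Scope ring_scope.

(* Points of R^4 are nested quadruples, so that the normed-module structure and
   the topology come from the library.  Vector and tensor fields are families of
   scalar components indexed by 'I_4. *)
Notation R4 R := (R * R * R * R)%type.

(* The same quadruples, with the sigma-algebra on which the library defines
   [lebesgue_measure]; [mR4 R] is convertible to [R4 R]. *)
Notation mR4 R := (measurableTypeR R * measurableTypeR R *
                   measurableTypeR R * measurableTypeR R)%type.

Section defs.
Context {R : realType}.
Implicit Types (f g phi : R4 R -> R) (j k : 'I_4) (p : R).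

Definition leb4 : {measure set (mR4 R) -> \bar R} :=
  (@lebesgue_measure R \x @lebesgue_measure R \x @lebesgue_measure R
     \x @lebesgue_measure R)%E.

Definition basis4 j : R4 R :=
  ((j == 0 :> nat)%:R, (j == 1 :> nat)%:R,
   (j == 2 :> nat)%:R, (j == 3 :> nat)%:R).

Definition partial j f : R4 R -> R := fun x => 'D_(basis4 j) f x.

Definition smooth f := forall s : seq 'I_4,
  let g := foldr partial f s in
  continuous g /\ forall x j, derivable g x (basis4 j).

(* C_c^infty(R^4) *)
Definition test_function phi :=
  smooth phi /\ compact (closure [set x | phi x != 0]).

(* L^1_loc(R^4); the library's [locally_integrable] is restricted to the line *)
Definition loc_integrable f :=
  measurable_fun [set: mR4 R] f /\
  forall K : set (R4 R), compact K -> (\int[leb4]_(x in K) `|f x|%:E < +oo)%E.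

Definition is_wpartial j f g :=
  [/\ loc_integrable f, loc_integrable g &
      forall phi, test_function phi ->
        \int[leb4]_x (f x * partial j phi x) = - \int[leb4]_x (g x * phi x)].

Definition has_wpartial j f := exists g, is_wpartial j f g.

(* A representative of the weak derivative (unique up to a null set); it is
   meaningful only under [has_wpartial j f]. *)
Definition wpartial j f : R4 R -> R := xget (cst 0) [set g | is_wpartial j f g].

Definition is_wdiv (F : 'I_4 -> R4 R -> R) g :=
  [/\ forall j, loc_integrable (F j), loc_integrable g &
      forall phi, test_function phi ->
        \int[leb4]_x (\sum_j F j x * partial j phi x)
          = - \int[leb4]_x (g x * phi x)].

Definition divergence_free (U : 'I_4 -> R4 R -> R) := is_wdiv U (cst 0).

Definition has_wdiv (F : 'I_4 -> R4 R -> R) := exists g, is_wdiv F g.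

(* same convention as [wpartial] *)
Definition wdiv (F : 'I_4 -> R4 R -> R) : R4 R -> R :=
  xget (cst 0) [set g | is_wdiv F g].

Definition tensor (U V : 'I_4 -> R4 R -> R) : 'I_4 -> 'I_4 -> R4 R -> R :=
  fun j i x => U j x * V i x.

(* The divergence of a tensor field contracts the first index:
   (div T)_i = sum_j d_j T_ji, so that div (U (x) V) = (U . grad) V when
   div U = 0. *)
Definition has_tdiv (T : 'I_4 -> 'I_4 -> R4 R -> R) :=
  forall i, has_wdiv (fun j => T j i).

Definition tdiv (T : 'I_4 -> 'I_4 -> R4 R -> R) : 'I_4 -> R4 R -> R :=
  fun i => wdiv (fun j => T j i).

(* L^p norm of a field with finitely many components, taken with respect to
   the pointwise Euclidean (Frobenius) norm *)
Definition LpN (I : finType) p (F : I -> R4 R -> R) : \bar R :=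
  Lnorm leb4 p%:E (fun x => (Num.sqrt (\sum_i F i x ^+ 2))%:E).

Definition wgrad (V : 'I_4 -> R4 R -> R) : 'I_4 * 'I_4 -> R4 R -> R :=
  fun ij => wpartial ij.2 (V ij.1).

Definition whess (V : 'I_4 -> R4 R -> R) : 'I_4 * 'I_4 * 'I_4 -> R4 R -> R :=
  fun ijk => wpartial ijk.2 (wgrad V ijk.1).

(* the homogeneous norm of \dot W^{2,p} *)
Definition dotW2pN p (V : 'I_4 -> R4 R -> R) : \bar R := LpN p (whess V).

Definition W2p p (V : 'I_4 -> R4 R -> R) :=
  [/\ forall i, V i \in Lfun leb4 p%:E,
      forall i j, has_wpartial j (V i) /\
        wpartial j (V i) \in Lfun leb4 p%:E &
      forall i j k, has_wpartial k (wpartial j (V i)) /\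
        wpartial k (wpartial j (V i)) \in Lfun leb4 p%:E].

(* \dot H^1(R^4): the completion of C_c^infty for the norm ||grad u||_{L^2},
   realized as a space of functions.  The L^1_loc convergence identifies the
   limit; without it nonzero constants would not be excluded. *)
Definition dotH1_scalar (u : R4 R -> R) :=
  [/\ loc_integrable u,
      forall j, has_wpartial j u /\ wpartial j u \in Lfun leb4 2%:E &
      exists phi : nat -> R4 R -> R,
        [/\ forall n, test_function (phi n),
            forall j, (fun n => Lnorm leb4 2%:E (fun x =>
              (partial j (phi n) x - wpartial j u x)%:E)) @ \oo --> 0%E &
            forall K : set (R4 R), compact K ->
              (fun n => \int[leb4]_(x in K) `|phi n x - u x|%:E)%E
                @ \oo --> 0%E]].

Definition dotH1 (U : 'I_4 -> R4 R -> R) := forall i, dotH1_scalar (U i).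

End defs.

(* Main.v *)
Require Import Defs.
From HB Require Import structures.
From mathcomp Require Import all_boot all_order all_algebra.
From mathcomp Require Import all_classical all_reals all_analysis.
From mathcomp Require Import fingroup perm measurable_realfun ring lra.

(** Since div U = 0, the divergence of the tensor product of U and V is the field
    (U . grad) V, so the matter is to bound the products U_j d_j V_i in L^p.
    Cut |U| at a height n. The field U lies in L^4, hence the part of |U| above
    the cut is as small as desired in L^4 when n is large. As
    1 / p = 1 / 4 + 1 / q with q = 4 p / (4 - p), Hoelder's inequality bounds
    the contribution of this part by a small constant times the norm of grad V
    in L^q, which the Sobolev inequality bounds by the norm of the Hessian of
    V in L^p. The part below the cut contributes at most n times the norm of
    grad V in L^p. The height n depends on eps, p and U only. This is
    [tensor_bound], and three facts feed it.

    The Sobolev inequality for functions given by their weak derivatives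
    ([sobolev_weak]). On almost every line in direction j, a function f with
    weak derivative g is a primitive of g ([weak_line_formula]): the difference
    between f and the candidate primitive, normalized by averages against a fixed
    bump, is orthogonal to all products of bumps ([weak_lines_test]), hence is 0
    ([dubois_reymond]). A chain rule inequality for the truncated power of order
    c = 3 p / (4 - p) and the integrability of f then give
    |f| ^ c <= int c |f| ^ (c - 1) |g| over almost every line
    ([line_inequality]). The product of these bounds over the four directions is
    integrated by the Loomis-Whitney inequality, and Hoelder's inequality closes
    the estimate ([sobolev]).

    The embedding of the homogeneous space of order 1 in L^4 ([dotH1_L4]). The
    Sobolev inequality with p = 2, applied to the differences of the test
    functions that approximate U, shows that they converge to U in L^4.

    The product rule ([wdiv_tensor]). Testing the weak derivative of V_i against
    the product of a test function and an approximation of U_j, and passing to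
    the limit with U_j in L^4 and its derivatives in L^2, gives the product rule
    for U_j V_i in the weak sense. In the sum over j the term with div U drops
    out. The weak divergence is unique almost everywhere ([wdiv_unique]), so the
    chosen representative satisfies the estimate. *)

Set Implicit Arguments.
Unset Strict Implicit.
Unset Printing Implicit Defensive.

Import Order.TTheory GRing.Theory Num.Theory.
Import numFieldNormedType.Exports.

Local Open Scope classical_set_scope.
Local Open Scope ring_scope.

(** * Smooth functions of one variable *)

Section OneVariable.
Context {R : realType}.
Implicit Types (f g : R -> R) (n k : nat).

(** The last derivative is asked to be differentiable rather than continuous:
    over all n this is the same notion of smoothness, and the recursion has a
    single clause. *)
Fixpoint Cn n f : Prop :=
  (forall x : R, derivable f x 1) /\
  match n with 0 => True | m.+1 => Cn m (derive1 f) end.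

Definition smooth1 f := forall n, Cn n f.

Lemma Cn_derivable n f (x : R) : Cn n f -> derivable f x 1.
Proof. by case: n => [|n] []. Qed.

Lemma CnS n f : Cn n.+1 f -> Cn n f.
Proof. by elim: n f => [|n IH] f [df [d2f h]]; split=> //; apply: IH; split. Qed.

Lemma Cn_derive1 n f (df : R -> R) :
  (forall x : R, is_derive x (1:R) f (df x)) -> Cn n df -> Cn n.+1 f.
Proof.
move=> fd cdf; split; first by move=> x; have := fd x; case.
suff -> : (derive1 f) = df by [].
by apply/funext => x; rewrite derive1E; have := fd x; case.
Qed.

Lemma Cn_is_derive n f (x : R) : Cn n f -> is_derive x 1 f ((derive1 f) x).
Proof.
by move=> /(@Cn_derivable _ _ x) df; rewrite derive1E; exact: DeriveDef.
Qed.

Lemma Cn_cst n (c : R) : Cn n (fun=> c).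
Proof.
elim: n c => [|n IH] c; first by split=> // x; exact: derivable_cst.
by apply: (@Cn_derive1 _ _ (fun=> 0)).
Qed.

Lemma CnD n f g : Cn n f -> Cn n g -> Cn n (fun x => f x + g x).
Proof.
elim: n f g => [|n IH] f g cf cg.
  by split=> // x; apply: derivableD; apply: Cn_derivable; [exact: cf|exact: cg].
apply: (@Cn_derive1 _ _ (fun x => (derive1 f) x + (derive1 g) x)).
  move=> x; apply: is_deriveD; apply: Cn_is_derive; [exact: cf|exact: cg].
by apply: IH; [case: cf|case: cg].
Qed.

Lemma CnM n f g : Cn n f -> Cn n g -> Cn n (fun x => f x * g x).
Proof.
elim: n f g => [|n IH] f g cf cg.
  by split=> // x; apply: derivableM; apply: Cn_derivable; [exact: cf|exact: cg].
apply: (@Cn_derive1 _ _ (fun x => f x * (derive1 g) x + g x * (derive1 f) x)).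
  by move=> x; apply: is_deriveM; apply: Cn_is_derive; [exact: cf|exact: cg].
by apply: CnD; apply: IH; [exact: CnS|case: cg|exact: CnS|case: cf].
Qed.

Lemma CnB n f g : Cn n f -> Cn n g -> Cn n (fun x => f x - g x).
Proof.
move=> cf cg.
have -> : (fun x => f x - g x) = (fun x => f x + (-1) * g x).
  by apply/funext => x; rewrite mulN1r.
by apply: CnD => //; apply: CnM => //; exact: Cn_cst.
Qed.

Lemma Cn_affine n f (a b : R) : Cn n f -> Cn n (fun x => f (a * x + b)).
Proof.
have dab (x : R) : is_derive x (1:R) (fun x : R => a * x + b) a.
  have h : is_derive x (1:R) (fun x : R => a * x + b) (a *: 1 + 0).
    by apply: is_deriveD; apply: is_deriveZ.
  by move: h; rewrite addr0 scaler1.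
have key f' (x : R) : derivable f' (a * x + b) 1 ->
    is_derive x (1:R) (fun x : R => f' (a * x + b)) (a * (derive1 f') (a * x + b)).
  move=> df; rewrite mulrC derive1E.
  apply: (@is_derive1_comp R f' (fun x => a * x + b)).
  exact: DeriveDef.
elim: n f => [|n IH] f cf.
  by split=> // x; have := key f x (@Cn_derivable _ _ (a * x + b) cf); case.
apply: (@Cn_derive1 _ _ (fun x => a * (derive1 f) (a * x + b))).
  by move=> x; apply: key; exact: Cn_derivable cf.
by apply: CnM; [exact: Cn_cst|apply: IH; case: cf].
Qed.

(** For k = 0 this is exp (- 1 / x), extended by 0. The powers of 1 / x are
    what its derivatives produce, so the family is closed under
    differentiation up to linear combinations. *)
Definition flat k (x : R) : R :=
  if 0 < x then x^-1 ^+ k * expR (- x^-1) else 0.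

Lemma flat_ge0 k x : 0 <= flat k x.
Proof.
rewrite /flat; case: ifPn => // x0.
by rewrite mulr_ge0// ?expR_ge0// exprn_ge0// invr_ge0 ltW.
Qed.

Lemma flatM k x : x * flat k.+1 x = flat k x.
Proof.
rewrite /flat; case: ifPn => [x0|]; last by rewrite mulr0.
by rewrite exprS !mulrA mulfV ?mul1r// gt_eqF.
Qed.

(** From (y / (k + 1)) ^ (k + 1) <= exp y at y = 1 / x. *)
Lemma flat_bound k x : flat k x <= k.+1%:R ^+ k.+1 * `|x|.
Proof.
rewrite /flat; case: ifPn => x0; last by rewrite mulr_ge0// exprn_ge0.
rewrite gtr0_norm// expRN.
have y0 : 0 < x^-1 by rewrite invr_gt0.
have h : (x^-1 / k.+1%:R) ^+ k.+1 <= expR x^-1.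
  have -> : expR x^-1 = expR (x^-1 / k.+1%:R) ^+ k.+1.
    by rewrite -expRM_natl mulrC mulfVK// pnatr_eq0.
  rewrite lerXn2r ?nnegrE ?expR_ge0//; first by rewrite divr_ge0// ltW.
  apply: le_trans (_ : 1 + x^-1 / k.+1%:R <= _); first by rewrite lerDr.
  exact: expR_ge1Dx.
rewrite ler_pdivrMr ?expR_gt0//.
have -> : x^-1 ^+ k = k.+1%:R ^+ k.+1 * x * (x^-1 / k.+1%:R) ^+ k.+1.
  rewrite expr_div_n (exprSr x^-1); field.
  by rewrite expf_neq0 ?pnatr_eq0// gt_eqF.
rewrite ler_wpM2l// mulr_ge0// ?exprn_ge0// ltW//.
Qed.

Lemma flat_cvg0 k : flat k x @[x --> 0] --> (0 : R).
Proof.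
apply: (@squeeze_cvgr _ _ _ _ (fun=> 0) (fun x => k.+1%:R ^+ k.+1 * `|x|)).
- by near=> x; rewrite flat_ge0 flat_bound.
- exact: cvg_cst.
- rewrite -[X in _ --> X](mulr0 (k.+1%:R ^+ k.+1)); apply: cvgMr.
  rewrite -[X in _ --> X](normr0 R).
  apply: cvg_norm; exact: cvg_id.
Unshelve. all: by end_near. Qed.

(** At 0 the difference quotient of flat k is flat k.+1, which tends to 0
    there. *)
Lemma is_derive_flat k (x : R) :
  is_derive x (1:R) (flat k) (flat k.+2 x - k%:R * flat k.+1 x).
Proof.
have [x0|x0|->] := ltgtP x 0.
- rewrite [X in is_derive _ _ _ X](_ : _ = 0); last first.
    by rewrite /flat ltNge (ltW x0)/= mulr0 subr0.
  apply: (@near_eq_is_derive _ _ _ (cst 0)).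
  near=> z; rewrite /flat ltNge [X in ~~ X](_ : _ = true)//.
  by apply: ltW; near: z; exact: lt_nbhsl.
- pose g := fun x : R => x^-1 ^+ k * expR (- x^-1).
  have dV : is_derive x (1:R) (fun x : R => x^-1) (- x ^- 2).
    have := @is_deriveV R id x 1 1; rewrite scaler1; apply=> //.
    by rewrite gt_eqF.
  have dg : is_derive x 1 g (flat k.+2 x - k%:R * flat k.+1 x).
    rewrite /flat x0.
    have -> : x^-1 ^+ k.+2 * expR (- x^-1) - k%:R * (x^-1 ^+ k.+1 * expR (- x^-1))
      = x^-1 ^+ k *: (expR (- x^-1) * - (- x ^- 2))
        + expR (- x^-1) *: (k%:R * x^-1 ^+ k.-1 *: (- x ^- 2)).
      rewrite /GRing.scale/= opprK -exprVn; clear g dV; case: k => [|k] /=.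
        by rewrite /=; ring.
      by rewrite !exprS; ring.
    apply: is_deriveM.
    have := @is_deriveX _ _ _ k _ _ _ dV.
    by rewrite (_ : _ ^+ k = fun x : R => x^-1 ^+ k)// exprfctE.
  apply: (@near_eq_is_derive _ _ _ g).
  near=> z; rewrite /flat /g ifT//; near: z; exact: lt_nbhsr.
- rewrite /flat ltxx mulr0 subr0.
  have h : h^-1 *: ((flat k \o shift 0) h%:A - flat k 0) @[h --> 0^'] --> (0:R).
    apply: (@cvg_trans _ (flat k.+1 h @[h --> 0^'])); last first.
      by apply: cvg_within_filter; exact: flat_cvg0.
    apply: near_eq_cvg; near=> h.
    rewrite /= addr0 {3}/flat ltxx subr0 -(flatM k (h%:A)).
    rewrite /GRing.scale/= mulr1 mulKf//; near: h; exact: nbhs_dnbhs_neq.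
  apply: DeriveDef; first by apply/cvg_ex; exists 0.
  exact: cvg_lim h.
Unshelve. all: by end_near. Qed.

Lemma smooth1_flat k : smooth1 (flat k).
Proof.
move=> n; elim: n k => [|n IH] k.
  by split=> // x; have := is_derive_flat k x; case.
apply: (Cn_derive1 (is_derive_flat k)); apply: CnB => //.
by apply: CnM => //; exact: Cn_cst.
Qed.

Lemma flat0_le1 x : flat 0 x <= 1.
Proof.
rewrite /flat; case: ifPn => // x0.
by rewrite expr0 mul1r -expR0 ler_expR oppr_le0 invr_ge0 ltW.
Qed.

(** Positive exactly on ]a, b[; the dilation by n.+1 makes both factors tend
    to 1 inside the interval, which gives smooth approximations of its
    indicator. *)
Definition bump (a b : R) n x :=
  flat 0 (n.+1%:R * x - n.+1%:R * a) * flat 0 (n.+1%:R * b - n.+1%:R * x).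

Lemma smooth1_bump a b n : smooth1 (bump a b n).
Proof.
move=> m; apply: CnM; first exact: Cn_affine (smooth1_flat _ _).
have := Cn_affine (- n.+1%:R) (n.+1%:R * b) (smooth1_flat 0 m).
by congr Cn; apply/funext => x; rewrite mulNr addrC.
Qed.

Lemma bump_ge0 a b n x : 0 <= bump a b n x.
Proof. by rewrite mulr_ge0// flat_ge0. Qed.

Lemma bump_le1 a b n x : bump a b n x <= 1.
Proof. by rewrite -[leRHS]mulr1 ler_pM ?flat_ge0// flat0_le1. Qed.

Lemma bump_gt0 a b n x : a < x < b -> 0 < bump a b n x.
Proof.
move=> /andP[ax xb]; rewrite /bump /flat -!mulrBr !pmulr_rgt0 ?subr_gt0//.
  by rewrite xb expr0 mul1r expR_gt0.
by rewrite ax expr0 mul1r expR_gt0.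
Qed.

Lemma bump_eq0 a b n x : ~~ (a < x < b) -> bump a b n x = 0.
Proof.
rewrite negb_and -!leNgt /bump /flat -!mulrBr => /orP[ax|bx].
  by rewrite ifF ?mul0r// pmulr_rgt0// subr_gt0 ltNge ax.
by rewrite [X in _ * X]ifF ?mulr0// pmulr_rgt0// subr_gt0 ltNge bx.
Qed.

Lemma flat0_cvg1 (z : R) : 0 < z -> flat 0 (n.+1%:R * z) @[n --> \oo] --> (1 : R).
Proof.
move=> z0.
have -> : (fun n => flat 0 (n.+1%:R * z)) = (fun n => expR (- (n.+1%:R^-1 * z^-1))).
  by apply/funext => n; rewrite /flat mulr_gt0// expr0 mul1r invfM.
rewrite -[X in _ --> X](expR0 R); apply: continuous_cvg; first exact: continuous_expR.
rewrite -[X in _ --> X]oppr0; apply: cvgN; rewrite -[X in _ --> X](mul0r z^-1).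
by apply: cvgMl; exact: cvg_harmonic.
Qed.

Lemma bump_cvg a b x : bump a b n x @[n --> \oo] --> (\1_`]a, b[ x : R).
Proof.
rewrite indicE mem_setE in_itv/=; case: (boolP (a < x < b)) => [/andP[ax xb]|abx].
  rewrite -[X in _ --> X](mulr1 1).
  under eq_fun do rewrite /bump -!mulrBr.
  by apply: cvgM; apply: flat0_cvg1; rewrite subr_gt0.
under eq_fun do rewrite bump_eq0//; exact: cvg_cst.
Qed.

End OneVariable.

(** * Lebesgue measure on four-space *)

Section ProductSigmaFinite.
Context d1 d2 (T1 : measurableType d1) (T2 : measurableType d2) (R : realType).
Variable m1 : {sigma_finite_measure set T1 -> \bar R}.
Variable m2 : {sigma_finite_measure set T2 -> \bar R}.

Let prod_sigma_finite : sigma_finite [set: T1 * T2] (m1 \x m2)%E.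
Proof.
have /sigma_finiteP[F [TF ndF Foo]] := sigma_finiteT m1.
have /sigma_finiteP[G [TG ndG Goo]] := sigma_finiteT m2.
exists (fun n => F n `*` G n).
  apply/seteqP; split=> // -[x y] _.
  have : setT x by []. rewrite TF => -[i _ Fix].
  have : setT y by []. rewrite TG => -[j _ Gjy].
  exists (maxn i j) => //=; split.
    by move/subsetPset: (ndF _ _ (leq_maxl i j)); apply.
  by move/subsetPset: (ndG _ _ (leq_maxr i j)); apply.
move=> n; have [mF Fn] := Foo n; have [mG Gn] := Goo n.
split; first exact: measurableX.
by rewrite product_measure1E// lte_mul_pinfty// ge0_fin_numE.
Qed.

(** The product measure bundled with its sigma-finiteness, so that Fubini's
    theorem can be iterated over more than two factors. *)
Definition prodsf : {sigma_finite_measure set (T1 * T2)%type -> \bar R} :=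
  HB.pack (m1 \x m2)%E
    (@Measure_isSigmaFinite.Build _ _ _ (m1 \x m2)%E prod_sigma_finite).

End ProductSigmaFinite.

Notation mR3 R := (measurableTypeR R * measurableTypeR R * measurableTypeR R)%type.

Section Coordinates.
Context {R : realType}.
Implicit Types (x : R4 R) (j k : 'I_4) (a b : 'I_4 -> R) (s t : R).

Definition leb2 : {sigma_finite_measure set (measurableTypeR R * measurableTypeR R)%type -> \bar R} :=
  prodsf (@lebesgue_measure R) (@lebesgue_measure R).

Definition leb3 : {sigma_finite_measure set (mR3 R) -> \bar R} :=
  prodsf leb2 (@lebesgue_measure R).

Lemma leb4E : @leb4 R = (leb3 \x @lebesgue_measure R)%E :> (set (mR4 R) -> \bar R).
Proof. by []. Qed.

Definition co x k : R := [:: x.1.1.1; x.1.1.2; x.1.2; x.2]`_k.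

Definition mk4 (f : 'I_4 -> R) : R4 R :=
  (f (inord 0), f (inord 1), f (inord 2), f (inord 3)).

Lemma ord4P (P : 'I_4 -> Prop) :
  P (inord 0) -> P (inord 1) -> P (inord 2) -> P (inord 3) -> forall j, P j.
Proof.
move=> P0 P1 P2 P3 [[|[|[|[|j]]]] jlt]//.
- by rewrite (_ : Ordinal jlt = inord 0)//; apply: val_inj; rewrite /= inordK.
- by rewrite (_ : Ordinal jlt = inord 1)//; apply: val_inj; rewrite /= inordK.
- by rewrite (_ : Ordinal jlt = inord 2)//; apply: val_inj; rewrite /= inordK.
- by rewrite (_ : Ordinal jlt = inord 3)//; apply: val_inj; rewrite /= inordK.
Qed.

Lemma coK f k : co (mk4 f) k = f k.
Proof. by elim/ord4P: k; rewrite /co inordK. Qed.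

Lemma mk4K x : mk4 (co x) = x.
Proof. by case: x => [[[a b] c] d]; rewrite /mk4 /co !inordK. Qed.

Lemma co_inj x y : co x =1 co y -> x = y.
Proof. by move=> xy; rewrite -(mk4K x) -(mk4K y) (funext xy). Qed.

Definition upd x j s := mk4 (fun k => if k == j then s else co x k).

Lemma co_upd x j s k : co (upd x j s) k = if k == j then s else co x k.
Proof. exact: coK. Qed.

Lemma upd_upd x j s t : upd (upd x j s) j t = upd x j t.
Proof. by apply: co_inj => k; rewrite !co_upd; case: eqP. Qed.

Lemma updC x i j s t : i != j -> upd (upd x i s) j t = upd (upd x j t) i s.
Proof.
move=> ij; apply: co_inj => k; rewrite !co_upd.
by case: eqP => // ->; case: eqP => // ji; rewrite ji eqxx in ij.
Qed.

Lemma upd_id x j : upd x j (co x j) = x.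
Proof. by apply: co_inj => k; rewrite co_upd; case: eqP => // ->. Qed.

(** Exchanging coordinate j with the last one carries the lines in direction j
    to the fibres of the last projection, along which leb4 is a product
    measure by definition. *)
Definition sw j x := mk4 (fun k => co x (tperm j (inord 3) k)).

Lemma co_sw j x k : co (sw j x) k = co x (tperm j (inord 3) k).
Proof. exact: coK. Qed.

Lemma swK j : involutive (sw j).
Proof. by move=> x; apply: co_inj => k; rewrite !co_sw tpermK. Qed.

Lemma sw_upd j x t : sw j (x.1, t) = upd (sw j x) j t.
Proof.
apply: co_inj => k; rewrite co_upd !co_sw.
case: eqP => [->|/eqP kj]; first by rewrite tpermL /co inordK.
have : tperm j (inord 3) k != inord 3.
  by rewrite -(inj_eq (@perm_inj _ (tperm j (inord 3)))) tpermK tpermR.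
by elim/ord4P: (tperm _ _ _); rewrite ?eqxx// /co !inordK.
Qed.

Lemma measurable_co k : measurable_fun [set: mR4 R] (co ^~ k : _ -> measurableTypeR R).
Proof.
have m1 : measurable_fun [set: mR4 R] (fun x : mR4 R => x.1) by exact: measurable_fst.
have m11 : measurable_fun [set: mR4 R] (fun x : mR4 R => x.1.1).
  by apply: (measurableT_comp _ m1); exact: measurable_fst.
elim/ord4P: k; rewrite /co inordK//=.
- by apply: (measurableT_comp _ m11); exact: measurable_fst.
- by apply: (measurableT_comp _ m11); exact: measurable_snd.
- by apply: (measurableT_comp _ m1); exact: measurable_snd.
- exact: measurable_snd.
Qed.

Lemma measurable_mk4 d (T : measurableType d) (f : T -> 'I_4 -> measurableTypeR R) :
  (forall k, measurable_fun [set: T] (f ^~ k : T -> measurableTypeR R)) ->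
  measurable_fun [set: T] ((fun t : T => mk4 (f t)) : T -> mR4 R).
Proof.
move=> mf; apply/measurable_fun_pairP; split; last exact: mf.
apply/measurable_fun_pairP; split; last exact: mf.
by apply/measurable_fun_pairP; split; exact: mf.
Qed.

Lemma measurable_sw j : measurable_fun [set: mR4 R] (sw j : mR4 R -> mR4 R).
Proof. by apply: measurable_mk4 => k; exact: measurable_co. Qed.

Lemma measurable_upd j :
  measurable_fun [set: mR4 R * measurableTypeR R]
    ((fun xs => upd xs.1 j xs.2) : _ -> mR4 R).
Proof.
apply: measurable_mk4 => k; case: eqP => _; first exact: measurable_snd.
by apply: (measurableT_comp (measurable_co k)); exact: measurable_fst.
Qed.

Lemma measurable_upd2 j x :
  measurable_fun [set: measurableTypeR R] (upd x j : _ -> mR4 R).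
Proof.
apply: measurable_mk4 => k; case: eqP => _; first exact: measurable_id.
exact: measurable_cst.
Qed.

Definition oobox a b : set (R4 R) := [set x | forall k, a k < co x k < b k].

Lemma oobox_prod a b : oobox a b =
  `]a (inord 0), b (inord 0)[ `*` `]a (inord 1), b (inord 1)[ `*`
  `]a (inord 2), b (inord 2)[ `*` `]a (inord 3), b (inord 3)[.
Proof.
apply/seteqP; split => [x xab|x [[[h0 h1] h2] h3]].
  have h k : co x k \in `]a k, b k[ by rewrite in_itv/= xab.
  have := h (inord 0); have := h (inord 1); have := h (inord 2).
  by have := h (inord 3); rewrite /co !inordK//.
by elim/ord4P; rewrite /co inordK.
Qed.

Lemma measurable_oobox a b : measurable (oobox a b : set (mR4 R)).
Proof. by rewrite oobox_prod; do 3 ?apply: measurableX => //. Qed.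

Lemma leb4_setX (A B C D : set (measurableTypeR R)) :
  measurable A -> measurable B -> measurable C -> measurable D ->
  leb4 (A `*` B `*` C `*` D : set (mR4 R)) =
  (lebesgue_measure A * lebesgue_measure B * lebesgue_measure C
     * lebesgue_measure D)%E.
Proof.
move=> mA mB mC mD; rewrite leb4E.
have E4 : (leb3 \x @lebesgue_measure R)%E (A `*` B `*` C `*` D) =
    (leb3 (A `*` B `*` C) * lebesgue_measure D)%E.
  by apply: product_measure1E => //; do 2 apply: measurableX => //.
have E3 : (leb2 \x @lebesgue_measure R)%E (A `*` B `*` C) =
    (leb2 (A `*` B) * lebesgue_measure C)%E.
  by apply: product_measure1E => //; exact: measurableX.
have E2 : (@lebesgue_measure R \x @lebesgue_measure R)%E (A `*` B) =
    (lebesgue_measure A * lebesgue_measure B)%E.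
  exact: product_measure1E.
by rewrite E4; congr (_ * _)%E; apply: (etrans E3); congr (_ * _)%E.
Qed.

Lemma leb4_oobox a b : leb4 (oobox a b) =
  (\prod_k lebesgue_measure (`]a k, b k[%classic : set R))%E.
Proof.
rewrite oobox_prod leb4_setX//.
rewrite big_ord_recr/= big_ord_recr/= big_ord_recr/= big_ord_recr/= big_ord0 mul1e.
have e0 : inord 0 = widen_ord (leqnSn 3) (widen_ord (leqnSn 2) (widen_ord (leqnSn 1) ord_max)).
  by apply: val_inj; rewrite /= inordK.
have e1 : inord 1 = widen_ord (leqnSn 3) (widen_ord (leqnSn 2) ord_max).
  by apply: val_inj; rewrite /= inordK.
have e2 : inord 2 = widen_ord (leqnSn 3) (ord_max : 'I_3).
  by apply: val_inj; rewrite /= inordK.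
have e3 : inord 3 = ord_max :> 'I_4 by apply: val_inj; rewrite /= inordK.
by rewrite -e0 -e1 -e2 -e3.
Qed.

(** A pi-system that generates the sigma-algebra: uniqueness of measures and
    of integrands is checked on it. *)
Definition ooboxes : set (set (R4 R)) := [set A | exists a b, A = oobox a b].

Lemma setI_closed_ooboxes : setI_closed ooboxes.
Proof.
move=> _ _ [a [b ->]] [c [d ->]].
exists (fun k => Num.max (a k) (c k)), (fun k => Num.min (b k) (d k)).
apply/seteqP; split => [x [xab xcd] k|x xabcd].
  by rewrite gt_max lt_min; have /andP[-> ->] := xab k; have /andP[-> ->] := xcd k.
by split=> k; have := xabcd k; rewrite gt_max lt_min => /andP[/andP[h1 h2] /andP[h3 h4]]; apply/andP.
Qed.

Lemma bigcup_oobox : \bigcup_n oobox (fun=> - n%:R) (fun=> n%:R) = setT.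
Proof.
apply/seteqP; split=> // x _.
pose M := \sum_k `|co x k|.
have [n Mn] : exists n, M < n%:R.
  exists (Num.truncn M).+1; exact: truncnS_gt.
exists n => //= k; rewrite -ltr_norml (le_lt_trans _ Mn)//.
by rewrite /M (bigD1 k)//= lerDl sumr_ge0.
Qed.

Lemma measurable_mR4E : @measurable _ (mR4 R) = <<s ooboxes >>.
Proof.
apply/seteqP; split; last first.
  apply: smallest_sub; first exact: sigma_algebra_measurable.
  by move=> _ [a [b ->]]; exact: measurable_oobox.
pose G4 := g_sigma_algebraType (ooboxes : set (set (R4 R))).
have mco k : measurable_fun [set: G4] ((fun x : G4 => co x k) : _ -> measurableTypeR R).
  apply: (measurability _ (RGenOInfty.measurableE R)).
  move=> _ [_ [c ->] <-]; rewrite setTI.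
  pose An n := oobox (fun k' => if k' == k then c else - n%:R) (fun=> n%:R).
  have -> : (fun x : G4 => co x k) @^-1` `]c, +oo[ = \bigcup_n An n.
    apply/seteqP; split => [x|x [n _ /(_ k)]]; last first.
      by rewrite eqxx /= in_itv/= andbT => /andP[].
    rewrite /= in_itv/= andbT => cx.
    have [n _ nx] : (\bigcup_n oobox (fun=> - n%:R) (fun=> n%:R)) x.
      by rewrite bigcup_oobox.
    exists n => //= k'; have /andP[? ->] := nx k'; rewrite andbT.
    by case: eqP => [->|].
  apply: bigcupT_measurable => n; apply: sub_sigma_algebra.
  by exists (fun k' => if k' == k then c else - n%:R), (fun=> n%:R).
have mid : measurable_fun [set: G4] ((fun x : G4 => mk4 (co x)) : G4 -> mR4 R).
  by apply: measurable_mk4 => k; exact: mco.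
move=> A mA; have := mid measurableT A mA; rewrite setTI.
by rewrite (_ : _ @^-1` A = A)//; apply/seteqP; split => x /=; rewrite mk4K.
Qed.

Lemma leb4_oobox_lty a b : (leb4 (oobox a b) < +oo)%E.
Proof.
rewrite leb4_oobox; suff /andP[] : (0 <= \prod_k lebesgue_measure (`]a k, b k[%classic : set R) < +oo)%E by [].
elim/big_ind : _ => [|x y /andP[x0 xy] /andP[y0 yy]|k _].
- by rewrite lee01 ltry.
- by rewrite mule_ge0//= lte_mul_pinfty// ge0_fin_numE.
- rewrite measure_ge0/= lebesgue_measure_itv/=; case: ifPn => // _.
  by rewrite -EFinB ltry.
Qed.

Lemma oobox_sw j a b : sw j @^-1` (oobox a b) =
  oobox (a \o tperm j (inord 3)) (b \o tperm j (inord 3)).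
Proof.
apply/seteqP; split => x /= h k; first by have := h (tperm j (inord 3) k); rewrite co_sw tpermK.
by rewrite co_sw; have := h (tperm j (inord 3) k); rewrite /= tpermK.
Qed.

(** The two measures agree on open boxes, which exhaust the space. *)
Lemma pushforward_sw j (A : set (mR4 R)) : measurable A ->
  pushforward leb4 (sw j : mR4 R -> mR4 R) A = leb4 A.
Proof.
move=> mA.
pose mphi_mixin := isMeasurableFun.Build _ _ _ _ _ (measurable_sw j).
pose phi : {mfun mR4 R >-> mR4 R} := HB.pack (sw j : mR4 R -> mR4 R) mphi_mixin.
pose m0 : {measure set (mR4 R) -> \bar R} := pushforward leb4 phi.
pose m' := m0 (measurable_sw j).
suff h : forall B, ooboxes B -> m' B = leb4 B.
  apply: (@measure_unique _ R (mR4 R) ooboxes (fun n => oobox (fun=> - n%:R) (fun=> n%:R))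
    measurable_mR4E setI_closed_ooboxes _ bigcup_oobox m' leb4 h _ A mA).
  - by move=> n; exists (fun=> - n%:R), (fun=> n%:R).
  - move=> n; rewrite h; last by exists (fun=> - n%:R), (fun=> n%:R).
    exact: leb4_oobox_lty.
move=> _ [a [b ->]]; rewrite /m'/= /pushforward oobox_sw !leb4_oobox.
by rewrite [RHS](reindex_inj (@perm_inj _ (tperm j (inord 3)))).
Qed.

End Coordinates.

Section LineIntegrals.
Context {R : realType}.
Implicit Types (x : R4 R) (j k : 'I_4) (a b : 'I_4 -> R) (s t : R).
Lemma integral_sw j (f : mR4 R -> \bar R) : measurable_fun [set: mR4 R] f ->
  (forall x, 0 <= f x)%E ->
  (\int[leb4]_x f (sw j x) = \int[leb4]_x f x)%E.
Proof.
move=> mf f0.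
have := @ge0_integral_pushforward _ _ _ _ R _ (measurable_sw j) leb4 _ f measurableT mf.
rewrite preimage_setT => /(_ (fun x _ => f0 x)) H.
apply: (etrans _ (etrans (esym H) _)); first by apply: eq_integral.
by apply: eq_measure_integral => [|mf' A mA _]; [exact: measurable_sw|exact: pushforward_sw].
Qed.

Lemma integrable_sw j (f : mR4 R -> \bar R) : leb4.-integrable [set: mR4 R] f ->
  leb4.-integrable [set: mR4 R] (fun x : mR4 R => f (sw j x)).
Proof.
move=> /integrableP[mf fi]; apply/integrableP; split.
  exact: (measurableT_comp mf (measurable_sw j)).
by rewrite (@integral_sw j (fun x => `|f x|)%E)//; exact: measurableT_comp.
Qed.

Lemma integral_sw_signed j (f : mR4 R -> \bar R) : measurable_fun [set: mR4 R] f ->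
  (\int[leb4]_x f (sw j x) = \int[leb4]_x f x)%E.
Proof.
move=> mf; rewrite integralE [RHS]integralE.
have P := integral_sw j (measurable_funepos mf) (funepos_ge0 f).
have N := integral_sw j (measurable_funeneg mf) (funeneg_ge0 f).
by congr (_ - _)%E; [apply: (etrans _ P)|apply: (etrans _ N)];
  apply: eq_integral => x _; rewrite ?funeposE ?funenegE.
Qed.

Lemma ae_sw j (P : R4 R -> Prop) : {ae leb4, forall x : mR4 R, P x} ->
  {ae leb4, forall x : mR4 R, P (sw j x)}.
Proof.
move=> [N [mN N0 PN]]; exists (sw j @^-1` N : set (mR4 R)); split.
- by rewrite -[X in measurable X]setTI; exact: measurable_sw.
- by rewrite -N0; exact: pushforward_sw.
- by move=> x /= Px; exact: PN.
Qed.

Lemma oobox_in_open (O : set (R4 R)) x : open O -> O x ->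
  exists a b : 'I_4 -> rat,
    oobox (ratr \o a) (ratr \o b) x /\ oobox (ratr \o a) (ratr \o b) `<=` O.
Proof.
move=> oO Ox; have /nbhs_ballP[e/= e0 eO] : nbhs x O by exact: open_nbhs_nbhs.
have ha k : exists q : rat, ratr q \in `]co x k - e, co x k[.
  have [|q qk] := @rat_in_itvoo R (co x k - e) (co x k); last by exists q.
  by rewrite ltrBlDr ltrDl.
have hb k : exists q : rat, ratr q \in `]co x k, co x k + e[.
  have [|q qk] := @rat_in_itvoo R (co x k) (co x k + e); last by exists q.
  by rewrite ltrDl.
have /choice[a ax] := ha; have /choice[c cx] := hb.
exists a, c; split=> [k|y xy].
  by have := ax k; have := cx k; rewrite !in_itv/= => /andP[-> _] /andP[_ ->].
apply: eO.
have h k : ball (co x k) e (co y k).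
  have := xy k; have := ax k; have := cx k.
  rewrite !in_itv/= => /andP[_ rx] /andP[xq _] /andP[qy yr].
  by rewrite -ball_normE/= ltr_distl; apply/andP; split; lra.
have := h (inord 0); have := h (inord 1); have := h (inord 2).
by have := h (inord 3); rewrite /co !inordK.
Qed.

(** An open set is a union of boxes with rational corners, and there are
    countably many of these. *)
Lemma open_measurable4 (O : set (R4 R)) : open O -> measurable (O : set (mR4 R)).
Proof.
move=> oO.
pose F (n : nat) : set (mR4 R) :=
  if unpickle n is Some ab then
    let B := oobox (ratr \o (ab.1 : {ffun 'I_4 -> rat})) (ratr \o (ab.2 : {ffun 'I_4 -> rat})) in
    if `[< B `<=` O >] then B else set0 else set0.
suff -> : O = \bigcup_n F n.
  apply: bigcupT_measurable => n; rewrite /F; case: unpickle => // ab.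
  by case: ifPn => // _; exact: measurable_oobox.
apply/seteqP; split => [x Ox|x [n _]]; last first.
  by rewrite /F; case: unpickle => // ab; case: ifPn => // /asboolP; exact.
have [a [b [xab abO]]] := oobox_in_open oO Ox.
exists (pickle ([ffun k => a k], [ffun k => b k])) => //.
rewrite /F pickleK/=.
have E (f : 'I_4 -> rat) : ratr \o [ffun k => f k] = ratr \o f :> ('I_4 -> R).
  by apply/funext => k /=; rewrite ffunE.
by rewrite !E; case: asboolP.
Qed.

Lemma continuous_measurable4 (f : R4 R -> R) : continuous f -> measurable_fun [set: mR4 R] f.
Proof.
move=> cf; apply: (measurability _ (RGenOpens.measurableE R)).
move=> _ [_ [a [b ->]] <-]; rewrite setTI.
by apply: open_measurable4; apply: open_comp => //; exact: interval_open.
Qed.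

Local Open Scope ereal_scope.

(** The integral over the line through x in direction j. It stays a function
    of the whole point, so that line integrals in different directions can be
    iterated and multiplied. *)
Definition lint j (F : R4 R -> \bar R) : R4 R -> \bar R :=
  fun x => \int[lebesgue_measure]_s F (upd x j s).

Lemma measurable_lint j (F : mR4 R -> \bar R) : measurable_fun [set: mR4 R] F ->
  (forall x, 0 <= F x) -> measurable_fun [set: mR4 R] (lint j F : mR4 R -> \bar R).
Proof.
move=> mF F0.
have := @measurable_fun_fubini_tonelli_F _ _ (mR4 R) (measurableTypeR R) R
  (@lebesgue_measure R) (fun xs => F (upd xs.1 j xs.2)).
by apply=> //; exact: (measurableT_comp mF (measurable_upd j)).
Qed.

Lemma lint_ge0 j (F : R4 R -> \bar R) : (forall x, 0 <= F x) -> forall x, 0 <= lint j F x.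
Proof. by move=> F0 x; exact: integral_ge0. Qed.

Lemma lint_upd j (F : R4 R -> \bar R) x s : lint j F (upd x j s) = lint j F x.
Proof. by apply: eq_integral => t _; rewrite upd_upd. Qed.

Lemma measurable_upd3 i j x :
  measurable_fun [set: measurableTypeR R * measurableTypeR R]
    ((fun st => upd (upd x i st.1) j st.2) : _ -> mR4 R).
Proof.
apply: measurable_mk4 => k; case: (k == j); first exact: measurable_snd.
rewrite (_ : (fun _ => _) = (fun st : measurableTypeR R * measurableTypeR R => if k == i then st.1 else co x k)); last first.
  by apply/funext => st; rewrite co_upd.
by case: (k == i); [exact: measurable_fst|exact: measurable_cst].
Qed.

Lemma lintC i j (F : mR4 R -> \bar R) x : measurable_fun [set: mR4 R] F ->
  (forall x, 0 <= F x) -> lint i (lint j F) x = lint j (lint i F) x.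
Proof.
move=> mF F0; have [->//|ij] := eqVneq i j.
have := @fubini_tonelli _ _ (measurableTypeR R) (measurableTypeR R) R
  (@lebesgue_measure R) (@lebesgue_measure R) (fun st => F (upd (upd x i st.1) j st.2)).
move=> /(_ (measurableT_comp mF (measurable_upd3 i j x)) (fun=> F0 _)) H.
apply: (etrans H).
by apply: eq_integral => t _; apply: eq_integral => s _ /=; rewrite updC.
Qed.

Lemma integral_lint (F : mR4 R -> \bar R) x : measurable_fun [set: mR4 R] F ->
  (forall x, 0 <= F x) ->
  \int[leb4]_x F x =
  lint (inord 0) (lint (inord 1) (lint (inord 2) (lint (inord 3) F))) x.
Proof.
move=> mF F0.
have H3 : \int[leb4]_x F x = \int[leb3]_y \int[lebesgue_measure]_t F (y, t).
  exact: (@fubini_tonelli1 _ _ _ _ _ leb3 (@lebesgue_measure R) F mF F0).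
pose G (y : mR3 R) := \int[lebesgue_measure]_t F (y, t).
have mG : measurable_fun [set: mR3 R] G.
  exact: (@measurable_fun_fubini_tonelli_F _ _ _ _ _ (@lebesgue_measure R) F).
have G0 y : 0 <= G y by exact: integral_ge0.
have H2 : \int[leb3]_y G y = \int[leb2]_z \int[lebesgue_measure]_t G (z, t).
  exact: (@fubini_tonelli1 _ _ _ _ _ leb2 (@lebesgue_measure R) G mG G0).
pose H (z : (measurableTypeR R * measurableTypeR R)%type) := \int[lebesgue_measure]_t G (z, t).
have mH : measurable_fun [set: measurableTypeR R * measurableTypeR R] H.
  exact: (@measurable_fun_fubini_tonelli_F _ _ _ _ _ (@lebesgue_measure R) G).
have H0 y : 0 <= H y by exact: integral_ge0.
have H1 : \int[leb2]_y H y = \int[lebesgue_measure]_z \int[lebesgue_measure]_t H (z, t).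
  exact: (@fubini_tonelli1 _ _ _ _ _ (@lebesgue_measure R) (@lebesgue_measure R) H mH H0).
rewrite H3; apply: (etrans H2); apply: (etrans H1).
apply: eq_integral => a _; apply: eq_integral => b _; apply: eq_integral => c _.
apply: eq_integral => d _; congr F.
by apply: co_inj => k; rewrite !co_upd; elim/ord4P: k; rewrite -!val_eqE /= !inordK// /co inordK.
Qed.

End LineIntegrals.

(** * The fundamental lemma of the calculus of variations *)

Section PiSystem.
Context d (T : measurableType d) (R : realType) (mu : {measure set T -> \bar R}).
Local Open Scope ereal_scope.

(** The sets over which h has integral 0 form a Dynkin system. *)
Lemma integral_eq0_pi_system (G : set (set T)) (D : set T) (h : T -> \bar R) :
  @measurable _ T = <<s G >> -> setI_closed G -> measurable D ->
  mu.-integrable D h -> \int[mu]_(x in D) h x = 0 ->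
  (forall B, G B -> \int[mu]_(x in D `&` B) h x = 0) ->
  ae_eq mu D h (cst 0).
Proof.
move=> mG IG mD ih hD hG; have mh := measurable_int _ ih.
suff H B : measurable B -> \int[mu]_(x in D `&` B) h x = 0.
  apply: integral_ae_eq => // E ED mE.
  by rewrite -(setIidr ED) H// integral0.
rewrite mG; move: B.
apply: (dynkin_induction (P := fun B => \int[mu]_(x in D `&` B) h x = 0) mG IG) => //.
- by rewrite setIT.
- move=> S mS hS.
  have : \int[mu]_(x in (D `&` S) `|` (D `&` ~` S)) h x = 0.
    by rewrite -setIUr setUv setIT.
  rewrite integral_setU ?hS ?add0e//.
  + exact: measurableI.
  + by apply: measurableI => //; exact: measurableC.
  + by rewrite -setIUr setUv setIT.
  + by apply/disj_setPS; rewrite setIACA setICr setI0.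
- move=> F mF tF hF; rewrite setI_bigcupr integral_bigcup//.
  + by rewrite eseries0// => i _ _; exact: hF.
  + exact: trivIset_setIl.
  + by move=> k; exact: measurableI.
  + apply: integrableS ih => //; last by move=> x [k _ []].
    by apply: bigcupT_measurable => k; exact: measurableI.
Qed.

Lemma integral_cvg_indic (D B : set T) (h : T -> R) (b : nat -> T -> R) :
  measurable D -> measurable B -> mu.-integrable D (EFin \o h) ->
  (forall n, measurable_fun [set: T] (b n)) ->
  (forall n x, (0 <= b n x <= 1)%R) ->
  (forall x, b n x @[n --> \oo] --> (\1_B x : R)) ->
  (forall n, \int[mu]_(x in D) (h x * b n x)%:E = 0) ->
  \int[mu]_(x in D `&` B) (h x)%:E = 0.
Proof.
move=> mD mB ih mb b01 bB hb.
have mh : measurable_fun D h by apply/measurable_EFinP; exact: measurable_int ih.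
have [] := @dominated_convergence _ _ _ mu D mD (fun n x => (h x * b n x)%:E)
  (fun x => (h x * \1_B x)%:E) (fun x => `|h x|%:E).
- by move=> n; apply/measurable_EFinP/measurable_funM => //; exact: measurable_funTS.
- by apply/measurable_EFinP/measurable_funM => //; exact: measurable_indic.
- apply: aeW => x Dx; apply: cvg_EFin; first exact: nearW.
  by apply: cvgMr; exact: bB.
- exact: integrable_norm.
- apply: aeW => x n Dx; rewrite lee_fin normrM ler_piMr//.
  by rewrite ger0_norm; have /andP[] := b01 n x.
move=> _ _; under eq_fun do rewrite hb.
move=> /cvg_lim; rewrite lim_cst// => /(_ (@ereal_hausdorff _))/esym.
rewrite integral_mkcondr => H; rewrite -[RHS]H; apply: eq_integral => x _.
rewrite patchE indicE; case: ifPn => _; first by rewrite mulr1.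
by rewrite mulr0.
Qed.

End PiSystem.

Section DuBoisReymond.
Context {R : realType}.
Implicit Types (x : R4 R) (j k : 'I_4) (a b : 'I_4 -> R) (N : R).

Definition prodf (psi : 'I_4 -> R -> R) : R4 R -> R :=
  fun x => \prod_k psi k (co x k).

Definition bump4 a b n := prodf (fun k => bump (a k) (b k) n).

Definition cube N : set (R4 R) := oobox (fun=> - N) (fun=> N).

Lemma measurable_prodf (psi : 'I_4 -> R -> R) :
  (forall k, measurable_fun [set: R] (psi k)) ->
  measurable_fun [set: mR4 R] (prodf psi).
Proof.
move=> mpsi; apply: measurable_prod => k _.
exact: (measurableT_comp (mpsi k) (measurable_co k)).
Qed.

Lemma measurable_bump (u v : R) n : measurable_fun [set: R] (bump u v n).
Proof.
apply: continuous_measurable_fun => x; apply: differentiable_continuous.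
by apply/derivable1_diffP; exact: Cn_derivable (smooth1_bump u v n 0).
Qed.

Lemma bump4_cvg a b x : bump4 a b n x @[n --> \oo] --> (\1_(oobox a b) x : R).
Proof.
have -> : \1_(oobox a b) x = \prod_(k < 4) (\1_`]a k, b k[ (co x k) : R).
  rewrite indicE; have [xab|xab] := boolP (x \in oobox a b).
    rewrite big1// => k _; rewrite indicE mem_set//=.
    by move/set_mem: xab => /(_ k); rewrite in_itv.
  apply/esym/eqP/prodf_eq0.
  have [k xk] : exists k, ~~ (a k < co x k < b k).
    apply: contrapT => h; move: xab; rewrite notin_setE; apply => k.
    by apply: contrapT => /negP hk; apply: h; exists k.
  exists k => //; rewrite indicE memNset// /= in_itv/=; exact/negP.
rewrite /bump4 /prodf !big_ord_recr big_ord0 /=.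
under eq_fun do rewrite !big_ord_recr big_ord0 /=.
by do 4 (apply: cvgM; last exact: bump_cvg); exact: cvg_cst.
Qed.

(** Products of bumps converge to the indicators of open boxes, so h has
    integral 0 over every box and then over every measurable set. Boxes are
    first cut down to the cube, which is why tests inside the cube suffice. *)
Lemma dubois_reymond N (h : mR4 R -> R) : leb4.-integrable (cube N) (EFin \o h) ->
  (forall a b n, (forall k, - N <= a k /\ b k <= N) ->
    (\int[leb4]_(x in cube N) (h x * bump4 a b n x)%:E)%E = 0%E) ->
  ae_eq leb4 (cube N) h (cst 0).
Proof.
move=> ih hb.
have mD : measurable (cube N : set (mR4 R)) by exact: measurable_oobox.
have H a b : (\int[leb4]_(x in cube N `&` oobox a b) (h x)%:E = 0)%E.
  have -> : cube N `&` oobox a b = cube N `&`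
      oobox (fun k => Num.max (- N) (a k)) (fun k => Num.min N (b k)).
    apply/seteqP; split => x [xN xab]; split => // k;
      have := xN k; have := xab k; rewrite gt_max lt_min.
      by move=> /andP[-> ->] /andP[-> ->].
    by move=> /andP[/andP[_ ->] /andP[_ ->]].
  apply: (@integral_cvg_indic _ _ _ leb4 _ _ _ (bump4 (fun k => Num.max (- N) (a k)) (fun k => Num.min N (b k)))) => //.
  - exact: measurable_oobox.
  - by move=> n; apply: measurable_prodf => k; exact: measurable_bump.
  - move=> n x; rewrite prodr_ge0/=; last by move=> k _; exact: bump_ge0.
    by apply: prodr_ile1 => k _; rewrite bump_ge0 bump_le1.
  - exact: bump4_cvg.
  - by move=> n; apply: hb => k; rewrite le_max lexx ge_min lexx.
have ae0 : ae_eq leb4 (cube N) (EFin \o h) (cst 0)%E.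
  apply: (integral_eq0_pi_system (measurable_mR4E (R:=R)) setI_closed_ooboxes) => //.
    by have := H (fun=> - N) (fun=> N); rewrite setIid.
  by move=> _ [a [b ->]]; exact: H.
by apply: filterS ae0 => x /= h0 Dx; have [] := h0 Dx.
Qed.

End DuBoisReymond.

(** * Hoelder's inequality and the Loomis-Whitney inequality *)

Section Hoelder.
Context d (T : measurableType d) (R : realType) (mu : {measure set T -> \bar R}).
Implicit Types (f g h : T -> \bar R) (a b : R).
Local Open Scope ereal_scope.

Lemma measurable_poweRT f a : measurable_fun [set: T] f ->
  measurable_fun [set: T] (fun x => f x `^ a).
Proof. by move=> mf; apply: (measurableT_comp (measurable_poweR a) mf). Qed.

Lemma hoelder_fin (f g : T -> R) a b : measurable_fun [set: T] f -> measurable_fun [set: T] g ->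
  (forall x, 0 <= f x)%R -> (forall x, 0 <= g x)%R ->
  (0 < a)%R -> (0 < b)%R -> (a + b = 1)%R ->
  \int[mu]_x ((f x)%:E `^ a * (g x)%:E `^ b) <=
  (\int[mu]_x (f x)%:E) `^ a * (\int[mu]_x (g x)%:E) `^ b.
Proof.
move=> mf mg f0 g0 a0 b0 ab.
have mp (u : T -> R) c : measurable_fun [set: T] u -> measurable_fun [set: T] (fun x => u x `^ c)%R.
  by move=> mu'; apply: (measurableT_comp (measurable_powR c) mu').
have := @hoelder _ _ _ mu _ _ _ _ (mp f a mf) (mp g b mg) _ _ _.
move=> /(_ a^-1 b^-1)%R; rewrite !invr_gt0 !invrK => /(_ a0 b0 ab).
have E (u : T -> R) c : (0 < c)%R -> (forall x, 0 <= u x)%R ->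
    Lnorm mu (c^-1)%:E (EFin \o (fun x => u x `^ c)%R) = (\int[mu]_x (u x)%:E) `^ c.
  move=> c0 u0; rewrite unlock invrK; congr (_ `^ _); apply: eq_integral => x _ /=.
  by rewrite ger0_norm ?powR_ge0// -powRrM mulfV ?gt_eqF// powRr1.
rewrite (E f a a0 f0) (E g b b0 g0) Lnorm1 => H; apply: (le_trans _ H).
rewrite le_eqVlt; apply/orP; left; apply/eqP; apply: eq_integral => x _.
by rewrite !poweR_EFin -EFinM /= ger0_norm// mulr_ge0 ?powR_ge0.
Qed.

(** Here a and b are the reciprocals of the conjugate exponents, and infinite
    values are allowed, since line integrals are extended reals. *)
Lemma hoelder_ge0 f g a b : measurable_fun [set: T] f -> measurable_fun [set: T] g ->
  (forall x, 0 <= f x) -> (forall x, 0 <= g x) ->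
  (0 < a)%R -> (0 < b)%R -> (a + b = 1)%R ->
  \int[mu]_x (f x `^ a * g x `^ b) <= (\int[mu]_x f x) `^ a * (\int[mu]_x g x) `^ b.
Proof.
move=> mf mg f0 g0 a0 b0 ab.
have mfg : measurable_fun [set: T] (fun x => f x `^ a * g x `^ b).
  by apply: emeasurable_funM; exact: measurable_poweRT.
have an0 : (a != 0)%R by rewrite gt_eqF.
have bn0 : (b != 0)%R by rewrite gt_eqF.
have If0 : 0 <= \int[mu]_x f x by exact: integral_ge0.
have Ig0 : 0 <= \int[mu]_x g x by exact: integral_ge0.
have zero (u v : T -> \bar R) c e : measurable_fun [set: T] u -> (forall x, 0 <= u x) ->
    (c != 0)%R -> \int[mu]_x u x = 0 -> {ae mu, forall x, u x `^ c * v x `^ e = 0}.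
  move=> mu' u0 c0 iu.
  have : ae_eq mu setT u (cst 0).
    apply/(ae_eq_integral_abs mu measurableT mu').
    by rewrite -[RHS]iu; apply: eq_integral => x _; rewrite gee0_abs.
  by apply: filterS => x /(_ I) ->; rewrite poweR0r// mul0e.
have az : {ae mu, forall x, f x `^ a * g x `^ b = 0} ->
    \int[mu]_x (f x `^ a * g x `^ b) <= (\int[mu]_x f x) `^ a * (\int[mu]_x g x) `^ b.
  move=> h; rewrite (ae_eq_integral (cst 0)) ?integral0//.
    by rewrite mule_ge0// poweR_ge0.
  by apply: filterS h => x h _.
have [f00|fn0] := eqVneq (\int[mu]_x f x) 0; first by apply: az; exact: zero.
have [g00|gn0] := eqVneq (\int[mu]_x g x) 0.
  by apply: az; apply: filterS (zero g f b a mg g0 bn0 g00) => x; rewrite muleC.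
have fp : 0 < \int[mu]_x f x by rewrite lt0e fn0.
have gp : 0 < \int[mu]_x g x by rewrite lt0e gn0.
have [fy|fy] := eqVneq (\int[mu]_x f x) +oo.
  by rewrite fy poweRyr// gt0_mulye ?leey// poweR_gt0.
have [gy|gy] := eqVneq (\int[mu]_x g x) +oo.
  by rewrite gy poweRyr// gt0_muley ?leey// poweR_gt0.
have intf (u : T -> \bar R) : measurable_fun [set: T] u -> (forall x, 0 <= u x) ->
    \int[mu]_x u x != +oo -> {ae mu, forall x, (fine (u x))%:E = u x}.
  move=> mu' u0 uy; have : mu.-integrable setT u.
    apply/integrableP; split => //; rewrite ltey.
    by under eq_integral do rewrite gee0_abs//.
  by move=> /(integrable_ae measurableT); apply: filterS => x /(_ I) h; rewrite fineK.
have aef := intf f mf f0 fy; have aeg := intf g mg g0 gy.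
have mF : measurable_fun [set: T] (fine \o f) by exact: measurableT_comp.
have mG : measurable_fun [set: T] (fine \o g) by exact: measurableT_comp.
have F0 x : (0 <= fine (f x))%R by rewrite fine_ge0.
have G0 x : (0 <= fine (g x))%R by rewrite fine_ge0.
have := hoelder_fin mF mG F0 G0 a0 b0 ab.
have -> : \int[mu]_x ((fine \o f) x)%:E = \int[mu]_x f x.
  apply: ae_eq_integral => //; first exact/measurable_EFinP.
  by apply: filterS aef => x.
have -> : \int[mu]_x ((fine \o g) x)%:E = \int[mu]_x g x.
  apply: ae_eq_integral => //; first exact/measurable_EFinP.
  by apply: filterS aeg => x.
apply: le_trans; rewrite le_eqVlt; apply/orP; left; apply/eqP.
apply: ae_eq_integral => //.
  by apply: emeasurable_funM; apply: measurable_poweRT; exact/measurable_EFinP.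
apply: filterS2 aef aeg => x fx gx _.
by rewrite -[in LHS]fx -[in LHS]gx.
Qed.

Lemma hoelder3 f g h : measurable_fun [set: T] f -> measurable_fun [set: T] g ->
  measurable_fun [set: T] h ->
  (forall x, 0 <= f x) -> (forall x, 0 <= g x) -> (forall x, 0 <= h x) ->
  \int[mu]_x (f x `^ 3^-1 * g x `^ 3^-1 * h x `^ 3^-1) <=
  (\int[mu]_x f x) `^ 3^-1 * (\int[mu]_x g x) `^ 3^-1 * (\int[mu]_x h x) `^ 3^-1.
Proof.
move=> mf mg mh f0 g0 h0.
have ph (x y : \bar R) : 0 <= x -> 0 <= y ->
    (x `^ 2^-1 * y `^ 2^-1) `^ (2 / 3) = x `^ 3^-1 * y `^ 3^-1.
  move=> x0 y0; rewrite poweRM ?poweR_ge0// -!poweRrM.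
  by rewrite (_ : 2^-1 * (2 / 3) = 3^-1 :> R)%R//; field.
have mgh : measurable_fun [set: T] (fun x => g x `^ 2^-1 * h x `^ 2^-1).
  by apply: emeasurable_funM; exact: measurable_poweRT.
have gh0 x : 0 <= g x `^ 2^-1 * h x `^ 2^-1 by rewrite mule_ge0 ?poweR_ge0.
have a0 : (0 < 3^-1 :> R)%R by lra.
have b0 : (0 < 2 / 3 :> R)%R by lra.
have h0' : (0 < 2^-1 :> R)%R by lra.
have ab : (3^-1 + 2 / 3 = 1 :> R)%R by field.
have hh : (2^-1 + 2^-1 = 1 :> R)%R by field.
under eq_integral do rewrite -muleA -ph//.
apply: (le_trans (hoelder_ge0 mf mgh f0 gh0 a0 b0 ab)).
rewrite -muleA; apply: lee_pmul; rewrite ?poweR_ge0//.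
rewrite -ph ?integral_ge0//; apply: (gt0_ler_poweR (ltW b0)).
- by rewrite in_itv/= leey andbT integral_ge0.
- by rewrite in_itv/= leey andbT mule_ge0// poweR_ge0.
- exact: (hoelder_ge0 mg mh g0 h0 h0' h0' hh).
Qed.

End Hoelder.

Section LoomisWhitney.
Context {R : realType}.
Implicit Types (x : R4 R) (i j k : 'I_4) (F : R4 R -> \bar R).
Local Open Scope ereal_scope.

(** Names the three directions other than i, so that [hoelder3] applies to a
    product over them. *)
Lemma prod_others i : exists u v w : 'I_4, [/\ u != i, v != i, w != i &
  forall f : 'I_4 -> \bar R, \prod_(k | k != i) f k = f u * f v * f w].
Proof.
have key (u v w : 'I_4) : uniq [:: i; u; v; w] ->
    [/\ u != i, v != i, w != i &
     forall f : 'I_4 -> \bar R, \prod_(k | k != i) f k = f u * f v * f w].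
  move=> Hu; have : [&& i != u, i != v & i != w].
    by move: Hu; rewrite /= !inE !negb_or => /andP[].
  move=> /and3P[iu iv iw]; split; rewrite 1?eq_sym// => f.
  have uvw : perm_eq [seq k <- index_enum 'I_4 | k != i] [:: u; v; w].
    apply: uniq_perm; first by rewrite filter_uniq// index_enum_uniq.
      by move: Hu => /= /andP[].
    move=> k; rewrite mem_filter mem_index_enum andbT.
    have : k \in [:: i; u; v; w].
      have /subset_cardP : #|[:: i; u; v; w]| = #|'I_4| by rewrite (card_uniqP Hu) card_ord.
      by move=> /(_ (subset_predT _)) ->.
    rewrite inE; case: eqP => [-> _|_ /= ->//].
    by move: Hu => /= /andP[/negPf].
  by rewrite -big_filter (perm_big _ uvw)/= !big_cons big_nil mule1 muleA.
elim/ord4P: i key => key.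
- by exists (inord 1), (inord 2), (inord 3); apply: key; rewrite /= !inE -!val_eqE /= !inordK.
- by exists (inord 0), (inord 2), (inord 3); apply: key; rewrite /= !inE -!val_eqE /= !inordK.
- by exists (inord 0), (inord 1), (inord 3); apply: key; rewrite /= !inE -!val_eqE /= !inordK.
- by exists (inord 0), (inord 1), (inord 2); apply: key; rewrite /= !inE -!val_eqE /= !inordK.
Qed.

Lemma lint_hoelder i (F : 'I_4 -> R4 R -> \bar R) x :
  (forall k, measurable_fun [set: mR4 R] (F k : mR4 R -> \bar R)) ->
  (forall k x, 0 <= F k x) -> (forall x s, F i (upd x i s) = F i x) ->
  lint i (fun x => \prod_k F k x `^ 3^-1) x <=
  \prod_k (if k == i then F k x else lint i (F k) x) `^ 3^-1.
Proof.
move=> mF F0 Fi.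
have mFu k : measurable_fun [set: measurableTypeR R] (fun s => F k (upd x i s)).
  exact: (measurableT_comp (mF k) (measurable_upd2 i x)).
have [u [v [w [ui vi wi P]]]] := prod_others i.
rewrite (bigD1 i)//= eqxx P (negPf ui) (negPf vi) (negPf wi).
rewrite /lint; under eq_integral do rewrite (bigD1 i)//= Fi P.
have mp k := measurable_poweRT 3^-1 (mFu k).
rewrite ge0_integralZl ?poweR_ge0//; last 2 first.
- exact: (emeasurable_funM (emeasurable_funM (mp u) (mp v)) (mp w)).
- by move=> s _; rewrite !mule_ge0 ?poweR_ge0.
apply: lee_pmul; rewrite ?poweR_ge0//.
  by apply: integral_ge0 => s _; rewrite !mule_ge0 ?poweR_ge0.
exact: (hoelder3 _ (mFu u) (mFu v) (mFu w) (fun=> F0 _ _) (fun=> F0 _ _) (fun=> F0 _ _)).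
Qed.

(** The families in the Loomis-Whitney inequality: the k-th member has been
    integrated in direction k, hence is constant along it. *)
Definition own_free (F : 'I_4 -> R4 R -> \bar R) :=
  [/\ forall k, measurable_fun [set: mR4 R] (F k : mR4 R -> \bar R),
      forall k x, 0 <= F k x & forall k x s, F k (upd x k s) = F k x].

Definition lint_others i (F : 'I_4 -> R4 R -> \bar R) k := if k == i then F k else lint i (F k).

Lemma own_free_lint i (F : 'I_4 -> R4 R -> \bar R) : own_free F -> own_free (lint_others i F).
Proof.
move=> [mF F0 Fi]; rewrite /lint_others; split => k.
- by case: ifP => _ //; apply: measurable_lint; [exact: mF|exact: F0].
- by case: ifP => _ x //; apply: lint_ge0; exact: F0.
- case: ifPn => [_|ki] x s //; apply: eq_integral => t _.
  by rewrite updC// Fi.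
Qed.

(** One step of the Loomis-Whitney inequality: the i-th factor is constant in
    direction i and comes out of the integral, and Hoelder's inequality with
    exponents 3, 3, 3 separates the other factors. *)
Lemma lint_prod_le i (F : 'I_4 -> R4 R -> \bar R) (G : R4 R -> \bar R) : own_free F ->
  measurable_fun [set: mR4 R] (G : mR4 R -> \bar R) -> (forall x, 0 <= G x) ->
  (forall x, G x <= \prod_k F k x `^ 3^-1) ->
  forall x, lint i G x <= \prod_k lint_others i F k x `^ 3^-1.
Proof.
move=> [mF F0 Fi] mG G0 GF x.
have mFu k : measurable_fun [set: measurableTypeR R] (fun s => F k (upd x i s)).
  exact: (measurableT_comp (mF k) (measurable_upd2 i x)).
apply: (le_trans _ (le_trans (lint_hoelder x mF F0 (Fi i)) _)).
  apply: ge0_le_integral => //.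
  - exact: (measurableT_comp mG (measurable_upd2 i x)).
  - rewrite (_ : (fun _ => _) = (fun s => F (inord 0) (upd x i s) `^ 3^-1 *
      F (inord 1) (upd x i s) `^ 3^-1 * F (inord 2) (upd x i s) `^ 3^-1 *
      F (inord 3) (upd x i s) `^ 3^-1)); last first.
      apply/funext => s; have [u [v [w [? ? ? P]]]] := prod_others i.
      rewrite !big_ord_recr big_ord0 /= mul1e.
      have e0 : inord 0 = widen_ord (leqnSn 3) (widen_ord (leqnSn 2) (widen_ord (leqnSn 1) ord_max)).
        by apply: val_inj; rewrite /= inordK.
      have e1 : inord 1 = widen_ord (leqnSn 3) (widen_ord (leqnSn 2) ord_max).
        by apply: val_inj; rewrite /= inordK.
      have e2 : inord 2 = widen_ord (leqnSn 3) (ord_max : 'I_3).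
        by apply: val_inj; rewrite /= inordK.
      have e3 : inord 3 = ord_max :> 'I_4 by apply: val_inj; rewrite /= inordK.
      by rewrite -e0 -e1 -e2 -e3.
    have mp k := measurable_poweRT 3^-1 (mFu k).
    exact: (emeasurable_funM (emeasurable_funM (emeasurable_funM (mp _) (mp _)) (mp _)) (mp _)).
by rewrite le_eqVlt; apply/orP; left; apply/eqP; apply: eq_bigr => k _; rewrite /lint_others; case: ifP.
Qed.

(** Integrate in the four directions in turn: at the end each A k has been
    integrated once in every direction, the direction k having been there from
    the start. *)
Lemma loomis_whitney (A : 'I_4 -> R4 R -> \bar R) :
  (forall k, measurable_fun [set: mR4 R] (A k : mR4 R -> \bar R)) ->
  (forall k x, 0 <= A k x) ->
  \int[leb4]_x \prod_k (lint k (A k) x) `^ 3^-1 <=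
  \prod_k (\int[leb4]_x A k x) `^ 3^-1.
Proof.
move=> mA A0.
have lC i j F : measurable_fun [set: mR4 R] (F : mR4 R -> \bar R) -> (forall x, 0 <= F x) ->
    lint i (lint j F) = lint j (lint i F).
  by move=> mF F0; apply/funext => x; exact: lintC.
have mL i F : measurable_fun [set: mR4 R] (F : mR4 R -> \bar R) -> (forall x, 0 <= F x) ->
    measurable_fun [set: mR4 R] (lint i F : mR4 R -> \bar R) /\ (forall x, 0 <= lint i F x).
  by move=> mF F0; split; [exact: measurable_lint|exact: lint_ge0].
pose J k := lint k (A k).
have gJ : own_free J.
  split => k; [by have [] := mL k _ (mA k) (A0 k)|by have [] := mL k _ (mA k) (A0 k)|].
  by move=> x s; rewrite /J lint_upd.
pose G x := \prod_k J k x `^ 3^-1.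
have G0 x : 0 <= G x by apply: prode_ge0 => k _; exact: poweR_ge0.
have mG : measurable_fun [set: mR4 R] (G : mR4 R -> \bar R).
  have mp k := measurable_poweRT 3^-1 (let: And3 mJ _ _ := gJ in mJ k).
  have [u [v [w [ui vi wi P]]]] := prod_others (inord 0).
  rewrite (_ : G = fun x => J (inord 0) x `^ 3^-1 * (J u x `^ 3^-1 * J v x `^ 3^-1 * J w x `^ 3^-1)).
    exact: (emeasurable_funM (mp _) (emeasurable_funM (emeasurable_funM (mp _) (mp _)) (mp _))).
  by apply/funext => x; rewrite /G (bigD1 (inord 0))//= P.
have [mG3 G30] := mL (inord 3) _ mG G0.
have [mG2 G20] := mL (inord 2) _ mG3 G30.
have [mG1 G10] := mL (inord 1) _ mG2 G20.
have g3 := own_free_lint (inord 3) gJ; have g2 := own_free_lint (inord 2) g3.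
have g1 := own_free_lint (inord 1) g2.
have x0 : R4 R := mk4 (fun=> 0%R).
have H3 := lint_prod_le (inord 3) gJ mG G0 (fun=> lexx _).
have H2 := lint_prod_le (inord 2) g3 mG3 G30 H3.
have H1 := lint_prod_le (inord 1) g2 mG2 G20 H2.
have H0 := lint_prod_le (inord 0) g1 mG1 G10 H1 x0.
rewrite (integral_lint x0 mG G0); apply: (le_trans H0).
rewrite le_eqVlt; apply/orP; left; apply/eqP; apply: eq_bigr => k _; congr (_ `^ _).
rewrite (integral_lint x0 (mA k) (A0 k)).
have [ma a0] := (mA k, A0 k).
have ne (m n : nat) : (m < 4)%N -> (n < 4)%N ->
    m != n -> (inord m == inord n :> 'I_4) = false.
  by move=> m4 n4 /negPf mn; rewrite -val_eqE /= !inordK.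
rewrite /lint_others /J; elim/ord4P: k ma a0 => ma a0.
- rewrite eqxx ?(ne 0%N 1%N isT isT isT) ?(ne 0%N 2%N isT isT isT) ?(ne 0%N 3%N isT isT isT).
  have [m3 p3] := mL (inord 3) _ ma a0; have [m2 p2] := mL (inord 2) _ m3 p3.
  by rewrite (lC (inord 3) (inord 0) _ ma a0) (lC (inord 2) (inord 0) _ m3 p3) (lC (inord 1) (inord 0) _ m2 p2).
- rewrite eqxx ?(ne 1%N 0%N isT isT isT) ?(ne 1%N 2%N isT isT isT) ?(ne 1%N 3%N isT isT isT).
  have [m3 p3] := mL (inord 3) _ ma a0.
  by rewrite (lC (inord 3) (inord 1) _ ma a0) (lC (inord 2) (inord 1) _ m3 p3).
- by rewrite eqxx ?(ne 2%N 0%N isT isT isT) ?(ne 2%N 1%N isT isT isT) ?(ne 2%N 3%N isT isT isT) (lC (inord 3) (inord 2) _ ma a0).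
- by rewrite eqxx ?(ne 3%N 0%N isT isT isT) ?(ne 3%N 1%N isT isT isT) ?(ne 3%N 2%N isT isT isT).
Qed.

End LoomisWhitney.

(** * A chain rule inequality along lines *)

Lemma ae_mono d (T : measurableType d) (R : realType)
  (mu : {measure set T -> \bar R}) (P Q : T -> Prop) :
  (forall x, P x -> Q x) -> {ae mu, forall x, P x} -> {ae mu, forall x, Q x}.
Proof. by move=> PQ; apply: filterS. Qed.

Lemma ae_mono2 d (T : measurableType d) (R : realType)
  (mu : {measure set T -> \bar R}) (P Q S : T -> Prop) :
  (forall x, P x -> Q x -> S x) -> {ae mu, forall x, P x} ->
  {ae mu, forall x, Q x} -> {ae mu, forall x, S x}.
Proof. by move=> PQ; apply: filterS2. Qed.

Lemma ae_forall_ord d (T : measurableType d) (R : realType)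
  (mu : {measure set T -> \bar R}) n (P : 'I_n -> T -> Prop) :
  (forall j, {ae mu, forall x, P j x}) -> {ae mu, forall x, forall j, P j x}.
Proof.
move=> Pj.
have : {ae mu, forall x, forall m, forall j : 'I_n, j = m :> nat -> P j x}.
  apply: ae_foralln => m; have [mn|nm] := ltnP m n.
    apply: (ae_mono _ (Pj (Ordinal mn))) => x Px j jm.
    by rewrite (_ : j = Ordinal mn)//; exact: val_inj.
  by apply: aeW => x j jm; have := ltn_ord j; rewrite jm ltnNge nm.
by apply: ae_mono => x Px j; exact: (Px j).
Qed.

Section ChainRule.
Context {R : realType}.
Notation leb := (@lebesgue_measure R).
Variables (Phi L : R -> R).
Hypothesis L0 : forall s, 0 <= L s.
Hypothesis cL : continuous L.
Hypothesis PhiL : forall a b, `|Phi a - Phi b| <= Num.max (L a) (L b) * `|a - b|.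

Section OnInterval.
Variables (A B : R) (h v : R -> R).
Hypothesis ch : {in `]A, B[, continuous h}.
Hypothesis v0 : forall s, 0 <= v s.
Hypothesis mv : measurable_fun [set: R] v.
Hypothesis hv : forall a b, A < a -> a <= b -> b < B ->
  (`|h b - h a|%:E <= \int[leb]_(r in `]a, b]) (v r)%:E)%E.

Let w r := L (h r).

Let cw x : A < x < B -> {for x, continuous w}.
Proof.
by move=> xAB; apply: continuous_comp; [apply: ch; rewrite in_itv|exact: cL].
Qed.

Let mwv (c : R) a b : A < a -> b < B ->
  measurable_fun `]a, b] (fun r => ((w r + c) * v r)%:E).
Proof.
move=> Aa bB; apply: (@measurable_funS _ _ _ _ `]A, B[) => //.
  by move=> x /=; rewrite !in_itv/= => /andP[ax xb]; rewrite (lt_trans Aa)//= (le_lt_trans xb).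
apply/measurable_EFinP; apply: measurable_funM; last exact: measurable_funTS.
apply: measurable_funD => //.
apply: open_continuous_measurable_fun => [|x]; first exact: interval_open.
by rewrite mem_setE in_itv/= => xAB; exact: cw.
Qed.

Let short (e : R) a b : A < a -> a <= b -> b < B -> 0 < e ->
  (forall r, a <= r <= b -> w a <= w r + e /\ w b <= w r + e) ->
  (`|Phi (h b) - Phi (h a)|%:E <= \int[leb]_(r in `]a, b]) ((w r + e) * v r)%:E)%E.
Proof.
move=> Aa ab bB e0 we.
apply: (@le_trans _ _ ((Num.max (w b) (w a))%:E * \int[leb]_(r in `]a, b]) (v r)%:E)%E).
  apply: le_trans (_ : (Num.max (w b) (w a) * `|h b - h a|)%:E <= _)%E.
    by rewrite lee_fin PhiL.
  rewrite EFinM lee_wpmul2l ?lee_fin ?le_max ?L0//; exact: hv.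
rewrite -ge0_integralZl//; last 3 first.
- by apply/measurable_EFinP; exact: measurable_funTS.
- by move=> r _; rewrite lee_fin.
- by rewrite lee_fin le_max L0.
apply: ge0_le_integral => //.
- by move=> r _; rewrite mule_ge0// lee_fin// le_max L0.
- by apply/measurable_EFinP; apply: measurable_funM => //; exact: measurable_funTS.
- exact: mwv.
- move=> r /=; rewrite in_itv/= => /andP[ar rb]; rewrite -EFinM lee_fin ler_wpM2r//.
  by have [|wa wb] := we r; [rewrite (ltW ar)|rewrite ge_max wa wb].
Qed.

Let unif (s t e : R) : A < s -> t < B -> 0 < e ->
  exists2 d, 0 < d & forall x y, s <= x <= t -> `|y - x| <= d -> `|w y - w x| <= e.
Proof.
move=> As tB e0.
have /compact_near_coveringP/(_ _ (0^'+ : set_system R)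
  (fun d x => forall y, `|y - x| <= d -> `|w y - w x| <= e)) := @segment_compact R s t.
have FF : Filter (0^'+ : set_system R) by exact: at_right_proper_filter.
move=> /(_ FF) H.
have [] : \forall d \near (0:R)^'+, `[s, t] `<=` (fun x => forall y, `|y - x| <= d -> `|w y - w x| <= e).
  apply: H => x /=; rewrite in_itv/= => /andP[sx xt].
  have xAB : A < x < B by rewrite (lt_le_trans As sx) (le_lt_trans xt tB).
  have e2 : 0 < e / 2 by rewrite divr_gt0.
  have /cvgrPdist_le/(_ _ e2)[r /= r0 hr] := cw xAB.
  exists (ball x (r / 2), [set d : R | d < r / 2]).
    split; first by apply: nbhsx_ballx; rewrite divr_gt0.
    by exists (r / 2) => /=; [rewrite divr_gt0|move=> d; rewrite /= sub0r normrN => + d0; rewrite gtr0_norm].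
  move=> [x' d] /= [xx' dr] y yx'.
  have h1 := hr x'; have h2 := hr y.
  have xr : `|x - x'| < r by apply: lt_le_trans xx' _; lra.
  have yr : `|x - y| < r.
    rewrite (le_lt_trans (ler_distD x' _ _))//.
    have : `|x - x'| < r / 2 by [].
    have : `|x' - y| < r / 2 by rewrite distrC (le_lt_trans yx').
    lra.
  rewrite (le_trans (ler_distD (w x) _ _))//.
  by rewrite (splitr e) lerD//; [rewrite distrC; exact: h2|exact: h1].
move=> d /= d0 hd; exists (d / 2); first by rewrite divr_gt0.
move=> x y sxt yx.
have d2 : 0 < d / 2 by rewrite divr_gt0.
have dd : `|0 - d / 2| < d by rewrite sub0r normrN gtr0_norm//; lra.
by apply: (hd _ dd d2 x _ y yx); rewrite /= in_itv.
Qed.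

Let chain (s t e : R) : A < s -> s <= t -> t < B -> 0 < e ->
  (`|Phi (h t) - Phi (h s)|%:E <= \int[leb]_(r in `]s, t]) ((w r + e) * v r)%:E)%E.
Proof.
move=> As st tB e0.
have [d d0 hd] := unif As tB (divr_gt0 e0 (ltr0n _ 2)).
(* Induction on the number of pieces of length d. *)
have key (m : nat) a b : s <= a -> a <= b -> b <= t -> b - a <= m%:R * d ->
    (`|Phi (h b) - Phi (h a)|%:E <= \int[leb]_(r in `]a, b]) ((w r + e) * v r)%:E)%E.
  elim: m b => [|m IH] b sa ab bt bad.
    have -> : b = a by apply/eqP; rewrite eq_le ab andbT; move: bad; rewrite mul0r subr_le0.
    by rewrite subrr normr0 integral_ge0// => r _; rewrite lee_fin mulr_ge0// addr_ge0// ?L0// ltW.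
  have Aa : A < a by exact: lt_le_trans sa.
  pose c := Num.max a (b - d).
  have ac : a <= c by rewrite le_max lexx.
  have cb : c <= b by rewrite ge_max ab gerBl ltW.
  have bB : b < B by exact: le_lt_trans tB.
  have cam : c - a <= m%:R * d.
    rewrite lerBlDr ge_max; apply/andP; split.
      by rewrite lerDr mulr_ge0// ltW.
    by move: bad; rewrite -natr1 mulrDl mul1r; lra.
  have h1 := IH c sa ac (le_trans cb bt) cam.
  have h2 : (`|Phi (h b) - Phi (h c)|%:E <= \int[leb]_(r in `]c, b]) ((w r + e) * v r)%:E)%E.
    apply: short => //; first exact: lt_le_trans ac.
    move=> r /andP[cr rb].
    have rst : s <= r <= t by rewrite (le_trans sa (le_trans ac cr)) (le_trans rb bt).
    have bcd : b - c <= d.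
      have : b - d <= c by rewrite le_max lexx orbT.
      lra.
    have h3 := hd r c rst; have h4 := hd r b rst.
    have {}h3 : `|w c - w r| <= e / 2 by apply: h3; rewrite ler_norml; apply/andP; split; lra.
    have {}h4 : `|w b - w r| <= e / 2 by apply: h4; rewrite ler_norml; apply/andP; split; lra.
    by move: h3 h4; rewrite !ler_norml => /andP[_ ?] /andP[_ ?]; split; lra.
  have -> : `]a, b]%classic = `]a, c] `|` `]c, b] :> set R.
    by rewrite -itv_bndbnd_setU// bnd_simp.
  rewrite ge0_integral_setU//; first last.
  - apply/disj_setPS => x [/=]; rewrite !in_itv/= => /andP[_ xc] /andP[cx _].
    by have := le_lt_trans xc cx; rewrite ltxx.
  - by move=> r _; rewrite lee_fin mulr_ge0// addr_ge0 ?L0// ltW.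
  - by rewrite -itv_bndbnd_setU ?bnd_simp//; exact: mwv.
  apply: le_trans (leeD h1 h2); rewrite -EFinD lee_fin.
  by rewrite [leRHS]addrC; exact: ler_distD.
apply: (key (Num.truncn ((t - s) / d)).+1) => //.
rewrite -ler_pdivrMr//; apply: ltW; exact: truncnS_gt.
Qed.

(** Cut the interval into pieces on which L (h r) varies by at most e. On each
    piece the increment of Phi o h is at most (L (h r) + e) times that of h;
    sum, then let e tend to 0. Only difference quotients of Phi enter, so Phi
    may be a truncated power. *)
Lemma chain_rule_le (s t : R) : A < s -> s <= t -> t < B ->
  (\int[leb]_(r in `]s, t]) (v r)%:E < +oo)%E ->
  (`|Phi (h t) - Phi (h s)|%:E <= \int[leb]_(r in `]s, t]) (L (h r) * v r)%:E)%E.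
Proof.
move=> As st tB vfin; apply/lee_addgt0Pr => e e0.
pose I := fine (\int[leb]_(r in `]s, t]) (v r)%:E).
have I0 : 0 <= I by rewrite fine_ge0// integral_ge0// => r _; rewrite lee_fin.
have IE : (\int[leb]_(r in `]s, t]) (v r)%:E = I%:E)%E.
  by rewrite fineK// ge0_fin_numE// integral_ge0// => r _; rewrite lee_fin.
have I1 : 0 < I + 1 by rewrite ltr_wpDl.
have e1 : 0 < e / (I + 1) by rewrite divr_gt0.
apply: (le_trans (chain As st tB e1)).
under eq_integral do rewrite mulrDl EFinD.
rewrite ge0_integralD//; first last.
- by apply/measurable_EFinP/measurable_funM => //; exact: measurable_funTS.
- by move=> r _; rewrite lee_fin mulr_ge0// ltW.
- rewrite (_ : (fun _ => _) = (fun r => ((w r + 0) * v r)%:E)); first exact: mwv.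
  by apply/funext => r; rewrite addr0.
- by move=> r _; rewrite lee_fin mulr_ge0//; exact: L0.
rewrite leeD2l//; under eq_integral do rewrite EFinM.
rewrite ge0_integralZl//; first last.
- by rewrite lee_fin ltW.
- by move=> r _; rewrite lee_fin.
- by apply/measurable_EFinP; exact: measurable_funTS.
rewrite IE -EFinM lee_fin -mulrA ler_piMr ?(ltW e0)// mulrC ler_pdivrMr// mul1r.
by rewrite lerDl.
Qed.

End OnInterval.

(** By the chain rule inequality, the values of Phi o f at two generic points
    differ by at most the integral K on the right. As |f| ^ p is integrable
    over a line of infinite length, |f| has no positive lower bound almost
    everywhere, so some of these values are arbitrarily small and all of them
    are at most K. *)
Lemma line_le (f g : R -> R) (p : R) (N0 : nat) :
  measurable_fun [set: R] f -> measurable_fun [set: R] g ->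
  (forall s, 0 <= Phi s) ->
  (forall e, 0 < e -> exists2 d, 0 < d & forall s, e <= Phi s -> d <= `|s|) ->
  0 < p -> (\int[leb]_s (`|f s| `^ p)%:E < +oo)%E ->
  (forall N : nat, (N0 <= N)%N -> leb.-integrable `[- N%:R, N%:R] (EFin \o g) /\
    exists c, {ae leb, forall t, t \in `]- N%:R, N%:R[ ->
      f t = c + \int[leb]_(r in `[- N%:R, t]) g r}) ->
  {ae leb, forall t, ((Phi (f t))%:E <= \int[leb]_r (L (f r) * `|g r|)%:E)%E}.
Proof.
move=> mf mg Phi0 Phid p0 fp loc.
have /choice[c hc] : forall N : nat, exists c, (N0 <= N)%N -> {ae leb, forall t, t \in `]- N%:R, N%:R[ ->
      f t = c + \int[leb]_(r in `[- N%:R, t]) g r}.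
  move=> N; have [NN|] := boolP (N0 <= N)%N; last by exists 0.
  by have [_ [c hc]] := loc N NN; exists c.
set K := (\int[leb]_r _)%E.
have [Ky|Ky] := eqVneq K +oo%E; first by apply: aeW => t; rewrite Ky leey.
have K0 : (0 <= K)%E by apply: integral_ge0 => r _; rewrite lee_fin mulr_ge0.
have Kfin : (fine K)%:E = K by rewrite fineK// ge0_fin_numE// ltey.
pose h N t := c N + \int[leb]_(r in `[- N%:R, t]) g r.
have mLg : measurable_fun [set: R] (fun r => (L (f r) * `|g r|)%:E).
  apply/measurable_EFinP/measurable_funM; last exact: measurableT_comp.
  by apply: (measurableT_comp _ mf); exact: continuous_measurable_fun.
have Kle (N : nat) a b : (N0 <= N)%N -> - N%:R < a -> a <= b -> b < N%:R ->
    `|Phi (h N b) - Phi (h N a)| <= fine K.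
  move=> NN Na ab bN; have [ig _] := loc N NN.
  have NltN : - N%:R < N%:R :> R by exact: lt_le_trans Na (le_trans ab (ltW bN)).
  have ch : {in `]- N%:R, N%:R[, continuous (h N)}.
    have := parameterized_integral_continuous (ltW NltN) ig.
    move=> /(continuous_within_itvP _ NltN)[+ _ _] => H x xN.
    by apply: cvgD; [exact: cvg_cst|exact: H].
  have sub (u v : R) : - N%:R < u -> v < N%:R -> `]u, v] `<=` `[- N%:R, N%:R]%classic.
    move=> Nu vN x /=; rewrite !in_itv/= => /andP[ux xv].
    by rewrite (ltW (lt_trans Nu ux)) (ltW (le_lt_trans xv vN)).
  have hv u v : - N%:R < u -> u <= v -> v < N%:R ->
      (`|h N v - h N u|%:E <= \int[leb]_(r in `]u, v]) (`|g r|)%:E)%E.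
    move=> Nu uv vN.
    have -> : h N v - h N u = \int[leb]_(r in `]u, v]) g r.
      rewrite /h opprD addrACA subrr add0r.
      apply: (@Rintegral_itvB _ g (BLeft (- N%:R)) (BRight v) u).
      - apply: integrableS ig => // x /=; rewrite !in_itv/= => /andP[-> xv].
        by rewrite (le_trans xv)// ltW.
      - by rewrite bnd_simp ltW.
      - by rewrite bnd_simp.
    have iguv : leb.-integrable `]u, v] (EFin \o g).
      by apply: integrableS ig => //; exact: sub.
    rewrite EFin_normr_Rintegral//; apply: le_trans (le_abse_integral _ _ _) _ => //.
    exact: measurable_int iguv.
  have v0 s : 0 <= `|g s| by [].
  have mv : measurable_fun [set: R] ((fun s => `|g s|) : R -> R) by exact: measurableT_comp.
  rewrite -lee_fin Kfin.
  apply: le_trans (@chain_rule_le _ _ (h N) ((fun s => `|g s|) : R -> R) ch v0 mv hv a b Na ab bN _) _.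
    move/integrableP: ig => [mg' ig]; apply: le_lt_trans ig.
    apply: ge0_subset_integral => //; first by apply/measurable_EFinP; apply: measurable_funTS.
    exact: sub.
  have mLh : measurable_fun `]a, b] (fun r => L (h N r)).
    apply: (@measurable_funS _ _ _ _ (`](- N%:R : R), N%:R[)) => //.
      by move=> x /=; rewrite !in_itv/= => /andP[ax xb]; rewrite (lt_trans Na)//= (le_lt_trans xb).
    apply: open_continuous_measurable_fun => [|x]; first exact: interval_open.
    rewrite mem_setE => xN; apply: continuous_comp; [exact: ch|exact: cL].
  rewrite (_ : (\int[leb]_(r in `]a, b]) _)%E = \int[leb]_(r in `]a, b]) (L (f r) * `|g r|)%:E)%E; last first.
    apply: ae_eq_integral => //.
    - by apply/measurable_EFinP/measurable_funM => //; exact: measurable_funTS.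
    - exact: measurable_funTS.
    - apply: (ae_mono _ (hc N NN)) => x fx /=; rewrite in_itv/= => /andP[ax xb].
      by rewrite /h -fx// in_itv/= (lt_trans Na ax) (le_lt_trans xb bN).
  by apply: ge0_subset_integral => // r _; rewrite lee_fin mulr_ge0.
pose good t := forall N : nat, (N0 <= N)%N -> t \in `]- N%:R, N%:R[ -> f t = h N t.
have aegood : {ae leb, forall t, good t}.
  apply: (@ae_foralln _ _ _ leb (fun N t => (N0 <= N)%N -> t \in `]- N%:R, N%:R[ -> f t = h N t)).
  move=> N; have [NN|nNN] := boolP (N0 <= N)%N; last by apply: aeW => t.
  by apply: (ae_mono _ (hc N NN)) => t ft _; exact: ft.
have pair s t : good s -> good t -> Phi (f t) <= Phi (f s) + fine K.
  move=> gs gt; pose N := maxn N0 (Num.truncn (`|s| + `|t|)).+1.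
  have NN : (N0 <= N)%N by exact: leq_maxl.
  have stN : `|s| + `|t| < N%:R.
    by apply: lt_le_trans (truncnS_gt _) _; rewrite ler_nat leq_maxr.
  have sN : - N%:R < s < N%:R by rewrite -ltr_norml (le_lt_trans _ stN)// lerDl.
  have tN : - N%:R < t < N%:R by rewrite -ltr_norml (le_lt_trans _ stN)// lerDr.
  rewrite (gs N NN) ?in_itv// (gt N NN) ?in_itv// -lerBlDl.
  case/andP: sN => Ns sN; case/andP: tN => Nt tN.
  have [st|ts] := leP s t; first exact: le_trans (ler_norm _) (Kle N s t NN Ns st tN).
  by apply: le_trans (ler_norm _) _; rewrite distrC; exact: Kle (ltW ts) sN.
apply: (ae_mono _ aegood) => t gt; rewrite -Kfin lee_fin leNgt; apply/negP => Kt.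
have e0 : 0 < Phi (f t) - fine K by rewrite subr_gt0.
have [d d0 hd] := Phid _ e0.
(* A value of Phi o f above K would keep |f| above d almost everywhere. *)
have aed : {ae leb, forall s, d <= `|f s|}.
  by apply: (ae_mono _ aegood) => s gs; apply: hd; rewrite lerBlDr; exact: pair.
suff : (\int[leb]_s (d `^ p)%:E <= \int[leb]_s (`|f s| `^ p)%:E)%E.
  have lT : leb [set: R] = +oo%E by rewrite -set_itvNyy lebesgue_measure_itv.
  rewrite integral_cst// [X in (_ * X)%E](_ : _ = +oo%E)//.
  rewrite gt0_muley ?lte_fin ?powR_gt0// leye_eq => /eqP fy.
  by move: fp; rewrite fy ltxx.
apply: ae_ge0_le_integral => //.
- by move=> *; rewrite lee_fin powR_ge0.
- apply/measurable_EFinP; apply: (measurableT_comp (measurable_powR p)).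
  exact: measurableT_comp.
- apply: (ae_mono _ aed) => s ds _; rewrite lee_fin; apply: ge0_ler_powR; rewrite ?nnegrE ?(ltW p0) ?(ltW d0)//.
Qed.

End ChainRule.

(** * The Gagliardo-Nirenberg-Sobolev inequality *)

Section TruncatedPower.
Context {R : realType}.
Implicit Types (a b c r s M : R).

(** Young's inequality for the product of a and b ^ (c - 1), if a <= b. *)
Lemma powR_two_point c a b : 1 < c -> 0 <= a -> 0 <= b ->
  `|a `^ c - b `^ c| <= c * Num.max a b `^ (c - 1) * `|a - b|.
Proof.
move=> c1; have c0 : 0 < c by exact: lt_trans c1.
wlog ab : a b / a <= b => [hw a0 b0|a0 b0].
  have /orP[ab|ba] := le_total a b; first exact: hw.
  by rewrite distrC maxC [X in _ * X]distrC; exact: hw.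
rewrite max_r// ler0_norm; last by rewrite subr_le0 ge0_ler_powR// ?nnegrE// ltW.
rewrite [`|a - b|]ler0_norm ?subr_le0// !opprB.
have q0 : 0 < c / (c - 1) by rewrite divr_gt0// subr_gt0.
have cn0 : c != 0 by rewrite gt_eqF.
have c1n0 : c - 1 != 0 by rewrite gt_eqF// subr_gt0.
have conj : c^-1 + (c / (c - 1))^-1 = 1 by field; rewrite c1n0 cn0.
have := conjugate_powR a0 (powR_ge0 b (c - 1)) c0 q0 conj.
rewrite -powRrM (_ : (c - 1) * (c / (c - 1)) = c); last by field.
rewrite -(ler_pM2l c0) mulrDr.
rewrite (_ : c * (a `^ c / c) = a `^ c); last by field.
rewrite (_ : c * (b `^ c / (c / (c - 1))) = (c - 1) * b `^ c); last by field; rewrite c1n0 cn0.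
have := mulr_powRB1 b0 c0; move: (a `^ c) (b `^ c) (b `^ (c - 1)) => A B C <- H.
by rewrite mulrBr; move: H; nra.
Qed.

Definition trunc M s : R := Num.min `|s| M.

Lemma trunc_ge0 M s : 0 <= M -> 0 <= trunc M s.
Proof. by move=> M0; rewrite le_min normr_ge0. Qed.

Lemma trunc_le M s : trunc M s <= M.
Proof. by rewrite ge_min lexx orbT. Qed.

Lemma trunc_norm M s : trunc M s <= `|s|.
Proof. by rewrite ge_min lexx. Qed.

Lemma trunc_lip M a b : `|trunc M a - trunc M b| <= `|a - b|.
Proof.
wlog ab : a b / `|a| <= `|b| => [hw|].
  have [ab|ba] := leP `|a| `|b|; first exact: hw.
  by rewrite distrC [leRHS]distrC; apply: hw; exact: ltW.
rewrite /trunc ler0_norm ?opprB; last first.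
  by rewrite subr_le0 le_min !ge_min ab lexx/= orbT.
have h : `|b| - `|a| <= `|a - b| by rewrite distrC; exact: lerB_dist.
by case: (leP `|b|); case: (leP `|a|) => ? ?; lra.
Qed.

Lemma continuous_trunc M : continuous (trunc M).
Proof.
move=> x; apply/cvgrPdist_le => e e0; exists e => // y xy.
by apply: le_trans (trunc_lip _ _ _) (ltW _).
Qed.

(** Truncating |s| at M makes the integrals of its powers finite, which the
    proof of the Sobolev inequality requires before a power of the left-hand
    side can be divided out. The truncation disappears by monotone
    convergence. *)
Definition powt M c s : R := trunc M s `^ c.

(** A bound for the difference quotients of the truncated power. It is not cut
    to 0 above the level M, so as to stay continuous. *)
Definition dpowt M c s : R := c * trunc M s `^ (c - 1).

Lemma powt_two_point M c a b : 1 < c -> 0 <= M ->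
  `|powt M c a - powt M c b| <= Num.max (dpowt M c a) (dpowt M c b) * `|a - b|.
Proof.
move=> c1 M0; have c0 : 0 < c by exact: lt_trans c1.
apply: le_trans (powR_two_point c1 (trunc_ge0 a M0) (trunc_ge0 b M0)) _.
apply: ler_pM => //; last exact: trunc_lip.
  by rewrite mulr_ge0 ?powR_ge0 ?ltW.
by rewrite /dpowt; case: (leP (trunc M a)) => _; rewrite le_max lexx ?orbT.
Qed.

Lemma powt_lip M c a b : 1 < c -> 0 <= M ->
  `|powt M c a - powt M c b| <= c * M `^ (c - 1) * `|a - b|.
Proof.
move=> c1 M0; apply: le_trans (powt_two_point a b c1 M0) _.
have c0 : 0 <= c by rewrite ltW// (lt_trans _ c1).
have h s : dpowt M c s <= c * M `^ (c - 1).
  rewrite /dpowt ler_wpM2l// ge0_ler_powR ?nnegrE ?trunc_ge0 ?trunc_le//.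
  by rewrite subr_ge0 ltW.
by rewrite ler_wpM2r// ge_max !h.
Qed.

Lemma continuous_powt M c : 1 < c -> 0 <= M -> continuous (powt M c).
Proof.
move=> c1 M0 x; have K0 : 0 <= c * M `^ (c - 1).
  by rewrite mulr_ge0 ?powR_ge0// ltW// (lt_trans _ c1).
apply/cvgrPdist_le => e e0; exists (e / (c * M `^ (c - 1) + 1)) => /=.
  by rewrite divr_gt0// ltr_wpDl.
move=> y /= xy; apply: le_trans (powt_lip _ _ c1 M0) _.
move: xy; rewrite ltr_pdivlMr ?ltr_wpDl// mulrC => /ltW; apply: le_trans.
by rewrite ler_wpM2r// lerDl.
Qed.

Lemma continuous_dpowt M c : 2 < c -> 0 <= M -> continuous (dpowt M c).
Proof.
move=> c2 M0 x; apply: cvgMr.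
by apply: (@continuous_powt M (c - 1)) => //; lra.
Qed.

Lemma powt_ge M c e : 0 < c -> 0 <= M -> 0 < e ->
  exists2 d, 0 < d & forall s, e <= powt M c s -> d <= `|s|.
Proof.
move=> c0 M0 e0; exists (e `^ c^-1); first exact: powR_gt0.
move=> s es; have := trunc_norm M s; apply: le_trans.
have -> : trunc M s = powt M c s `^ c^-1.
  by rewrite /powt -powRrM mulfV ?gt_eqF// powRr1// trunc_ge0.
by rewrite ge0_ler_powR// ?nnegrE ?powR_ge0 ?invr_ge0 ?(ltW c0) ?(ltW e0).
Qed.

End TruncatedPower.

Section TruncationLimit.
Context d (T : measurableType d) (R : realType) (mu : {measure set T -> \bar R}).
Local Open Scope ereal_scope.

Lemma measurable_trunc_powR (f : T -> R) (M q : R) : measurable_fun [set: T] f ->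
  measurable_fun [set: T] (fun x => powt M q (f x)).
Proof.
move=> mf; apply: (measurableT_comp (measurable_powR q)).
apply: (measurableT_comp _ mf); apply: continuous_measurable_fun.
exact: continuous_trunc.
Qed.

(** Monotone convergence, with the truncation level and the domain growing
    together. *)
Lemma integral_trunc_le (f : T -> R) (q : R) (K : nat -> set T) (B : \bar R) :
  measurable_fun [set: T] f -> (0 < q)%R -> (forall n, measurable (K n)) ->
  (forall m n, (m <= n)%N -> K m `<=` K n) -> \bigcup_n K n = setT ->
  (forall n, \int[mu]_(x in K n) (powt n%:R q (f x))%:E <= B) ->
  \int[mu]_x (`|f x| `^ q)%:E <= B.
Proof.
move=> mf q0 mK ndK UK KB.
pose g n x := ((fun x => (powt n%:R q (f x))%:E) \_ (K n)) x.
have mg n : measurable_fun [set: T] (g n).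
  apply/(measurable_restrictT _ (mK n)); apply: measurable_funTS.
  by apply/measurable_EFinP; exact: measurable_trunc_powR.
have g0 n x : setT x -> 0 <= g n x.
  by move=> _; rewrite /g patchE; case: ifP => // _; rewrite lee_fin powR_ge0.
have ndg x : setT x -> {homo g^~ x : m n / (m <= n)%N >-> m <= n}.
  move=> _ m n mn; rewrite /g !patchE; case: ifPn => xm; last by case: ifP => _; rewrite ?lee_fin ?powR_ge0.
  rewrite mem_set; last by apply: ndK mn _ _; exact: set_mem.
  rewrite lee_fin; apply: ge0_ler_powR; rewrite ?nnegrE ?trunc_ge0 ?(ltW q0)//.
  rewrite /trunc le_min !ge_min lexx/=.
  by rewrite ler_nat mn orbT.
have gf x : setT x -> g n x @[n --> \oo] --> (`|f x| `^ q)%:E.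
  move=> _; apply: (cvg_trans _ (@cvg_cst _ _ _ \oo _)); apply: near_eq_cvg.
  have [N _ KN] : (\bigcup_n K n) x by rewrite UK.
  near=> n; rewrite /g patchE mem_set; last first.
    by apply: (ndK N) => //; near: n; exact: nbhs_infty_ge.
  rewrite /powt /trunc min_l//; near: n; exact: nbhs_infty_ger.
have h := cvg_monotone_convergence measurableT mg g0 ndg.
rewrite (eq_integral (fun x => limn (g^~ x))); last first.
  by move=> x _; apply/esym/cvg_lim => //; exact: gf.
apply: (cvge_to_le (h mu)); apply: nearW => n.
by rewrite -integral_mkcond.
Unshelve. all: by end_near. Qed.

End TruncationLimit.

Section Sobolev.
Context {R : realType}.
Implicit Types (p : R).
Local Open Scope ereal_scope.

(** The power of f to which the line inequality is applied. Both 4 / 3 times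
    [sob_exp p] and p / (p - 1) times [sob_exp p - 1] are equal to the
    critical exponent [sob_conj p], which is what closes the argument. It is
    the constant of the Sobolev inequality as well. *)
Definition sob_exp p : R := (3 * p / (4 - p))%R.
Definition sob_conj p : R := (4 * p / (4 - p))%R.

Lemma le_poweR (r : R) (x y : \bar R) : (0 <= r)%R -> 0 <= x -> x <= y -> x `^ r <= y `^ r.
Proof.
move=> r0 x0 xy; apply: gt0_ler_poweR => //; rewrite in_itv/= leey andbT//.
exact: le_trans xy.
Qed.

Lemma prod4_cst (c : \bar R) : \prod_(k < 4) c = c * c * c * c.
Proof. by rewrite !big_ord_recr big_ord0 /= mul1e. Qed.

Lemma le_prode (f g : 'I_4 -> \bar R) : (forall k, 0 <= f k) ->
  (forall k, f k <= g k) -> \prod_k f k <= \prod_k g k.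
Proof.
move=> f0 fg.
suff : (0 <= \prod_k f k) && (\prod_k f k <= \prod_k g k) by move=> /andP[].
elim/big_ind2 : _ => [|x1 x2 y1 y2 /andP[? ?] /andP[? ?]|k _].
- by rewrite lexx lee01.
- by rewrite mule_ge0//= lee_pmul.
- by rewrite f0 fg.
Qed.

Lemma poweR_prod4 (x : R) (a : R) : (0 <= x)%R ->
  \prod_(k < 4) (x%:E `^ a) = (x `^ (4 * a))%:E.
Proof.
move=> x0; rewrite prod4_cst !poweR_EFin -!EFinM; congr EFin.
have [a0|an0] := eqVneq a 0%R; first by rewrite a0 mulr0 !powRr0 !mulr1.
have [->|xn0] := eqVneq x 0%R; first by rewrite !powR0 ?mulr0// mulf_neq0.
rewrite -!powRD ?xn0 ?implybT//; congr (_ `^ _)%R; ring.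
Qed.

(** The argument of Gagliardo and Nirenberg. Multiply the four line
    inequalities, raised to the power 1 / 3, and integrate: the Loomis-Whitney
    inequality bounds the result by the integrals of dpowt * |g j|, and
    Hoelder's inequality bounds each of these by a multiple of G times a power
    of the left-hand side. The total exponent of the left-hand side is less
    than 1 on the right, and it is finite by truncation, so it can be divided
    out. *)
Lemma sobolev_trunc (f : mR4 R -> R) (g : 'I_4 -> mR4 R -> R) p (G M : R) :
  (1 < p < 4)%R -> measurable_fun [set: mR4 R] f ->
  (forall j, measurable_fun [set: mR4 R] (g j)) ->
  \int[leb4]_x (`|f x| `^ p)%:E < +oo -> (0 <= G)%R -> (0 < M)%R ->
  (forall j, \int[leb4]_x (`|g j x| `^ p)%:E <= (G `^ p)%:E) ->
  (forall j, {ae leb4, forall x : mR4 R, (powt M (sob_exp p) (f x))%:E <=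
     lint j (fun y => (dpowt M (sob_exp p) (f y) * `|g j y|)%:E) x}) ->
  \int[leb4]_x (powt M (sob_conj p) (f x))%:E <= ((sob_exp p * G) `^ sob_conj p)%:E.
Proof.
move=> /andP[p1 p4] mf mg fp G0 M0 gG hline.
set c := sob_exp p; set q := sob_conj p; set b := ((p - 1) / p)%R.
have p0 : (0 < p)%R by lra.
have p40 : (0 < 4 - p)%R by lra.
have pn0 : p != 0%R by rewrite gt_eqF.
have p4n0 : (4 - p)%R != 0%R by rewrite gt_eqF.
have c0 : (0 < c)%R by rewrite divr_gt0// mulr_gt0.
have q0 : (0 < q)%R by rewrite divr_gt0// mulr_gt0.
have b0 : (0 < b)%R by rewrite divr_gt0// subr_gt0.
have pi0 : (0 < p^-1)%R by rewrite invr_gt0.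
have qb : (q * b = c - 1)%R by rewrite /q /b /c /sob_conj /sob_exp; field; rewrite p4n0 pn0.
have c1 : (0 < c - 1)%R by rewrite -qb mulr_gt0.
have mpow (r : R) : measurable_fun [set: mR4 R] (fun x => powt M r (f x)).
  exact: measurable_trunc_powR.
pose I := \int[leb4]_x (powt M q (f x))%:E.
have I0 : 0 <= I by apply: integral_ge0 => x _; rewrite lee_fin powR_ge0.
have mfp : measurable_fun [set: mR4 R] (fun x => (`|f x| `^ p)%:E).
  apply/measurable_EFinP; apply: (measurableT_comp (measurable_powR p)).
  exact: measurableT_comp.
(* powt M q is at most M ^ (q - p) * |f| ^ p, because p <= q. *)
have Ifin : I < +oo.
  apply: (@le_lt_trans _ _ (\int[leb4]_x ((M `^ (q - p))%:E * (`|f x| `^ p)%:E))).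
    apply: ge0_le_integral => //.
    - by move=> x _; rewrite lee_fin powR_ge0.
    - by apply/measurable_EFinP; exact: mpow.
    - exact: emeasurable_funM.
    move=> x _; rewrite -EFinM lee_fin /powt.
    have t0 := trunc_ge0 (f x) (ltW M0).
    have qp : (0 <= q - p)%R.
      rewrite /q /sob_conj (_ : _ - _ = p * p / (4 - p))%R; last by field.
      by rewrite divr_ge0 ?mulr_ge0 ?ltW.
    have -> : (trunc M (f x) `^ q = trunc M (f x) `^ (q - p) * trunc M (f x) `^ p)%R.
      rewrite -powRD ?subrK//; apply/implyP => /eqP qe; move: q0; rewrite qe ltxx//.
    apply: ler_pM; rewrite ?powR_ge0//; apply: ge0_ler_powR; rewrite ?nnegrE//.
    - exact: ltW.
    - exact: trunc_le.
    - exact: ltW.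
    - exact: trunc_norm.
  rewrite ge0_integralZl//; first by rewrite lte_mul_pinfty// ?lee_fin ?powR_ge0//.
  by rewrite lee_fin powR_ge0.
pose i := fine I.
have iE : I = i%:E by rewrite fineK// ge0_fin_numE.
have i0 : (0 <= i)%R by rewrite fine_ge0.
pose H j (x : mR4 R) := (dpowt M c (f x) * `|g j x|)%:E.
have mH j : measurable_fun [set: mR4 R] (H j).
  apply/measurable_EFinP/measurable_funM; last exact: measurableT_comp.
  by apply: measurable_funM => //; exact: mpow.
have H0 j x : 0 <= H j x.
  by rewrite lee_fin; apply: mulr_ge0 => //; apply: mulr_ge0; [exact: ltW|exact: powR_ge0].
have HI j : \int[leb4]_x H j x <= (c * (i `^ b * G))%:E.
  have E x : H j x = c%:E * ((powt M q (f x))%:E `^ b * (`|g j x| `^ p)%:E `^ p^-1).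
    rewrite !poweR_EFin -!EFinM /H /dpowt /powt; congr EFin.
    by rewrite -!powRrM qb mulfV// powRr1// mulrA.
  have mgp : measurable_fun [set: mR4 R] (fun x => (`|g j x| `^ p)%:E).
    apply/measurable_EFinP; apply: (measurableT_comp (measurable_powR p)).
    exact: measurableT_comp.
  have mq : measurable_fun [set: mR4 R] (fun x => (powt M q (f x))%:E).
    by apply/measurable_EFinP; exact: mpow.
  have bp : (b + p^-1 = 1)%R by rewrite /b; field.
  under eq_integral do rewrite E.
  rewrite ge0_integralZl//; first last.
  - by rewrite lee_fin ltW.
  - by move=> x _; rewrite mule_ge0 ?poweR_ge0.
  - by apply: emeasurable_funM; exact: measurable_poweRT.
  rewrite [leRHS]EFinM; apply: lee_wpmul2l; first by rewrite lee_fin ltW.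
  have := hoelder_ge0 leb4 mq mgp _ _ b0 pi0 bp.
  move=> h; apply: (le_trans (h _ _)).
  - by move=> x; rewrite lee_fin powR_ge0.
  - by move=> x; rewrite lee_fin powR_ge0.
  rewrite -/I iE poweR_EFin [leRHS]EFinM; apply: lee_wpmul2l; first by rewrite lee_fin powR_ge0.
  have -> : G%:E = (G `^ p)%:E `^ p^-1 by rewrite poweR_EFin -powRrM mulfV// powRr1.
  apply: le_poweR; [exact: ltW| |exact: gG].
  by apply: integral_ge0 => x _; rewrite lee_fin powR_ge0.
have IH : I <= \int[leb4]_x \prod_k (lint k (H k) x) `^ 3^-1.
  have lH0 k x : 0 <= lint k (H k) x by exact: lint_ge0.
  apply: ae_ge0_le_integral => //.
  - by move=> x _; rewrite lee_fin powR_ge0.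
  - by apply/measurable_EFinP; exact: mpow.
  - by move=> x _; apply: prode_ge0 => k _; exact: poweR_ge0.
  - have mp k := measurable_poweRT 3^-1 (measurable_lint k (mH k) (H0 k)).
    rewrite (_ : (fun _ => _) = (fun x => \prod_(k <- index_enum 'I_4) (lint k (H k) x) `^ 3^-1))//.
    elim: (index_enum _) => [|k s IHs].
      by rewrite (_ : (fun _ => _) = cst 1)//; apply/funext => x; rewrite big_nil.
    rewrite (_ : (fun _ => _) = (fun x => (lint k (H k) x) `^ 3^-1 *
        \prod_(k <- s) (lint k (H k) x) `^ 3^-1)).
      exact: (emeasurable_funM (mp k) IHs).
    by apply/funext => x; rewrite big_cons.
  have aeall : {ae leb4, forall x : mR4 R, forall j, (powt M c (f x))%:E <= lint j (H j) x}.
    exact: ae_forall_ord.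
  apply: (ae_mono _ aeall) => x hx _.
  have -> : (powt M q (f x))%:E = \prod_(k < 4) (powt M c (f x))%:E `^ 3^-1.
    rewrite poweR_prod4 ?powR_ge0// /powt -powRrM; congr (_ `^ _)%:E.
    by rewrite /c /q /sob_exp /sob_conj; field.
  apply: le_prode => k; first exact: poweR_ge0.
  by apply: le_poweR; rewrite ?invr_ge0// lee_fin powR_ge0.
have LW := loomis_whitney mH H0.
(* The exponent b * 4 / 3 = 4 (p - 1) / (3 p) is less than 1 as p < 4. *)
have Ibound : (i <= (c * (i `^ b * G)) `^ (4 * 3^-1))%R.
  rewrite -lee_fin -iE; apply: (le_trans IH); apply: (le_trans LW).
  rewrite -poweR_prod4; last by rewrite mulr_ge0 ?(ltW c0)// mulr_ge0// powR_ge0.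
  apply: le_prode => k; first exact: poweR_ge0.
  by apply: le_poweR; rewrite ?invr_ge0//; exact: integral_ge0.
rewrite -/I iE lee_fin.
have [->|in0] := eqVneq i 0%R; first exact: powR_ge0.
have ip : (0 < i)%R by rewrite lt0r in0.
have cG0 : (0 <= c * G)%R by rewrite mulr_ge0// ltW.
have ->: i = ((i `^ (1 - b * (4 * 3^-1))) `^ c)%R.
  rewrite -powRrM (_ : ((1 - b * (4 * 3^-1)) * c = 1)%R) ?powRr1//.
  by rewrite /b /c /sob_exp; field; rewrite p4n0 pn0.
have -> : ((c * G) `^ q = ((c * G) `^ (4 * 3^-1)) `^ c)%R.
  by rewrite -powRrM; congr (_ `^ _)%R; rewrite /q /c /sob_conj /sob_exp; field.
apply: ge0_ler_powR; rewrite ?nnegrE ?powR_ge0 ?(ltW c0)//.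
rewrite powRB; last by rewrite in0 implybT.
rewrite powRr1// ler_pdivrMr ?powR_gt0// powRrM -powRM ?powR_ge0//.
by apply: le_trans Ibound _; rewrite mulrCA [X in (X `^ _)%R]mulrC.
Qed.

Lemma sobolev (f : mR4 R -> R) (g : 'I_4 -> mR4 R -> R) p (G : R) :
  (1 < p < 4)%R -> measurable_fun [set: mR4 R] f ->
  (forall j, measurable_fun [set: mR4 R] (g j)) ->
  \int[leb4]_x (`|f x| `^ p)%:E < +oo -> (0 <= G)%R ->
  (forall j, \int[leb4]_x (`|g j x| `^ p)%:E <= (G `^ p)%:E) ->
  (forall j M, (0 < M)%R -> {ae leb4, forall x : mR4 R, (powt M (sob_exp p) (f x))%:E <=
     lint j (fun y => (dpowt M (sob_exp p) (f y) * `|g j y|)%:E) x}) ->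
  \int[leb4]_x (`|f x| `^ sob_conj p)%:E <= ((sob_exp p * G) `^ sob_conj p)%:E.
Proof.
move=> p14 mf mg fp G0 gG hline; have /andP[p1 p4] := p14.
have q0 : (0 < sob_conj p)%R by rewrite divr_gt0 ?mulr_gt0//; lra.
apply: (@integral_trunc_le _ _ _ leb4 f _ (fun=> setT)) => //.
  by apply/seteqP; split => // x _; exists 0%N.
case=> [|n].
  rewrite integral0_eq ?lee_fin ?powR_ge0// => x _.
  rewrite /powt (_ : trunc _ _ = 0%R) ?powR0 ?gt_eqF//.
  by rewrite /trunc min_r// normr_ge0.
exact: (sobolev_trunc p14 mf mg fp G0 (ltr0Sn _ n) gG (fun j => hline j _ (ltr0Sn _ n))).
Qed.

End Sobolev.

(** * Calculus of test functions *)

Lemma continuous_fst (U V : topologicalType) : continuous (@fst U V).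
Proof. by move=> x; exact: cvg_fst. Qed.

Lemma continuous_snd (U V : topologicalType) : continuous (@snd U V).
Proof. by move=> x; exact: cvg_snd. Qed.

Lemma cvg_pair2 (T : Type) (F : set_system T) {FF : Filter F} (U V : topologicalType)
    (f : T -> U) (g : T -> V) (a : U) (b : V) :
  f x @[x --> F] --> a -> g x @[x --> F] --> b -> (f x, g x) @[x --> F] --> (a, b).
Proof. by move=> fa gb; exact: cvg_pair. Qed.

Section Lines.
Context {R : realType}.
Implicit Types (f g : R4 R -> R) (x : R4 R) (j k : 'I_4) (t : R).

Lemma upd_shift x j h : h *: basis4 j + x = upd x j (co x j + h).
Proof.
apply: co_inj => k; rewrite co_upd.
have -> : co (h *: basis4 j + x) k = h * (k == j)%:R + co x k.
  rewrite eq_sym; elim/ord4P: k; rewrite /co /basis4 -val_eqE /= !inordK//=.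
by case: eqP => [->|_]; rewrite ?mulr1 ?mulr0 ?add0r// addrC.
Qed.

Lemma diff_quot_line f x j :
  (fun h => h^-1 *: ((f \o shift x) (h *: basis4 j) - f x)) =
  (fun h => h^-1 *: (((fun t => f (upd x j t)) \o shift (co x j)) (h *: 1) - f (upd x j (co x j)))).
Proof.
apply/funext => h; rewrite /= upd_id upd_shift; congr (_ *: (f (upd x j _) - _)).
by rewrite /GRing.scale/= mulr1 addrC.
Qed.

Lemma derivable_line f x j :
  derivable f x (basis4 j) <-> derivable (fun t => f (upd x j t)) (co x j) 1.
Proof. by rewrite /derivable diff_quot_line. Qed.

Lemma partial_line f x j :
  partial j f x = derive1 (fun t => f (upd x j t)) (co x j).
Proof. by rewrite derive1E /partial /derive diff_quot_line. Qed.

Lemma is_derive_line f x j t : derivable f (upd x j t) (basis4 j) ->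
  is_derive t (1:R) (fun s => f (upd x j s)) (partial j f (upd x j t)).
Proof.
move=> /derivable_line; rewrite co_upd eqxx.
have E : (fun s => f (upd (upd x j t) j s)) = (fun s => f (upd x j s)).
  by apply/funext => s; rewrite upd_upd.
rewrite partial_line co_upd eqxx E derive1E => df.
exact: DeriveDef.
Qed.

Lemma continuous_co k : continuous (co ^~ k : R4 R -> R).
Proof.
have c1 : continuous (fun x : R4 R => x.1) by exact: continuous_fst.
have c2 : continuous (fun x : R4 R => x.1.1).
  by move=> x; apply: (continuous_comp (c1 x)); exact: continuous_fst.
elim/ord4P: k; rewrite /co inordK//= => x.
- by apply: (continuous_comp (c2 x)); exact: continuous_fst.
- by apply: (continuous_comp (c2 x)); exact: continuous_snd.
- by apply: (continuous_comp (c1 x)); exact: continuous_snd.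
- exact: continuous_snd.
Qed.

Lemma continuous_upd x j : continuous (upd x j).
Proof.
move=> t; have c (k : 'I_4) : (fun s => if k == j then s else co x k) s @[s --> t] --> (if k == j then t else co x k).
  by case: (k == j); [exact: cvg_id|exact: cvg_cst].
by apply: cvg_pair2; [apply: cvg_pair2; [apply: cvg_pair2|]|]; exact: c.
Qed.

End Lines.

Section SmoothAlgebra.
Context {R : realType}.
Implicit Types (f g : R4 R -> R) (j k : 'I_4) (n : nat).

(** Smoothness one order at a time, in a form suited to induction over the
    product rule. *)
Fixpoint Cn4 n f : Prop :=
  (continuous f /\ forall x j, derivable f x (basis4 j)) /\
  match n with 0 => True | m.+1 => forall j, Cn4 m (partial j f) end.

Lemma smoothP f : smooth f <-> forall n, Cn4 n f.
Proof.
have sm g j : smooth g -> smooth (partial j g).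
  by move=> sg s; have := sg (rcons s j); rewrite foldr_rcons.
split=> [sf n|cf s].
  elim: n f sf => [|n IH] f sf; first by split=> //; exact: (sf [::]).
  by split; [exact: (sf [::])|move=> j; apply: IH; exact: sm].
elim/last_ind: s f cf => [|s j IH] f cf /=; first by have [] := cf 0%N.
by rewrite foldr_rcons; apply: IH => n; have [_] := cf n.+1; exact.
Qed.

Lemma Cn4_0 n f : Cn4 n f -> continuous f /\ forall x j, derivable f x (basis4 j).
Proof. by case: n => [|n] []. Qed.

Lemma Cn4S n f : Cn4 n.+1 f -> Cn4 n f.
Proof. by elim: n f => [|n IH] f [f0 h]; split=> // j; apply: IH; exact: h. Qed.

Lemma Cn4D n f g : Cn4 n f -> Cn4 n g -> Cn4 n (fun x => f x + g x).
Proof.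
elim: n f g => [|n IH] f g cf cg;
  have [[f0 df] [g0 dg]] := (Cn4_0 cf, Cn4_0 cg).
  split=> //; split; first by move=> x; apply: cvgD; [exact: f0|exact: g0].
  by move=> x j; apply: derivableD.
split; first (split; first by move=> x; apply: cvgD; [exact: f0|exact: g0]).
  by move=> x j; apply: derivableD.
move=> j; have -> : partial j (fun x => f x + g x) = (fun x => partial j f x + partial j g x).
  by apply/funext => x; exact: deriveD.
by apply: IH; [case: cf => _; apply|case: cg => _; apply].
Qed.

Lemma partialM f g j x : derivable f x (basis4 j) -> derivable g x (basis4 j) ->
  partial j (fun x => f x * g x) x = f x * partial j g x + g x * partial j f x.
Proof. by move=> df dg; exact: deriveM. Qed.

Lemma Cn4M n f g : Cn4 n f -> Cn4 n g -> Cn4 n (fun x => f x * g x).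
Proof.
elim: n f g => [|n IH] f g cf cg;
  have [[f0 df] [g0 dg]] := (Cn4_0 cf, Cn4_0 cg).
  split=> //; split; first by move=> x; apply: cvgM; [exact: f0|exact: g0].
  by move=> x j; apply: derivableM.
split; first (split; first by move=> x; apply: cvgM; [exact: f0|exact: g0]).
  by move=> x j; apply: derivableM.
move=> j; have -> : partial j (fun x => f x * g x) =
    (fun x => f x * partial j g x + g x * partial j f x).
  by apply/funext => x; exact: partialM.
by apply: Cn4D; apply: IH; [exact: Cn4S|case: cg => _; apply|exact: Cn4S|case: cf => _; apply].
Qed.

Lemma Cn4_cst n (c : R) : Cn4 n (fun=> c).
Proof.
elim: n c => [|n IH] c; first by split=> //; split=> [x|x j]; [exact: cvg_cst|exact: derivable_cst].
split; first by split=> [x|x j]; [exact: cvg_cst|exact: derivable_cst].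
move=> j; have -> : partial j (fun=> c) = (fun=> 0) by apply/funext => x; exact: derive_cst.
exact: IH.
Qed.

Lemma smoothM f g : smooth f -> smooth g -> smooth (fun x => f x * g x).
Proof. by move=> /smoothP sf /smoothP sg; apply/smoothP => n; exact: Cn4M. Qed.

Lemma smoothB f g : smooth f -> smooth g -> smooth (fun x => f x - g x).
Proof.
move=> /smoothP sf /smoothP sg; apply/smoothP => n.
have -> : (fun x => f x - g x) = (fun x => f x + (-1) * g x).
  by apply/funext => x; rewrite mulN1r.
by apply: Cn4D => //; apply: Cn4M => //; exact: Cn4_cst.
Qed.

Lemma smooth_cont f : smooth f -> continuous f.
Proof. by move=> /(_ [::]) []. Qed.

Lemma smooth_derivable f x j : smooth f -> derivable f x (basis4 j).
Proof. by move=> /(_ [::]) [_]; exact. Qed.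

Lemma smooth_partial f j : smooth f -> smooth (partial j f).
Proof. by move=> sg s; have := sg (rcons s j); rewrite foldr_rcons. Qed.

(** Differentiating a product of functions of one variable in direction j
    replaces its j-th factor. *)
Definition repl (psi : 'I_4 -> R -> R) j (v : R -> R) : 'I_4 -> R -> R :=
  fun k => if k == j then v else psi k.

Lemma prodf_repl (psi : 'I_4 -> R -> R) j v x :
  prodf (repl psi j v) x = (\prod_(k | k != j) psi k (co x k)) * v (co x j).
Proof.
rewrite /prodf (bigD1 j)//= /repl eqxx mulrC; congr (_ * _).
by apply: eq_bigr => k /negPf ->.
Qed.

Lemma prodf_split (psi : 'I_4 -> R -> R) j x :
  prodf psi x = (\prod_(k | k != j) psi k (co x k)) * psi j (co x j).
Proof. by rewrite /prodf (bigD1 j)//= mulrC. Qed.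

Lemma is_derive_prodf (psi : 'I_4 -> R -> R) j x : derivable (psi j) (co x j) 1 ->
  derivable (prodf psi) x (basis4 j) /\
  partial j (prodf psi) x = prodf (repl psi j (derive1 (psi j))) x.
Proof.
move=> dpsi; set c := \prod_(k | k != j) psi k (co x k).
have E : (fun t => prodf psi (upd x j t)) = (fun t => c * psi j t).
  apply/funext => t; rewrite (prodf_split _ j) co_upd eqxx; congr (_ * _).
  by apply: eq_bigr => k /negPf kj; rewrite co_upd kj.
have h : is_derive (co x j) (1:R) (fun t => c * psi j t) (c * derive1 (psi j) (co x j)).
  by rewrite derive1E; apply: is_deriveZ; exact: DeriveDef.
split; first by apply/derivable_line; rewrite E; case: h.
by rewrite partial_line E derive1E prodf_repl; case: h.
Qed.

Lemma prodf_derivable (psi : 'I_4 -> R -> R) : (forall k, smooth1 (psi k)) ->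
  continuous (prodf psi) /\ forall x j, derivable (prodf psi) x (basis4 j).
Proof.
move=> spsi; split=> [x|x j]; last first.
  by have [] := is_derive_prodf (@Cn_derivable _ _ _ (co x j) (spsi j 0%N)).
have cpsi k : continuous (fun y : R4 R => psi k (co y k)).
  move=> y; apply: continuous_comp; first exact: continuous_co.
  by apply: differentiable_continuous; apply/derivable1_diffP; exact: Cn_derivable (spsi k 0%N).
suff H (r : seq 'I_4) : continuous (fun y : R4 R => \prod_(k <- r) psi k (co y k)) by exact: H.
elim: r => [|k r IHr] y.
  rewrite (_ : (fun _ => _) = (fun=> 1)); first exact: cvg_cst.
  by apply/funext => z; rewrite big_nil.
rewrite (_ : (fun _ => _) = (fun z : R4 R => psi k (co z k) * \prod_(k <- r) psi k (co z k))).
  by apply: cvgM; [exact: cpsi|exact: IHr].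
by apply/funext => z; rewrite big_cons.
Qed.

Lemma smooth_prodf (psi : 'I_4 -> R -> R) : (forall k, smooth1 (psi k)) -> smooth (prodf psi).
Proof.
move=> spsi; apply/smoothP => n; elim: n psi spsi => [|n IH] psi spsi.
  by split=> //; exact: prodf_derivable.
split; first exact: prodf_derivable.
move=> j; have -> : partial j (prodf psi) = prodf (repl psi j (derive1 (psi j))).
  by apply/funext => x; have [] := is_derive_prodf (@Cn_derivable _ _ _ (co x j) (spsi j 0%N)).
apply: IH => k m; rewrite /repl; case: eqP => _; last exact: spsi.
by have [] := spsi j m.+1.
Qed.

End SmoothAlgebra.

Section TestFunctions.
Context {R : realType}.
Implicit Types (f g h phi : R4 R -> R) (j k : 'I_4) (N : R).

Definition supp_in N f := forall x, ~ cube N x -> f x = 0.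

Lemma cubeN N x : ~ cube N x <-> exists k, N <= `|co x k|.
Proof.
split=> [nx|[k Nk] /(_ k)]; last by rewrite -ltr_norml ltNge Nk.
apply: contrapT => nk; apply: nx => k; rewrite -ltr_norml ltNge.
by apply/negP => h; apply: nk; exists k.
Qed.

Lemma cubeS N N' : N <= N' -> cube N `<=` (cube N' : set (R4 R)).
Proof.
move=> NN x xN k; have := xN k; rewrite -!ltr_norml => h; exact: lt_le_trans h NN.
Qed.

Lemma supp_inS N N' f : N <= N' -> supp_in N f -> supp_in N' f.
Proof. by move=> NN sf x xN; apply: sf => /(cubeS NN). Qed.

Definition ccube N : set (R4 R) := [set x | forall k, - N <= co x k <= N].

Lemma cube_ccube N : cube N `<=` ccube N.
Proof. by move=> x xN k; have /andP[a b] := xN k; rewrite (ltW a) (ltW b). Qed.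

Lemma closed_ccube N : closed (ccube N).
Proof.
have -> : ccube N = \bigcap_k ((fun x => co x k) @^-1` `[- N, N]).
  apply/seteqP; split=> x h k; first by move=> _; rewrite /= in_itv/= h.
  by have := h k I; rewrite /= in_itv.
apply: closed_bigI => k _; apply: preimage_closed; last exact: itv_closed.
by move=> x _; exact: continuous_co.
Qed.

Lemma compact_ccube N : compact (ccube N).
Proof.
have sc : compact (`[- N, N] : set R) by exact: segment_compact.
have -> : ccube N = `[- N, N] `*` `[- N, N] `*` `[- N, N] `*` `[- N, N].
  apply/seteqP; split=> x.
    move=> h; have := (h (inord 0), h (inord 1), h (inord 2), h (inord 3)).
    by rewrite /co !inordK//= => -[[[a b] c] d]; rewrite !in_itv.
  rewrite /= !in_itv/= => -[[[a b] c] d] k.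
  by elim/ord4P: k; rewrite /co inordK.
by do 3 (apply: compact_setX => //).
Qed.

Lemma compact_in_cube (K : set (R4 R)) : compact K -> exists2 N, 0 < N & K `<=` cube N.
Proof.
move=> cK.
have H k : exists M : R, forall x, K x -> `|co x k| <= M.
  have : compact ((fun x : R4 R => co x k) @` K).
    by apply: continuous_compact => //; apply: continuous_subspaceT; exact: continuous_co.
  move=> /compact_bounded[M [_ hM]]; exists (M + 1) => x Kx.
  by apply: (hM (M + 1)); [rewrite ltrDl|exists x].
have /choice[M hM] := H.
exists (1 + \sum_k `|M k|); first by rewrite ltr_pwDl// sumr_ge0.
move=> x Kx k; rewrite -ltr_norml (le_lt_trans (hM k x Kx))//.
rewrite (bigD1 k)//= (le_lt_trans (ler_norm _))// addrCA ltrDl.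
by rewrite ltr_pwDl// sumr_ge0.
Qed.

Lemma test_supp phi : test_function phi -> exists2 N, 0 < N & supp_in N phi.
Proof.
move=> [_ /compact_in_cube[N N0 h]]; exists N => // x nx.
apply: contrapT => /eqP px; apply: nx; apply: h; exact: subset_closure.
Qed.

Lemma supp_test N phi : smooth phi -> supp_in N phi -> test_function phi.
Proof.
move=> sp sN; split=> //; apply: (subclosed_compact _ (@compact_ccube N)); first exact: closed_closure.
rewrite ((closure_id _).1 (@closed_ccube N)); apply: closureS => x /= px.
by apply: cube_ccube; apply: contrapT => nx; rewrite sN ?eqxx in px.
Qed.

(** The margin makes f vanish on a whole segment around the point. *)
Lemma supp_partial N j f : supp_in N f -> supp_in (N + 1) (partial j f).
Proof.
move=> sf x /cubeN[k Nk]; rewrite partial_line derive1E.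
rewrite (@near_eq_derive _ _ _ _ (fun=> 0)); first by rewrite derive_cst.
have := @nbhsx_ballx _ _ (co x j) 1 (@ltr01 R); apply: filterS => t.
rewrite /ball/= => xt; apply: sf; apply/cubeN; exists k; rewrite co_upd.
case: eqP => [kj|_]; last by rewrite (le_trans _ Nk)// lerDl.
rewrite kj in Nk; have := ler_dist_dist (co x j) t; have := ler_norm (`|co x j| - `|t|).
move: (`|co x j|) (`|t|) (`|_ - t|) xt (`|_ - _|) Nk => a b c c1 d h1 h2 h3; lra.
Qed.

Lemma supp_bounded N f : continuous f -> supp_in N f -> exists2 M, 0 < M & forall x, `|f x| <= M.
Proof.
move=> cf sf.
have : compact (f @` ccube N).
  by apply: continuous_compact; [apply: continuous_subspaceT|exact: compact_ccube].
move=> /compact_bounded[M [_ hM]]; exists (`|M| + 1); first by rewrite ltr_pwDr.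
move=> x; have [xN|xN] := pselect (cube N x).
  by apply: (hM (`|M| + 1)); [rewrite (le_lt_trans (ler_norm M))// ltrDl|exists x => //; exact: cube_ccube].
by rewrite sf// normr0 addr_ge0.
Qed.

Lemma testM phi psi : test_function phi -> test_function psi ->
  test_function (fun x => phi x * psi x).
Proof.
move=> tp [sq _]; have [N N0 sN] := test_supp tp.
by apply: (@supp_test N); [apply: smoothM => //; case: tp|move=> x /sN ->; rewrite mul0r].
Qed.

Lemma testB phi psi : test_function phi -> test_function psi ->
  test_function (fun x => phi x - psi x).
Proof.
move=> tp tq; have [N N0 sN] := test_supp tp; have [M M0 sM] := test_supp tq.
apply: (@supp_test (Num.max N M)); first by apply: smoothB; [case: tp|case: tq].
move=> x xN; rewrite (@supp_inS _ _ _ _ sN _ xN) ?(@supp_inS _ _ _ _ sM _ xN) ?subr0// le_max lexx ?orbT//.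
Qed.

Lemma test_partial j phi : test_function phi -> test_function (partial j phi).
Proof.
move=> tp; have [N N0 sN] := test_supp tp.
by apply: (@supp_test (N + 1)); [apply: smooth_partial; case: tp|exact: supp_partial].
Qed.

Lemma test_cont phi : test_function phi -> continuous phi.
Proof. by move=> [/smooth_cont]. Qed.

Lemma test_meas phi : test_function phi -> measurable_fun [set: mR4 R] phi.
Proof. by move=> /test_cont; exact: continuous_measurable4. Qed.

Lemma test_prodf N (psi : 'I_4 -> R -> R) : (forall k, smooth1 (psi k)) ->
  (forall k s, N <= `|s| -> psi k s = 0) -> test_function (prodf psi).
Proof.
move=> spsi hN; apply: (@supp_test N); first exact: smooth_prodf.
by move=> x /cubeN[k Nk]; rewrite (prodf_split _ k) hN// mulr0.
Qed.

Lemma partial_prodf (psi : 'I_4 -> R -> R) j x : smooth1 (psi j) ->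
  partial j (prodf psi) x = prodf (repl psi j (derive1 (psi j))) x.
Proof.
by move=> s; have [] := is_derive_prodf (@Cn_derivable _ _ _ (co x j) (s 0%N)).
Qed.

Lemma measurable_cube N : measurable (cube N : set (mR4 R)).
Proof. exact: measurable_oobox. Qed.

Lemma loc_integrable_cube h N : loc_integrable h -> leb4.-integrable (cube N) (EFin \o h).
Proof.
move=> [mh hK].
have mc : measurable (ccube N : set (mR4 R)).
  rewrite -[ccube N]setCK; apply: measurableC; apply: open_measurable4.
  by apply: closed_openC; exact: closed_ccube.
apply: (@integrableS _ (mR4 R) R leb4 (ccube N)); [exact: mc|exact: measurable_cube|exact: cube_ccube|].
apply/integrableP; split; last exact: hK _ (@compact_ccube N).
by apply/measurable_EFinP; apply: measurable_funS mh.
Qed.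

Lemma cube_loc_integrable h : measurable_fun [set: mR4 R] h ->
  (forall N, leb4.-integrable (cube N) (EFin \o h)) -> loc_integrable h.
Proof.
move=> mh hN; split=> // K cK; have [N N0 KN] := compact_in_cube cK.
have /integrableP[_] := hN N; apply: le_lt_trans.
apply: ge0_subset_integral => //; last first.
- by apply/measurable_EFinP; apply: measurableT_comp => //; apply: measurable_funS mh.
- exact: measurable_cube.
rewrite -[K]setCK; apply: measurableC; apply: open_measurable4.
apply: closed_openC; apply: compact_closed => //; exact: norm_hausdorff.
Qed.

Lemma integrable_supp N f : supp_in N f ->
  leb4.-integrable (cube N) (EFin \o f) -> leb4.-integrable [set: mR4 R] (EFin \o f).
Proof.
move=> sf /(integrable_mkcond _ (measurable_cube N)).1.
by congr integrable; apply/funext => x; rewrite patchE; case: ifPn => //; rewrite notin_setE => /sf /= ->.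
Qed.

Lemma integral_supp N f : supp_in N f ->
  (\int[leb4]_(x in cube N) (f x)%:E = \int[leb4]_x (f x)%:E)%E.
Proof.
move=> sf; rewrite integral_mkcond; apply: eq_integral => x _.
by rewrite patchE; case: ifPn => //; rewrite notin_setE => /sf /= ->.
Qed.

Lemma loc_integrable_mul h phi N : loc_integrable h -> continuous phi -> supp_in N phi ->
  leb4.-integrable [set: mR4 R] (fun x => (h x * phi x)%:E).
Proof.
move=> lh cphi sN; have [M M0 hM] := supp_bounded cphi sN.
have mphi := continuous_measurable4 cphi.
apply: (@integrable_supp N (fun x => h x * phi x)).
  by move=> x /sN ->; rewrite mulr0.
have iM := integrableZl (measurable_cube N) M (loc_integrable_cube N lh).
apply: (le_integrable (measurable_cube N) _ _ iM).
  by apply/measurable_EFinP; apply: measurable_funM; apply: (@measurable_funS _ _ (mR4 R) _ setT) => //; case: lh.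
move=> x _; rewrite /= lee_fin !normrM (gtr0_norm M0) mulrC.
by rewrite ler_wpM2r.
Qed.

End TestFunctions.

(** * Weak derivatives along lines *)

Lemma ae_eq_integrable d (T : measurableType d) (R : realType)
  (mu : {measure set T -> \bar R}) (f g : T -> \bar R) :
  measurable_fun setT g -> {ae mu, forall x, f x = g x} ->
  mu.-integrable setT f -> mu.-integrable setT g.
Proof.
move=> mg fg /integrableP[mf If]; apply/integrableP; split=> //.
rewrite (_ : (\int[mu]_x `|g x|)%E = (\int[mu]_x `|f x|)%E)//.
apply: ae_eq_integral => //; [exact: measurableT_comp|exact: measurableT_comp|].
by apply: ae_mono fg => x -> _.
Qed.

Section Smear.
Context d (X : measurableType d) (R : realType).
Variable m : {sigma_finite_measure set X -> \bar R}.
Local Notation leb := (@lebesgue_measure R).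
Local Notation mR := (measurableTypeR R).
Local Notation mX := (prodsf m leb).
Local Notation mXR := (prodsf mX leb).

Let flip (z : X * mR * mR) : X * mR * mR := ((z.1.1, z.2), z.1.2).

Lemma measurable_flip : measurable_fun setT flip.
Proof.
apply: measurable_fun_pair; first apply: measurable_fun_pair.
- by apply: measurableT_comp; [exact: measurable_fst|exact: measurable_fst].
- exact: measurable_snd.
- by apply: measurableT_comp; [exact: measurable_snd|exact: measurable_fst].
Qed.

Lemma ge0_integral_flip (P : X * mR * mR -> \bar R) : measurable_fun setT P ->
  (forall z, 0 <= P z)%E ->
  (\int[mXR]_z P (flip z) = \int[mXR]_z P z)%E.
Proof.
move=> mP P0.
have mPf : measurable_fun setT (P \o flip) by apply: measurableT_comp => //; exact: measurable_flip.
have E (Q : X * mR * mR -> \bar R) : measurable_fun setT Q -> (forall z, 0 <= Q z)%E ->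
    (\int[mXR]_z Q z = \int[m]_y \int[leb]_t \int[leb]_s Q ((y, t), s))%E.
  move=> mQ Q0.
  have mF := @measurable_fun_fubini_tonelli_F _ _ _ _ _ leb Q mQ Q0.
  have F0 z : (0 <= fubini_F leb Q z)%E by apply: integral_ge0 => s _; exact: Q0.
  apply: etrans (@fubini_tonelli1 _ _ _ _ _ mX leb Q mQ Q0) _.
  exact: (@fubini_tonelli1 _ _ _ _ _ m leb (fubini_F leb Q) mF F0).
apply: etrans (E _ mPf (fun z => P0 _)) _; apply: etrans (esym (E _ mP P0)).
apply: eq_integral => y _.
have mPy : measurable_fun setT (fun ts : mR * mR => P ((y, ts.1), ts.2)).
  apply: measurableT_comp mP _; apply: measurable_fun_pair; last exact: measurable_snd.
  by apply: measurable_fun_pair; [exact: measurable_cst|exact: measurable_fst].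
exact: esym (@fubini_tonelli _ _ _ _ _ leb leb _ mPy (fun z => P0 _)).
Qed.

Lemma integral_flip (P : X * mR * mR -> \bar R) : measurable_fun setT P ->
  (\int[mXR]_z P (flip z) = \int[mXR]_z P z)%E.
Proof.
move=> mP; rewrite [LHS]integralE [RHS]integralE; congr (_ - _)%E.
  rewrite -(ge0_integral_flip (measurable_funepos mP) (funepos_ge0 P)).
  by apply: eq_integral => z _; rewrite !funeposE.
rewrite -(ge0_integral_flip (measurable_funeneg mP) (funeneg_ge0 P)).
by apply: eq_integral => z _; rewrite !funenegE.
Qed.

Variables (N : R) (u : X * mR -> R) (k : mR * mR -> R) (B : R).
Hypothesis N0 : 0 < N.
Hypothesis iu : mX.-integrable setT (EFin \o u).
Hypothesis mk : measurable_fun setT k.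
Hypothesis kB : forall z, `|k z| <= B.

(** An integral operator acting along the last variable. The weighted averages
    and the primitives along lines are both of this form. *)
Definition smear (x : X * mR) : R := \int[leb]_s (k (s, x.2) * u (x.1, s)).

Let mu : measurable_fun setT u.
Proof. by have /integrableP[/measurable_EFinP] := iu. Qed.

Let B0 : 0 <= B. Proof. exact: le_trans (kB (0, 0)). Qed.

Let mI : measurable_fun setT (\1_`]- N, N[ : mR -> R).
Proof. exact: measurable_indic. Qed.

(** The common majorant: kernel and weight are bounded, and the weight
    confines the extra variable to a bounded interval. *)
Lemma integrable_slab :
  mXR.-integrable setT (fun z => (u (flip z).1 * \1_`]- N, N[ z.1.2)%:E).
Proof.
have mf : measurable_fun setT (fun z : X * mR * mR => (u (flip z).1 * \1_`]- N, N[ z.1.2)%:E).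
  apply/measurable_EFinP; apply: measurable_funM.
    apply: measurableT_comp mu _; apply: measurableT_comp; first exact: measurable_fst.
    exact: measurable_flip.
  apply: measurableT_comp mI _; apply: measurableT_comp; first exact: measurable_snd.
  exact: measurable_fst.
apply/integrableP; split=> //.
rewrite -integral_flip; last exact: measurableT_comp.
rewrite (@fubini_tonelli1 _ _ _ _ _ mX leb); [|by apply: measurableT_comp => //; apply: measurableT_comp mf _; exact: measurable_flip|by move=> z; exact: abse_ge0].
have -> : (\int[mX]_x fubini_F leb (fun z => `|(u (flip (flip z)).1 * \1_`]- N, N[ (flip z).1.2)%:E|) x =
    \int[mX]_x ((N + N)%:E * `|(u x)%:E|))%E.
  apply: eq_integral => -[y s] _; rewrite /fubini_F /=.
  under eq_integral do rewrite normrM EFinM.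
  rewrite ge0_integralZl//; last first.
    by apply/measurable_EFinP; apply: measurableT_comp mI; exact: normr_measurable.
  rewrite muleC; congr (_ * _)%E.
  under eq_integral do rewrite ger0_norm//.
  rewrite integral_indic ?setIT; [|exact: measurableT|exact: measurable_itv].
  apply: etrans (lebesgue_measure_itv _) _.
  by rewrite /= lte_fin gt0_cp// -EFinD opprK.
rewrite ge0_integralZl//; last 2 first.
- by apply: measurableT_comp => //; case/integrableP: iu.
- by rewrite lee_fin addr_ge0// ltW.
by rewrite lte_mul_pinfty// ?lee_fin ?addr_ge0 ?(ltW N0)//; case/integrableP: iu.
Qed.

Variables (w : X * mR -> R) (C : R).
Hypothesis mw : measurable_fun setT w.
Hypothesis wC : forall x, `|w x| <= C * \1_`]- N, N[ x.2.

Let H z := k (z.2, z.1.2) * u (flip z).1 * w z.1.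

Let C0 : 0 <= C.
Proof.
have := wC (point, 0); rewrite indicE mem_set ?mulr1; last by rewrite /= in_itv/= oppr_lt0 N0.
exact: le_trans.
Qed.

Let mH : measurable_fun setT H.
Proof.
apply: measurable_funM; first apply: measurable_funM.
- apply: measurableT_comp mk _; apply: measurable_fun_pair; first exact: measurable_snd.
  by apply: measurableT_comp; [exact: measurable_snd|exact: measurable_fst].
- apply: measurableT_comp mu _; apply: measurableT_comp; first exact: measurable_fst.
  exact: measurable_flip.
- by apply: measurableT_comp mw _; exact: measurable_fst.
Qed.

Let iH : mXR.-integrable setT (EFin \o H).
Proof.
have := integrableZl measurableT (B * C) integrable_slab; apply: le_integrable => //.
  exact/measurable_EFinP.
move=> z _; rewrite /H /= lee_fin !normrM.
rewrite (ger0_norm B0) (ger0_norm C0) (ger0_norm (x := \1_ _ _))//.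
have := kB (z.2, z.1.2); have := wC z.1.
move: (normr_ge0 (k (z.2, z.1.2))) (normr_ge0 (w z.1)) (normr_ge0 (u (flip z).1)).
move: (`|k _|) (`|w _|) (`|u _|) (\1_ _ _ : R) => a b c e a0 b0 c0 bC aB.
have -> : B * C * (c * e) = B * c * (C * e) by ring.
by apply: ler_pM => //; [exact: mulr_ge0|exact: ler_wpM2r].
Qed.

Let smearE : {ae mX, forall x, (\int[leb]_s (H (x, s))%:E = (smear x * w x)%:E)%E}.
Proof.
have := @ae_integrable1 _ _ _ _ _ mX leb _ integrable_slab.
apply: ae_mono => -[y t] /= iy.
have [tI|tI] := boolP (t \in `]- N, N[%classic); last first.
  have w0 : w (y, t) = 0.
    have := wC (y, t); rewrite indicE (negPf tI) mulr0 normr_le0 => /eqP//.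
  rewrite w0 mulr0; apply: integral0_eq => s _.
  by rewrite /H /= w0 mulr0.
have iu' : leb.-integrable setT (fun s => (u (y, s))%:E).
  move: iy; rewrite indicE tI; congr integrable.
  by apply/funext => s; rewrite mulr1.
have ik : leb.-integrable setT (fun s => (k (s, t) * u (y, s))%:E).
  have := integrableZl measurableT B iu'; apply: le_integrable => //.
    apply/measurable_EFinP; apply: measurable_funM.
      by apply: measurableT_comp mk _; apply: measurable_fun_pair.
    by apply: measurableT_comp mu _; apply: measurable_fun_pair.
  by move=> s _; rewrite /= lee_fin !normrM (ger0_norm B0) ler_wpM2r.
rewrite /H /=; under eq_integral do rewrite EFinM.
rewrite integralZr//; rewrite EFinM; congr (_ * _)%E.
by rewrite /smear /Rintegral fineK//; exact: integrable_fin_num.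
Qed.

Lemma measurable_smear : measurable_fun setT smear.
Proof.
apply: measurableT_comp; first exact: fine_measurable.
set K : X * mR * mR -> \bar R := fun z => (k (z.2, z.1.2) * u (flip z).1)%:E.
have mK : measurable_fun setT K.
  apply/measurable_EFinP; apply: measurable_funM.
    apply: measurableT_comp mk _; apply: measurable_fun_pair; first exact: measurable_snd.
    by apply: measurableT_comp; [exact: measurable_snd|exact: measurable_fst].
  apply: measurableT_comp mu _; apply: measurableT_comp; first exact: measurable_fst.
  exact: measurable_flip.
rewrite (_ : (fun x => _) = (fun x => fubini_F leb K^\+ x - fubini_F leb K^\- x)%E); last first.
  apply/funext => x; rewrite integralE; congr (_ - _)%E; apply: eq_integral => s _.
    by rewrite !funeposE.
  by rewrite !funenegE.
apply: emeasurable_funB; apply: (@measurable_fun_fubini_tonelli_F _ _ _ _ _ leb) => //.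
  exact: measurable_funepos.
exact: measurable_funeneg.
Qed.

Lemma integrable_smear : mX.-integrable setT (fun x => (smear x * w x)%:E).
Proof.
apply: (@ae_eq_integrable _ _ _ mX _ _ _ smearE (@integrable_fubini_F _ _ _ _ _ mX leb _ iH)).
by apply/measurable_EFinP; apply: measurable_funM => //; exact: measurable_smear.
Qed.

(** Fubini's theorem in the two copies of the last variable moves the kernel
    to the weight w. *)
Lemma integral_smear : (\int[mX]_x (smear x * w x)%:E =
  \int[mX]_x \int[leb]_t (k (x.2, t) * u x * w (x.1, t))%:E)%E.
Proof.
transitivity (\int[mX]_x \int[leb]_s (H (x, s))%:E)%E.
  apply: ae_eq_integral => //.
  - by apply/measurable_EFinP; apply: measurable_funM => //; exact: measurable_smear.
  - exact: (@measurable_fubini_F _ _ _ _ _ mX leb _ iH).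
  - by apply: ae_mono smearE => x E _.
have E := @integral12_prod_meas1 _ _ _ _ _ mX leb _ iH.
rewrite [LHS]E -[LHS]integral_flip; last exact/measurable_EFinP.
have iHf : mXR.-integrable setT (fun z => (H (flip z))%:E).
  apply/integrableP; split.
    by apply/measurable_EFinP; apply: measurableT_comp mH measurable_flip.
  have /integrableP[_] := iH; rewrite -integral_flip//.
  by apply: measurableT_comp => //; exact/measurable_EFinP.
rewrite -(@integral12_prod_meas1 _ _ _ _ _ mX leb _ iHf).
by apply: eq_integral => -[y s] _; apply: eq_integral => t _.
Qed.

End Smear.

Section Primitive.
Context {R : realType}.
Local Notation leb := (@lebesgue_measure R).

Definition prim (v : R -> R) s := \int[leb]_(r in `]-oo, s]) v r.

Lemma indic_below s : (fun t : R => (t <= s)%R%:R) = \1_`]-oo, s] :> (R -> R).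
Proof.
apply/funext => t; rewrite indicE; case: (leP t s) => ts.
  by rewrite mem_set//= in_itv.
by rewrite memNset//= in_itv/= leNgt ts.
Qed.

Lemma prim_indic (v : R -> R) s : prim v s = \int[leb]_t (v t * (t <= s)%R%:R).
Proof.
rewrite /prim [LHS]Rintegral_mkcond; apply: eq_Rintegral => r _.
rewrite patchE -[_%:R]/((fun t : R => (t <= s)%R%:R) r) indic_below indicE.
by case: (r \in _); rewrite ?mulr1 ?mulr0.
Qed.

Lemma integrable_below (v : R -> R) s : leb.-integrable setT (EFin \o v) ->
  leb.-integrable setT (fun t => (v t * (t <= s)%R%:R)%:E).
Proof.
move=> iv; apply: (le_integrable _ _ _ iv) => //.
  apply/measurable_EFinP; apply: measurable_funM.
    by apply/measurable_EFinP; case/integrableP: iv.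
  by rewrite indic_below; exact: measurable_indic.
move=> t _; rewrite /= lee_fin normrM ler_piMr//.
by case: (t <= s); rewrite ?normr1 ?normr0.
Qed.

Variables (N : R) (b : R -> R).
Hypothesis N0 : 0 < N.
Hypothesis sb : smooth1 b.
Hypothesis b0 : forall s, N <= `|s| -> b s = 0.

Lemma smooth1_continuous : continuous b.
Proof.
move=> x; apply: differentiable_continuous; apply/derivable1_diffP.
exact: Cn_derivable (sb 0).
Qed.

Lemma integrable_smooth1 : leb.-integrable setT (EFin \o b).
Proof.
have : leb.-integrable `[- N, N] (EFin \o b).
  apply: continuous_compact_integrable; first exact: segment_compact.
  by apply: continuous_subspaceT; exact: smooth1_continuous.
move=> /(@integrable_mkcond _ (measurableTypeR R) R leb _ (EFin \o b) (measurable_itv _)).1.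
congr integrable; apply/funext => s; rewrite patchE; case: ifPn => //.
rewrite notin_setE /= in_itv/= -ler_norml => /negP; rewrite -ltNge => /ltW h.
by rewrite b0.
Qed.

Lemma integrable_smooth1_itv (i : interval R) : leb.-integrable [set` i] (EFin \o b).
Proof.
by apply: (@integrableS _ (measurableTypeR R) R leb setT) integrable_smooth1 => //; exact: measurable_itv.
Qed.

Lemma is_derive_prim s : is_derive s (1:R) (prim b) (b s).
Proof.
have [//|dp ep] := @continuous_FTC1 R b -oo%O s (s + 1) _ (integrable_smooth1_itv _) (ltNyr _) (@smooth1_continuous s).
  by rewrite ltrDl.
by rewrite -[b s]ep derive1E; exact: DeriveDef.
Qed.

Lemma smooth1_prim : smooth1 (prim b).
Proof.
by move=> n; apply: CnS; apply: (Cn_derive1 is_derive_prim); exact: sb.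
Qed.

Lemma prim_le s : s <= - N -> prim b s = 0.
Proof.
move=> sN; rewrite /prim /Rintegral integral0_eq// => r /=; rewrite in_itv/= => rs; congr EFin; apply: b0.
by rewrite ler_normr lerNr (le_trans rs sN) orbT.
Qed.

Lemma prim_ge s : N <= s -> prim b s = \int[leb]_r b r.
Proof.
move=> sN; rewrite /prim [LHS]Rintegral_mkcond; apply: eq_Rintegral => r _.
rewrite patchE; case: ifPn => //; rewrite notin_setE /= in_itv/= => /negP.
by rewrite -ltNge => sr; rewrite b0// (le_trans sN)// (le_trans (ltW sr))// ler_norm.
Qed.

End Primitive.

Section Kernels.
Context {R : realType}.
Local Notation leb := (@lebesgue_measure R).
Variables (N : R).
Hypothesis N0 : 0 < N.

Let bN := bump (- N) N 0.
Let Z := \int[leb]_s bN s.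

Lemma bump_supp a b n s : - N <= a -> b <= N -> N <= `|s| -> bump a b n s = 0.
Proof.
move=> Na bN' Ns; apply: bump_eq0; apply/negP => /andP[as_ sb].
move: Ns; apply/negP; rewrite -ltNge ltr_norml (le_lt_trans Na as_).
exact: lt_le_trans bN'.
Qed.

Let sN : smooth1 bN. Proof. exact: smooth1_bump. Qed.
Let zN s : N <= `|s| -> bN s = 0. Proof. exact: bump_supp. Qed.

Lemma integral_bump_gt0 : 0 < Z.
Proof.
have mb : measurable_fun setT (EFin \o bN) by apply/measurable_EFinP; exact: measurable_bump.
have g0 : (0 <= \int[leb]_s (bN s)%:E)%E by apply: integral_ge0 => s _; rewrite lee_fin bump_ge0.
rewrite lt_neqAle; apply/andP; split; last by rewrite fine_ge0.
apply/eqP => Z0.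
have I0 : (\int[leb]_s `|(bN s)%:E| = 0)%E.
  transitivity (\int[leb]_s (bN s)%:E)%E.
    by apply: eq_integral => s _; rewrite abse_EFin ger0_norm ?bump_ge0.
  rewrite -(fineK (integrable_fin_num measurableT (integrable_smooth1 sN zN))).
  by congr EFin; exact: esym Z0.
have /(_ I0) := (@ae_eq_integral_abs _ (measurableTypeR R) R leb setT measurableT _ mb).1.
move=> [A [mA A0 sA]].
have : (leb [set` `]- N, N[%R] <= leb A)%E.
  apply: le_measure; [by apply: mem_set; exact: measurable_itv|exact: mem_set|].
  move=> s /=; rewrite in_itv/= => sI; apply: sA => /= /(_ I) [] /eqP.
  by rewrite gt_eqF// bump_gt0.
by rewrite A0 lebesgue_measure_itv/= lte_fin gt0_cp// -EFinD lee_fin opprK leNgt addr_gt0.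
Qed.

(** The average along the line with weight the normalized bump on ]- N, N[. It
    supplies the constant of integration. *)
Definition ker1 (z : measurableTypeR R * measurableTypeR R) : R := Z^-1 * bN z.1.

(** The primitive along the line whose average against the same bump is 0: the
    integral of this kernel in its second variable against the normalized bump
    vanishes. *)
Definition ker2 (z : measurableTypeR R * measurableTypeR R) : R :=
  Z^-1 * prim bN z.1 - (z.2 <= z.1)%R%:R.

Lemma measurable_ker1 : measurable_fun setT ker1.
Proof.
apply: measurable_funM; first exact: measurable_cst.
by apply: measurableT_comp; [exact: measurable_bump|exact: measurable_fst].
Qed.

Lemma measurable_ker2 : measurable_fun setT ker2.
Proof.
apply: measurable_funB.
  apply: measurable_funM; first exact: measurable_cst.
  apply: measurableT_comp; last exact: measurable_fst.
  apply: continuous_measurable_fun => x; exact: (smooth1_continuous (smooth1_prim sN zN)).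
rewrite (_ : (fun _ => _) = \1_[set z : measurableTypeR R * measurableTypeR R | z.2 <= z.1]).
  apply: measurable_indic; rewrite -[X in measurable X]setTI.
  by apply: measurable_fun_le; [exact: measurableT|exact: measurable_snd|exact: measurable_fst].
apply/funext => z; rewrite indicE; case: (leP z.2 z.1) => h; first by rewrite mem_set.
by rewrite memNset//= leNgt h.
Qed.

Lemma ker1_le z : `|ker1 z| <= Z^-1.
Proof.
have Z0 := integral_bump_gt0; rewrite normrM !ger0_norm ?bump_ge0 ?invr_ge0 ?(ltW Z0)//.
by rewrite ler_piMr ?bump_le1// invr_ge0 (ltW Z0).
Qed.

Lemma ker2_le z : `|ker2 z| <= 1.
Proof.
have Z0 := integral_bump_gt0.
have p0 s : 0 <= prim bN s by apply: Rintegral_ge0 => r _; exact: bump_ge0.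
have pZ s : prim bN s <= Z.
  rewrite prim_indic; apply: le_Rintegral => //.
  - exact: integrable_below (integrable_smooth1 sN zN).
  - exact: (integrable_smooth1 sN zN).
  - by move=> t _; rewrite ler_piMr ?bump_ge0//; case: (t <= s).
have a0 : 0 <= Z^-1 * prim bN z.1 by rewrite mulr_ge0// invr_ge0 (ltW Z0).
have a1 : Z^-1 * prim bN z.1 <= 1 by rewrite ler_pdivrMl// mulr1.
by rewrite /ker2 ler_norml; case: (z.2 <= z.1)%R => /=; apply/andP; split; lra.
Qed.

Variables (a b : R) (n : nat).
Hypotheses (Na : - N <= a) (bN' : b <= N).
Let bt := bump a b n.
Let mt := \int[leb]_s bt s.
Let sbt : smooth1 bt. Proof. exact: smooth1_bump. Qed.
Let zbt s : N <= `|s| -> bt s = 0. Proof. exact: bump_supp. Qed.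

(** Subtracting a multiple of the normalized bump makes the integral 0, so
    that the primitive has compact support and can be a factor of a test
    function. *)
Definition centered s : R := bt s - mt * (Z^-1 * bN s).

Lemma smooth1_centered : smooth1 centered.
Proof.
move=> k; apply: CnB; first exact: sbt.
by apply: CnM; [exact: Cn_cst|apply: CnM; [exact: Cn_cst|exact: sN]].
Qed.

Lemma centered_supp s : N <= `|s| -> centered s = 0.
Proof. by move=> Ns; rewrite /centered zbt// zN// !mulr0 subr0. Qed.

Let ibN : leb.-integrable setT (fun s => (mt * (Z^-1 * bN s))%:E).
Proof.
have := integrableZl measurableT (mt * Z^-1) (integrable_smooth1 sN zN).
by congr integrable; apply/funext => s; rewrite /= -EFinM -mulrA.
Qed.

Lemma prim_centered s : prim centered s = prim bt s - mt * (Z^-1 * prim bN s).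
Proof.
rewrite /prim RintegralB//.
- by rewrite mulrA -RintegralZl//; [congr (_ - _); apply: eq_Rintegral => r _; rewrite mulrA|exact: integrable_smooth1_itv sN zN _].
- exact: integrable_smooth1_itv sbt zbt _.
- by apply: integrableS measurableT _ _ ibN.
Qed.

Lemma prim_centered_supp s : N <= `|s| -> prim centered s = 0.
Proof.
rewrite ler_normr => /orP[Ns|Ns]; last first.
  by apply: (prim_le centered_supp); rewrite lerNr.
rewrite prim_centered (prim_ge zbt)// (prim_ge zN)// mulVf ?mulr1 ?subrr//.
by rewrite gt_eqF// integral_bump_gt0.
Qed.

Lemma integral_ker1 s : (\int[leb]_t (ker1 (s, t) * bt t)%:E =
  (mt * (Z^-1 * bN s))%:E)%E.
Proof.
rewrite /ker1 /=; under eq_integral do rewrite EFinM.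
rewrite integralZl//; last exact: integrable_smooth1 sbt zbt.
rewrite -[X in (_ * X)%E]fineK; first by rewrite -EFinM mulrC.
exact: integrable_fin_num (integrable_smooth1 sbt zbt).
Qed.

Lemma integral_ker2 s : (\int[leb]_t (ker2 (s, t) * bt t)%:E = (- prim centered s)%:E)%E.
Proof.
have ib := integrable_smooth1 sbt zbt.
have i1 : leb.-integrable setT (fun t => (Z^-1 * prim bN s * bt t)%:E).
  by have := integrableZl measurableT (Z^-1 * prim bN s) ib; congr integrable; apply/funext => t; rewrite /= EFinM.
have i2 : leb.-integrable setT (fun t => (bt t * (t <= s)%R%:R)%:E).
  exact: integrable_below.
transitivity (\int[leb]_t ((Z^-1 * prim bN s * bt t)%:E - (bt t * (t <= s)%R%:R)%:E))%E.
  by apply: eq_integral => t _; rewrite /ker2 /= mulrBl EFinB [X in (_ - X%:E)%E]mulrC.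
rewrite integralB//; under eq_integral do rewrite EFinM.
rewrite integralZl//.
rewrite -[X in (_ * X - _)%E]fineK ?(integrable_fin_num ib)//.
rewrite -[X in (_ - X)%E]fineK ?(integrable_fin_num i2)//.
rewrite -EFinM -EFinB; congr EFin.
rewrite prim_centered opprB; congr (_ - _); last by rewrite prim_indic.
  by rewrite mulrC.
- exact: integrable_fin_num i2.
- exact: integrable_fin_num ib.
Qed.

End Kernels.

Lemma integrable_mul_bounded d (T : measurableType d) (R : realType)
  (mu : {measure set T -> \bar R}) (u v : T -> R) (C : R) :
  mu.-integrable setT (EFin \o u) -> measurable_fun setT v ->
  (forall x, `|v x| <= C) -> mu.-integrable setT (fun x => (u x * v x)%:E).
Proof.
move=> iu mv vC; have := integrableZl measurableT C iu; apply: le_integrable => //.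
  by apply/measurable_EFinP; apply: measurable_funM => //; apply/measurable_EFinP; case/integrableP: iu.
move=> x _; rewrite /= lee_fin !normrM mulrC ler_wpM2r//.
exact: le_trans (vC x) (ler_norm _).
Qed.

Section WeakLines.
Context {R : realType}.
Local Notation leb := (@lebesgue_measure R).
Local Notation i3 := (inord 3 : 'I_4).

Lemma co_pair (x : R4 R) t k : co (x.1, t) k = if k == i3 then t else co x k.
Proof. by elim/ord4P: k; rewrite /co -val_eqE /= !inordK. Qed.

Lemma co_i3 (x : R4 R) : co x i3 = x.2.
Proof. by rewrite /co inordK. Qed.

Lemma prodf_sw j (psi : 'I_4 -> R -> R) x :
  prodf psi (sw j x) = prodf (psi \o tperm j i3) x.
Proof.
rewrite /prodf (reindex_inj (@perm_inj _ (tperm j i3))) /=.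
by apply: eq_bigr => k _; rewrite co_sw tpermK.
Qed.

Definition cut N (h : R4 R -> R) : mR4 R -> R := fun x => h x * \1_(cube N) x.

Lemma cut_in N h x : cube N x -> cut N h x = h x.
Proof. by move=> xN; rewrite /cut indicE mem_set// mulr1. Qed.

Lemma cut_supp N h : supp_in N (cut N h : R4 R -> R).
Proof. by move=> x xN; rewrite /cut indicE memNset// mulr0. Qed.

Lemma integrable_cut N h : loc_integrable h -> leb4.-integrable setT (EFin \o cut N h).
Proof.
move=> lh; apply: (@integrable_supp _ N _ (@cut_supp N h)).
have := loc_integrable_cube N lh; apply: eq_integrable; first exact: measurable_cube.
by move=> x /set_mem xN; rewrite /= cut_in.
Qed.

Lemma cut_sw N j h x : cut N (fun y => h (sw j y)) x = cut N h (sw j x).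
Proof.
rewrite /cut; congr (_ * _); rewrite !indicE; congr (nat_of_bool _)%:R.
rewrite -[RHS]/(x \in sw j @^-1` cube N) oobox_sw; congr (_ \in oobox _ _).
Qed.

Lemma integrable_cut_sw N j h : loc_integrable h ->
  leb4.-integrable setT (EFin \o cut N (fun y => h (sw j y))).
Proof.
move=> lh; have := integrable_sw j (integrable_cut N lh).
by congr integrable; apply/funext => x; rewrite /= cut_sw.
Qed.

(** Moving the two kernels to the test function leaves the integral of f
    against a centered bump plus the integral of g against the primitive of
    that bump. This is the weak derivative tested on the product whose j-th
    factor is the primitive, hence 0. *)
Lemma weak_lines_test j (f g : R4 R -> R) N a b n : 0 < N -> is_wpartial j f g ->
  (forall k, - N <= a k /\ b k <= N) ->
  (\int[leb4]_(x in cube N) ((cut N (fun y => f (sw j y)) x -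
     smear (cut N (fun y => f (sw j y))) (ker1 N) x -
     smear (cut N (fun y => g (sw j y))) (ker2 N) x) * bump4 a b n x)%:E)%E = 0%E.
Proof.
move=> N0 [lf lg wfg] ab.
set u := cut N (fun y => f (sw j y)); set v := cut N (fun y => g (sw j y)).
have iu : leb4.-integrable setT (EFin \o u) := integrable_cut_sw N j lf.
have iv : leb4.-integrable setT (EFin \o v) := integrable_cut_sw N j lg.
pose bb k := bump (a k) (b k) n.
pose bt := bb i3.
pose E (x : R4 R) := \prod_(k | k != i3) bb k (co x k).
have [a3 b3] := ab i3.
set w : mR4 R -> R := bump4 a b n.
have sbb k : smooth1 (bb k) by exact: smooth1_bump.
have zbb k s : N <= `|s| -> bb k s = 0 by have [] := ab k; exact: bump_supp.
have wE x t : w (x.1, t) = E x * bt t.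
  rewrite /w /bump4 (prodf_split _ i3) co_pair eqxx; congr (_ * _).
  by apply: eq_bigr => k /negPf ki; rewrite co_pair ki.
have wE' x : w x = E x * bt x.2 by rewrite -wE; case: x.
have mw : measurable_fun setT w by apply: measurable_prodf => k; exact: measurable_bump.
have mE : measurable_fun [set: mR4 R] E.
  rewrite (_ : E = prodf (repl bb i3 (fun=> 1))); last first.
    by apply/funext => x; rewrite prodf_repl mulr1.
  apply: measurable_prodf => k; rewrite /repl; case: eqP => _; last exact: measurable_bump.
  exact: measurable_cst.
have E1 x : `|E x| <= 1.
  by rewrite normr_prod; apply: prodr_ile1 => k _; rewrite normr_ge0 ger0_norm ?bump_ge0 ?bump_le1.
have bt1 s : `|bt s| <= 1 by rewrite ger0_norm ?bump_ge0 ?bump_le1.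
have wC (x : mR3 R * measurableTypeR R) : `|w x| <= 1 * \1_`]- N, N[ x.2.
  rewrite mul1r wE'; have [xN|xN] := boolP (x.2 \in (`]- N, N[%classic : set R)).
    by rewrite indicE xN normrM mulr_ile1.
  rewrite indicE (negPf xN) /bt zbb ?mulr0 ?normr0//.
  by move: xN; rewrite notin_setE /= in_itv/= -ltr_norml => /negP; rewrite -leNgt.
have pull (k : measurableTypeR R * measurableTypeR R -> R) B (c : R) (x : R4 R) :
    measurable_fun setT k -> (forall z, `|k z| <= B) ->
    (\int[leb]_t (k (x.2, t) * c * w (x.1, t))%:E =
     (c * E x)%:E * \int[leb]_t (k (x.2, t) * bt t)%:E)%E.
  move=> mk kB.
  have ik : leb.-integrable setT (fun t => (k (x.2, t) * bt t)%:E).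
    have ib := integrable_smooth1 (sbb i3) (zbb i3).
    have mkx : measurable_fun setT (fun t => k (x.2, t)).
      by apply: measurableT_comp mk _; exact: measurable_fun_pair.
    have := integrable_mul_bounded ib mkx (fun t => kB (x.2, t)).
    by congr integrable; apply/funext => t; rewrite mulrC.
  rewrite -integralZl//; apply: eq_integral => t _; rewrite wE -EFinM; congr EFin.
  by ring.
pose Zi := (\int[leb]_s bump (- N) N 0 s)^-1.
pose mt := \int[leb]_s bt s.
pose Psi := prim (centered N (a i3) (b i3) n).
have sc : smooth1 (centered N (a i3) (b i3) n) by exact: smooth1_centered.
have zc s : N <= `|s| -> centered N (a i3) (b i3) n s = 0 by exact: centered_supp.
have sPsi : smooth1 Psi by exact: (smooth1_prim sc zc).
have zPsi s : N <= `|s| -> Psi s = 0 by exact: prim_centered_supp.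
pose A2 (x : mR4 R) := E x * (mt * (Zi * bump (- N) N 0 x.2)).
pose A3 (x : mR4 R) := E x * - Psi x.2.
have I1 := @integral_smear _ _ _ leb3 N u (ker1 N) _ N0 iu (@measurable_ker1 _ N) (ker1_le N0) w 1 mw wC.
have I2 := @integral_smear _ _ _ leb3 N v (ker2 N) _ N0 iv (@measurable_ker2 _ N) (ker2_le N0) w 1 mw wC.
have i1 := @integrable_smear _ _ _ leb3 N u (ker1 N) _ N0 iu (@measurable_ker1 _ N) (ker1_le N0) w 1 mw wC.
have i2 := @integrable_smear _ _ _ leb3 N v (ker2 N) _ N0 iv (@measurable_ker2 _ N) (ker2_le N0) w 1 mw wC.
have I1' : (\int[leb4]_x (smear u (ker1 N) x * w x)%:E = \int[leb4]_x (u x * A2 x)%:E)%E.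
  apply: etrans I1 _; apply: eq_integral => x _.
  rewrite (pull _ _ _ _ (@measurable_ker1 _ N) (ker1_le N0)) integral_ker1// -EFinM.
  by congr EFin; rewrite /A2 mulrA.
have I2' : (\int[leb4]_x (smear v (ker2 N) x * w x)%:E = \int[leb4]_x (v x * A3 x)%:E)%E.
  apply: etrans I2 _; apply: eq_integral => x _.
  rewrite (pull _ _ _ _ (@measurable_ker2 _ N) (ker2_le N0)) integral_ker2// -EFinM.
  by congr EFin; rewrite /A3 mulrA.
have mA2 : measurable_fun setT A2.
  apply: measurable_funM => //; apply: measurable_funM; first exact: measurable_cst.
  apply: measurable_funM; first exact: measurable_cst.
  by apply: measurableT_comp; [exact: measurable_bump|exact: measurable_snd].
have mPsi : measurable_fun setT Psi.
  exact: continuous_measurable_fun (smooth1_continuous sPsi).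
have mA3 : measurable_fun setT A3.
  apply: measurable_funM => //; apply: measurableT_comp; first exact: oppr_measurable.
  by apply: measurableT_comp mPsi _; exact: measurable_snd.
have zrepl (c : R -> R) k s : (forall s, N <= `|s| -> c s = 0) -> N <= `|s| ->
    repl bb i3 c k s = 0.
  by move=> zC Ns; rewrite /repl; case: eqP => _; [exact: zC|exact: zbb].
have supprepl (c : R -> R) : (forall s, N <= `|s| -> c s = 0) -> supp_in N (prodf (repl bb i3 c)).
  by move=> zC x /cubeN[k Nk]; rewrite (prodf_split _ k) zrepl// mulr0.
have replE (c : R -> R) (x : R4 R) : prodf (repl bb i3 c) x = E x * c x.2.
  by rewrite prodf_repl co_i3.
have srepl (c : R -> R) k : smooth1 c -> smooth1 (repl bb i3 c k).
  by move=> sC; rewrite /repl; case: eqP.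
have [B B0 A3B] : exists2 B, 0 < B & forall x, `|A3 x| <= B.
  have cP : continuous (prodf (repl bb i3 Psi)).
    by apply: smooth_cont; apply: smooth_prodf => k; exact: srepl.
  have [B B0 hB] := supp_bounded cP (supprepl _ zPsi).
  by exists B => // x; have := hB x; rewrite replE /A3 mulrN normrN.
have A2B x : `|A2 x| <= `|mt * Zi|.
  rewrite /A2 normrM mulrA normrM -[leRHS]mul1r ler_pM//.
  by rewrite ler_piMr// ger0_norm ?bump_ge0 ?bump_le1.
have iA1 := integrable_mul_bounded iu mw (fun x => le_trans (wC x) (_ : _ <= 1)).
have {}iA1 : leb4.-integrable setT (fun x => (u x * w x)%:E).
  by apply: iA1 => x; rewrite mul1r indicE; case: (_ \in _).
have iA2 := integrable_mul_bounded iu mA2 A2B.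
have iA3 := integrable_mul_bounded iv mA3 A3B.
(* The test function: in the original coordinates the factor Psi stands at
   position j. *)
pose psi0 := repl bb i3 Psi \o tperm j i3.
have spsi0 k : smooth1 (psi0 k) by exact: srepl.
have tphi : test_function (prodf psi0).
  by apply: (@test_prodf _ N) => // k s; exact: zrepl.
have phiE x : prodf psi0 (sw j x) = E x * Psi x.2.
  rewrite prodf_sw -replE; congr (prodf _ x).
  by apply/funext => k; rewrite /psi0 /= tpermK.
have dphiE x : partial j (prodf psi0) (sw j x) = E x * centered N (a i3) (b i3) n x.2.
  rewrite partial_prodf// prodf_sw -replE; congr (prodf _ x).
  have -> : derive1 (psi0 j) = centered N (a i3) (b i3) n.
    rewrite /psi0 /comp tpermL {1}/repl eqxx.
    by apply/funext => s; rewrite derive1E; have [_ ->] := is_derive_prim sc zc s.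
  apply/funext => k; rewrite /repl /comp; have [->|ki] := eqVneq k i3.
    by rewrite tpermR eqxx.
  rewrite ifF; first by rewrite /psi0 /repl /comp tpermK (negPf ki).
  apply/eqP => h; move/eqP: ki; apply.
  by apply: (@perm_inj _ (tperm j i3)); rewrite h tpermR.
have [M M0 sM] := test_supp tphi.
have tdphi := test_partial j tphi.
have [M' M'0 sM'] := test_supp tdphi.
have iP1 := loc_integrable_mul lf (test_cont tdphi) sM'.
have iP2 := loc_integrable_mul lg (test_cont tphi) sM.
have W : (\int[leb4]_x (f x * partial j (prodf psi0) x)%:E + \int[leb4]_x (g x * prodf psi0 x)%:E = 0)%E.
  rewrite -(fineK (integrable_fin_num measurableT iP1)).
  rewrite -(fineK (integrable_fin_num measurableT iP2)) -EFinD; congr EFin.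
  by apply/eqP; rewrite addr_eq0; apply/eqP; exact: wfg.
have S1 := integral_sw_signed j (measurable_int _ iP1).
have S2 := integral_sw_signed j (measurable_int _ iP2).
have iS1 := integrable_sw j iP1.
have iS2 := integrable_sw j iP2.
rewrite (@integral_supp _ N (fun x => _ * w x)); last first.
  by move=> x /cubeN[k Nk]; rewrite /w /bump4 (prodf_split _ k) [X in _ * (_ * X)](zbb k _ Nk) !mulr0.
have split1 x : (((u x - smear u (ker1 N) x - smear v (ker2 N) x) * w x)%:E =
   ((u x * w x)%:E - (smear u (ker1 N) x * w x)%:E) - (smear v (ker2 N) x * w x)%:E)%E.
  by rewrite -!EFinB !mulrBl.
apply: etrans (eq_integral _ _ (fun x _ => split1 x)) _.
have iD1 : leb4.-integrable setT (fun x => (u x * w x)%:E - (smear u (ker1 N) x * w x)%:E)%E.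
  exact: (integrableB measurableT iA1 i1).
apply: etrans (integralB measurableT iD1 i2) _.
rewrite (integralB measurableT iA1 i1) I1' I2'.
rewrite -(integralB measurableT iA1 iA2).
have iD2 : leb4.-integrable setT (fun x => (u x * w x)%:E - (u x * A2 x)%:E)%E.
  exact: (integrableB measurableT iA1 iA2).
apply: etrans (esym (integralB measurableT iD2 iA3)) _.
apply: etrans _ W; rewrite -S1 -S2 -(integralD measurableT iS1 iS2).
apply: eq_integral => x _.
suff H : u x * w x - u x * A2 x - v x * A3 x = f (sw j x) * partial j (prodf psi0) (sw j x) + g (sw j x) * prodf psi0 (sw j x)
  by apply: etrans (congr1 EFin H) _; rewrite EFinD.
have alg (p q e t m s : R) : p * (e * t) - p * (e * m) - q * (e * - s) =
    p * (e * (t - m)) + q * (e * s) by ring.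
rewrite dphiE phiE wE' /A2 /A3.
have [xN|xN] := pselect (cube N x).
  by rewrite /u /v !cut_in//; exact: alg.
have alg0 (p q c m s : R) : 0 * c - 0 * m - 0 * s = p * 0 + q * 0 by ring.
have u0 : u x = 0 by exact: cut_supp xN.
have v0 : v x = 0 by exact: cut_supp xN.
have c0 := supprepl _ zc x xN; have P0 := supprepl _ zPsi x xN.
by rewrite replE in c0; rewrite replE in P0; rewrite c0 P0 u0 v0; exact: alg0.
Qed.

End WeakLines.

Section AeSections.
Context d1 d2 (T1 : measurableType d1) (T2 : measurableType d2) (R : realType).
Variables (m1 : {sigma_finite_measure set T1 -> \bar R}).
Variables (m2 : {sigma_finite_measure set T2 -> \bar R}).

Lemma null_sections (A : set (T1 * T2)) : measurable A ->
  (m1 \x m2)%E A = 0%E <-> {ae m1, forall x, m2 (xsection A x) = 0%E}.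
Proof.
move=> mA; rewrite /product_measure1.
have mf : measurable_fun setT (m2 \o xsection A) by exact: measurable_fun_xsection.
have E : (\int[m1]_x (m2 \o xsection A) x = \int[m1]_x `|(m2 \o xsection A) x|)%E.
  by apply: eq_integral => x _; rewrite gee0_abs//; exact: measure_ge0.
rewrite E; split=> [/(ae_eq_integral_abs m1 measurableT mf).1|h].
  by apply: ae_mono => x; exact.
apply/(ae_eq_integral_abs m1 measurableT mf).2.
by apply: ae_mono h => x hx _.
Qed.

Lemma ae_section (P : T1 * T2 -> Prop) : {ae (prodsf m1 m2), forall x, P x} ->
  {ae m1, forall x, {ae m2, forall y, P (x, y)}}.
Proof.
move=> [A [mA A0 PA]]; have := (null_sections mA).1 A0.
apply: ae_mono => x Ax; exists (xsection A x); split=> //.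
  exact: measurable_xsection.
by move=> y /= nP; rewrite -in_setE mem_xsection in_setE; apply: PA.
Qed.

(** The measurability assumption is what allows a null set to be recognized
    from its sections. *)
Lemma section_ae (P : T1 * T2 -> Prop) : measurable [set x | ~ P x] ->
  {ae m1, forall x, {ae m2, forall y, P (x, y)}} -> {ae (prodsf m1 m2), forall x, P x}.
Proof.
move=> mP h; exists [set x | ~ P x]; split=> //; apply/(null_sections mP).2.
apply: ae_mono h => x [B [mB B0 PB]].
apply/eqP; rewrite eq_le measure_ge0 andbT -B0; apply: le_measure.
- by rewrite in_setE; exact: measurable_xsection.
- by rewrite in_setE.
- by move=> y /=; rewrite -in_setE mem_xsection in_setE; exact: PB.
Qed.

End AeSections.

Section LineFormula.
Context {R : realType}.
Local Notation leb := (@lebesgue_measure R).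

(** Up to a constant, smearing with [ker2] integrates from - N, since the
    indicators of t <= s and of s < t add up to 1. *)
Lemma line_formula (N : R) (v g : R -> R) (t : R) : 0 < N ->
  leb.-integrable setT (EFin \o v) -> leb.-integrable `[- N, N] (EFin \o g) ->
  (forall s, s \in `]- N, N[ -> v s = g s) -> (forall s, s \notin `]- N, N[ -> v s = 0) ->
  t \in `]- N, N[ ->
  \int[leb]_s (ker2 N (s, t) * v s) =
  (\int[leb]_s (ker2 N (s, 0) * v s) + \int[leb]_s (v s * (0 <= s)%R%:R) - \int[leb]_s v s)
  + \int[leb]_(r in `[- N, t]) g r.
Proof.
move=> N0 iv ig vg v0 tN.
have mk u : measurable_fun setT (fun s => ker2 N (s, u)).
  apply: measurableT_comp (@measurable_ker2 _ N) _.
  exact: measurable_fun_pair.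
have ik u : leb.-integrable setT (fun s => (ker2 N (s, u) * v s)%:E).
  have := integrable_mul_bounded iv (mk u) (fun s => ker2_le N0 (s, u)).
  by congr integrable; apply/funext => s; rewrite mulrC.
have ia u : leb.-integrable setT (fun s => (v s * (u <= s)%R%:R)%:E).
  apply: (integrable_mul_bounded (C := 1) iv).
    rewrite (_ : (fun _ => _) = \1_`[u, +oo[); first exact: measurable_indic.
    apply/funext => s; rewrite indicE; case: (leP u s) => us.
      by rewrite mem_set//= in_itv/= us.
    by rewrite memNset//= in_itv/= andbT leNgt us.
  by move=> s; case: (u <= s)%R; rewrite ?normr1 ?normr0.
have E : \int[leb]_s (ker2 N (s, t) * v s) = \int[leb]_s (ker2 N (s, 0) * v s)
    + \int[leb]_s (v s * (0 <= s)%R%:R) - \int[leb]_s (v s * (t <= s)%R%:R).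
  have iD : leb.-integrable setT (EFin \o ((fun s => ker2 N (s, 0) * v s) \+ (fun s => v s * (0 <= s)%R%:R))).
    by have := integrableD measurableT (ik 0) (ia 0); congr integrable.
  rewrite -(RintegralD measurableT (ik 0) (ia 0)) -(RintegralB measurableT iD (ia t)).
  by apply: eq_Rintegral => s _; rewrite /ker2 /=; ring.
have [Nt tN'] : - N < t /\ t < N by move: tN; rewrite in_itv/= => /andP[].
have iS (i : interval R) : [set` i] `<=` `[- N, N] -> leb.-integrable [set` i] (EFin \o g).
  move=> sub; apply: (@integrableS _ (measurableTypeR R) R leb _ _ _ _ _ sub ig);
    exact: measurable_itv.
have G : \int[leb]_(r in `[- N, t]) g r = \int[leb]_s v s - \int[leb]_s (v s * (t <= s)%R%:R).
  rewrite -Rintegral_itv_bndo_bndc; last first.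
    by apply: iS => s; rewrite /= !in_itv/= => /andP[-> st]; rewrite (ltW (lt_trans st tN')).
  rewrite -Rintegral_itv_obnd_cbnd; last first.
    apply: iS => s; rewrite /= !in_itv/= => /andP[Ns st].
    by rewrite (ltW Ns) (ltW (lt_trans st tN')).
  rewrite -(RintegralB measurableT iv (ia t)) Rintegral_mkcond; apply: eq_Rintegral => s _.
  rewrite patchE; case: ifPn => [/set_mem/=|].
    rewrite in_itv/= => /andP[Ns st].
    by rewrite vg ?in_itv/= ?Ns ?(lt_trans st tN')// leNgt st mulr0 subr0.
  rewrite notin_setE /= in_itv/= => /negP; rewrite negb_and -!leNgt => /orP[sN|ts].
    by rewrite v0 ?mul0r ?subr0// in_itv/= ltNge sN.
  by rewrite ts mulr1 subrr.
by rewrite E G; ring.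
Qed.

End LineFormula.

Section WeakLineInequality.
Context {R : realType}.
Local Notation leb := (@lebesgue_measure R).
Local Notation i3 := (inord 3 : 'I_4).

Lemma weak_smear j (f g : R4 R -> R) N : 0 < N -> is_wpartial j f g ->
  {ae leb4, forall x : mR4 R, cube N x ->
    f (sw j x) = smear (cut N (fun y => f (sw j y))) (ker1 N) x +
                 smear (cut N (fun y => g (sw j y))) (ker2 N) x}.
Proof.
move=> N0 wfg; have [lf lg _] := wfg.
set u := cut N (fun y => f (sw j y)); set v := cut N (fun y => g (sw j y)).
have iu : leb4.-integrable setT (EFin \o u) := integrable_cut_sw N j lf.
have iv : leb4.-integrable setT (EFin \o v) := integrable_cut_sw N j lg.
pose w : mR4 R -> R := \1_(cube N).
have mw : measurable_fun setT w by apply: measurable_indic; exact: measurable_cube.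
have wC (x : mR3 R * measurableTypeR R) : `|w x| <= 1 * \1_`]- N, N[ x.2.
  rewrite mul1r /w !indicE; have [xN|xN] := pselect (cube N x).
    by rewrite !mem_set//= ?normr1// in_itv/= -(co_i3 x).
  by rewrite (memNset xN) normr0.
have i1 := @integrable_smear _ _ _ leb3 N u (ker1 N) _ N0 iu (@measurable_ker1 _ N) (ker1_le N0) w 1 mw wC.
have i2 := @integrable_smear _ _ _ leb3 N v (ker2 N) _ N0 iv (@measurable_ker2 _ N) (ker2_le N0) w 1 mw wC.
have onc (h : mR4 R -> R) : leb4.-integrable setT (fun x => (h x * w x)%:E) ->
    leb4.-integrable (cube N) (EFin \o h).
  move=> ih; apply/(@integrable_mkcond _ (mR4 R) R leb4 _ _ (measurable_cube N)).
  move: ih; congr integrable; apply/funext => x; rewrite patchE /w indicE.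
  by case: ifPn => _; rewrite ?mulr1 ?mulr0.
have iu' : leb4.-integrable (cube N) (EFin \o u).
  by apply: (@integrableS _ (mR4 R) R leb4 _ _ _ measurableT _ _ iu) => //; exact: measurable_cube.
have ih : leb4.-integrable (cube N)
    (EFin \o (fun x => u x - smear u (ker1 N) x - smear v (ker2 N) x)).
  have := integrableB (measurable_cube N) (integrableB (measurable_cube N) iu' (onc _ i1)) (onc _ i2).
  by congr integrable.
have := dubois_reymond ih (fun a b n ab => weak_lines_test n N0 wfg ab).
apply: ae_mono => x H xN; have := H xN; rewrite {1}/u cut_in// => /eqP.
by rewrite -addrA -opprD subr_eq0 => /eqP.
Qed.

(** Absolute continuity on lines: [weak_smear] holds on almost every line by
    Fubini's theorem, and there it writes f as a primitive of g. The bound N0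
    depends on the line because a cube only meets the lines that pass through
    its base. *)
Lemma weak_line_formula j (f g : R4 R -> R) : is_wpartial j f g ->
  {ae leb3, forall y : mR3 R, exists N0 : nat, forall N : nat, (N0 <= N)%N ->
    leb.-integrable `[- N%:R, N%:R] (EFin \o (fun t => g (sw j (y, t)))) /\
    exists c, {ae leb, forall t, t \in `]- N%:R, N%:R[ ->
      f (sw j (y, t)) = c + \int[leb]_(r in `[- N%:R, t]) g (sw j (y, r))}}.
Proof.
move=> wfg; have [lf lg _] := wfg.
have P1 (N : nat) : {ae leb3, forall y : mR3 R, {ae leb, forall t, cube N.+1%:R (y, t) ->
    f (sw j (y, t)) = smear (cut N.+1%:R (fun y => f (sw j y))) (ker1 N.+1%:R) (y, t) +
                 smear (cut N.+1%:R (fun y => g (sw j y))) (ker2 N.+1%:R) (y, t)}}.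
  by have := @ae_section _ _ _ _ _ leb3 leb _ (@weak_smear j f g N.+1%:R (ltr0Sn _ _) wfg).
have P2 (N : nat) : {ae leb3, forall y : mR3 R, leb.-integrable setT
    (fun t => (cut N.+1%:R (fun z => g (sw j z)) (y, t))%:E)}.
  have := @ae_integrable1 _ _ _ _ _ leb3 leb _ (integrable_cut_sw N.+1%:R j lg).
  by apply: ae_mono => y; exact.
have {P1} := ae_foralln P1; have {P2} := ae_foralln P2.
apply: ae_mono2 => y P2 P1.
have [N0 hN0] : exists N0 : nat, forall k, `|co (y, 0) k| < N0%:R.
  (* A cube whose base contains y. *)
  exists (\sum_(k < 4) (Num.truncn `|co (y, 0%R : R) k|%R).+1)%N => k.
  apply: lt_le_trans (truncnS_gt _) _.
  by rewrite ler_nat (bigD1 k)//= leq_addr.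
exists N0.+1 => -[//|N] NN0; have NN : 0 < N.+1%:R :> R by rewrite ltr0n.
have cubeE (M : R) t : N0%:R <= M -> cube M (y, t) <-> t \in `]- M, M[.
  move=> N0M; rewrite in_itv/=; split=> [/(_ i3)|tM k]; first by rewrite co_i3.
  have [->|ki] := eqVneq k i3; first by rewrite co_i3.
  have := co_pair (y, 0 : R) t k; rewrite (negPf ki) /= => ->.
  by rewrite -ltr_norml (lt_le_trans (hN0 k)).
have N0N : N0%:R <= N.+1%:R :> R by rewrite ler_nat ltnW.
have N0N2 : N0%:R <= N.+2%:R :> R by rewrite ler_nat; apply: leq_trans (ltnW NN0) _.
have ig : leb.-integrable `[- N.+1%:R, N.+1%:R] (EFin \o (fun t => g (sw j (y, t)))).
  have i := P2 N.+1.
  have i' : leb.-integrable `[- N.+1%:R, N.+1%:R]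
      (fun t => (cut N.+2%:R (fun z => g (sw j z)) (y, t))%:E).
    by apply: (@integrableS _ (measurableTypeR R) R leb _ _ _ measurableT _ _ i).
  apply: eq_integrable i'; first exact: measurable_itv.
  move=> t /set_mem /=; rewrite in_itv/= => /andP[Nt tN].
  congr EFin; apply: cut_in; apply/cubeE => //; rewrite in_itv/=.
  by rewrite (lt_le_trans _ Nt) ?ltrN2 ?ltr_nat// (le_lt_trans tN)// ltr_nat.
split=> //.
set u := cut N.+1%:R (fun y => f (sw j y)) in P1 *.
set v := cut N.+1%:R (fun y => g (sw j y)) in P1 *.
exists (\int[leb]_s (ker1 N.+1%:R (s, 0) * cut N.+1%:R (fun y => f (sw j y)) (y, s)) +
  (\int[leb]_s (ker2 N.+1%:R (s, 0) * cut N.+1%:R (fun z => g (sw j z)) (y, s)) +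
   \int[leb]_s (cut N.+1%:R (fun z => g (sw j z)) (y, s) * (0 <= s)%R%:R) -
   \int[leb]_s cut N.+1%:R (fun z => g (sw j z)) (y, s))).
apply: ae_mono (P1 N) => t H tN; rewrite H; last exact/cubeE.
rewrite -addrA; congr (_ + _).
apply: (line_formula NN (P2 N) ig) => // s.
  by move=> sN; apply: cut_in; apply/cubeE.
by move=> sN; apply: cut_supp => /(cubeE _ _ N0N); rewrite (negPf sN).
Qed.

(** [line_le] on almost every line, with Phi a truncated power; measurability
    of the two sides turns this into a statement almost everywhere in the
    space. *)
Lemma line_inequality j (f g : R4 R -> R) (p M c : R) :
  measurable_fun [set: mR4 R] f -> measurable_fun [set: mR4 R] g ->
  0 < p -> (\int[leb4]_x (`|f x| `^ p)%:E < +oo)%E -> 2 < c -> 0 < M ->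
  {ae leb3, forall y : mR3 R, exists N0 : nat, forall N : nat, (N0 <= N)%N ->
    leb.-integrable `[- N%:R, N%:R] (EFin \o (fun t => g (sw j (y, t)))) /\
    exists c, {ae leb, forall t, t \in `]- N%:R, N%:R[ ->
      f (sw j (y, t)) = c + \int[leb]_(r in `[- N%:R, t]) g (sw j (y, r))}} ->
  {ae leb4, forall x : mR4 R, ((powt M c (f x))%:E <=
    lint j (fun y => (dpowt M c (f y) * `|g y|)%:E) x)%E}.
Proof.
move=> mf mg p0 fp c2 M0 hl.
have M0' := ltW M0.
pose F (x : mR4 R) := f (sw j x); pose G (x : mR4 R) := g (sw j x).
have mF : measurable_fun setT F := measurableT_comp mf (measurable_sw j).
have mG : measurable_fun setT G := measurableT_comp mg (measurable_sw j).
pose P (x : mR4 R) := ((powt M c (F x))%:E <=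
    \int[leb]_t (dpowt M c (F (x.1, t)) * `|G (x.1, t)|)%:E)%E.
suff : {ae leb4, forall x : mR4 R, P x}.
  move=> /(ae_sw j); apply: ae_mono => x; rewrite /P /F /G swK /lint.
  by under eq_integral do rewrite sw_upd swK.
have c1 : 1 < c by apply: lt_trans c2; rewrite ltr1n.
have mH : measurable_fun setT (fun x : mR3 R * measurableTypeR R => (dpowt M c (F x) * `|G x|)%:E).
  apply/measurable_EFinP; apply: measurable_funM.
    apply: measurableT_comp mF; exact: continuous_measurable_fun (continuous_dpowt c2 M0').
  exact: measurableT_comp.
have d0 s : 0 <= dpowt M c s by rewrite mulr_ge0 ?powR_ge0// ltW// (lt_trans _ c1).
have H0 (x : mR3 R * measurableTypeR R) : (0 <= (dpowt M c (F x) * `|G x|)%:E)%E.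
  by rewrite lee_fin mulr_ge0.
apply: (@section_ae _ _ _ _ _ leb3 leb P).
  rewrite (_ : [set x | ~ P x] = setT `&` [set x | (\int[leb]_t (dpowt M c (F (x.1, t)) * `|G (x.1, t)|)%:E < (powt M c (F x))%:E)%E]).
    apply: measurable_lte => //.
      apply: (@measurableT_comp _ _ _ (mR4 R) (mR3 R) (\bar R) (fun y : mR3 R => \int[leb]_t (dpowt M c (F (y, t)) * `|G (y, t)|)%:E)%E); last exact: measurable_fst.
      exact: (@measurable_fun_fubini_tonelli_F _ _ _ _ _ leb _ mH H0).
    apply/measurable_EFinP; apply: measurableT_comp mF.
    exact: continuous_measurable_fun (continuous_powt c1 M0').
  apply/seteqP; split=> x; rewrite /P /=.
    by move=> h; split=> //; rewrite ltNge; apply/negP.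
  by move=> [_]; rewrite ltNge => /negP.
have fpF : {ae leb3, forall y : mR3 R, (\int[leb]_t (`|F (y, t)| `^ p)%:E < +oo)%E}.
  have iF : leb4.-integrable setT (fun x => (`|F x| `^ p)%:E).
    have : leb4.-integrable [set: mR4 R] (fun x => (`|f x| `^ p)%:E).
      apply/integrableP; split.
        by apply/measurable_EFinP; apply: measurableT_comp (measurable_powR p) _; exact: measurableT_comp.
      by under eq_integral do rewrite abse_EFin ger0_norm ?powR_ge0//.
    exact: integrable_sw.
  have := @ae_integrable1 _ _ _ _ _ leb3 leb _ iF.
  apply: ae_mono => y /integrableP[_].
  by under eq_integral do rewrite abse_EFin ger0_norm ?powR_ge0//.
apply: ae_mono2 fpF hl => y fy [N0 hy].
apply: (@line_le R (powt M c) (dpowt M c) d0 (continuous_dpowt c2 M0') _ (fun t => F (y, t)) (fun t => G (y, t)) p N0) => //.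
- by move=> a b; exact: powt_two_point.
- by apply: measurableT_comp mF _; exact: measurable_fun_pair.
- by apply: measurableT_comp mG _; exact: measurable_fun_pair.
- by move=> s; exact: powR_ge0.
- by move=> e e0; apply: powt_ge => //; exact: lt_trans c1.
Qed.

End WeakLineInequality.

(** * The Sobolev inequality for weakly differentiable functions *)

Section Sobolev.
Context {R : realType}.
Local Notation leb := (@lebesgue_measure R).
Implicit Types (f : R4 R -> R) (p q : R).

(** L^q bounds are expressed through the q-th power of the norm, an integral,
    to which linearity and monotonicity apply. *)
Definition pint q f : \bar R := (\int[leb4]_x (`|f x| `^ q)%:E)%E.

Lemma measurable_pint q f : measurable_fun [set: mR4 R] f ->
  measurable_fun [set: mR4 R] (fun x => (`|f x| `^ q)%:E).
Proof.
move=> mf; apply/measurable_EFinP.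
by apply: measurableT_comp (measurable_powR q) _; exact: measurableT_comp.
Qed.

Lemma pint_ge0 q f : (0 <= pint q f)%E.
Proof. by apply: integral_ge0 => x _; rewrite lee_fin powR_ge0. Qed.

Lemma test_line_formula j phi : test_function phi ->
  forall y : mR3 R, exists N0 : nat, forall N : nat, (N0 <= N)%N ->
    leb.-integrable `[- N%:R, N%:R] (EFin \o (fun t => partial j phi (sw j (y, t)))) /\
    exists c, {ae leb, forall t, t \in `]- N%:R, N%:R[ ->
      phi (sw j (y, t)) = c + \int[leb]_(r in `[- N%:R, t]) partial j phi (sw j (y, r))}.
Proof.
move=> tp y; have [N1 N10 sN] := test_supp tp.
exists (Num.truncn N1).+1 => N NN.
have N1N : N1 <= N%:R by apply: ltW (lt_le_trans (truncnS_gt _) _); rewrite ler_nat.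
have N0 : 0 < N%:R :> R by exact: lt_le_trans N1N.
pose z := sw j (y, 0 : R).
have E t : sw j (y, t) = upd z j t by rewrite -sw_upd.
have cd : continuous (fun t => partial j phi (sw j (y, t))).
  move=> t; under eq_fun do rewrite E.
  by apply: continuous_comp; [exact: continuous_upd|exact: test_cont (test_partial j tp) _].
have ic (a b : R) : leb.-integrable `[a, b] (EFin \o (fun t => partial j phi (sw j (y, t)))).
  apply: continuous_compact_integrable; first exact: segment_compact.
  exact: continuous_subspaceT.
split=> //; exists 0; apply: aeW => t; rewrite in_itv/= => /andP[Nt tN]; rewrite add0r.
have df s : is_derive s (1:R) (fun s => phi (sw j (y, s))) (partial j phi (sw j (y, s))).
  rewrite E; under eq_fun do rewrite E.
  by apply: is_derive_line; apply: smooth_derivable; case: tp.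
have cp : continuous (fun s => phi (sw j (y, s))).
  move=> s; apply: differentiable_continuous; apply/derivable1_diffP.
  by case: (df s).
rewrite /Rintegral (@continuous_FTC2 _ _ (fun s => phi (sw j (y, s))))//.
- rewrite /= (sN (sw j (y, - N%:R))) ?subr0//.
  by apply/cubeN; exists j; rewrite E co_upd eqxx normrN gtr0_norm.
- exact: continuous_subspaceT.
- split; first by move=> s _; case: (df s).
    by apply: cvg_at_right_filter; exact: cp.
  by apply: cvg_at_left_filter; exact: cp.
- by move=> s _; rewrite derive1E; case: (df s).
Qed.

Lemma pint_test q phi : 0 < q -> test_function phi -> (pint q phi < +oo)%E.
Proof.
move=> q0 tp; have [N N0 sN] := test_supp tp.
have [M M0 hM] := supp_bounded (test_cont tp) sN.
have s0 : supp_in N (fun x => `|phi x| `^ q).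
  by move=> x /sN ->; rewrite normr0 powR0// gt_eqF.
rewrite /pint -(integral_supp s0).
apply: (@le_lt_trans _ _ (\int[leb4]_(x in cube N) (M `^ q)%:E)%E).
  apply: ge0_le_integral => //.
  - exact: measurable_cube.
  - by apply: (@measurable_funS _ _ (mR4 R) _ setT) => //; exact: measurable_pint (test_meas tp).
  by move=> x _; rewrite lee_fin ge0_ler_powR ?nnegrE ?(ltW q0) ?(ltW M0).
rewrite integral_cst; last exact: measurable_cube.
by rewrite lte_mul_pinfty// ?lee_fin ?powR_ge0//; exact: leb4_oobox_lty.
Qed.

Lemma sob_exp_gt2 p : 2 <= p < 4 -> 2 < sob_exp p.
Proof.
move=> /andP[p2 p4]; rewrite /sob_exp ltr_pdivlMr ?subr_gt0//; lra.
Qed.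

Lemma sobolev_lines f (g : 'I_4 -> R4 R -> R) p (G : R) : 2 <= p < 4 ->
  measurable_fun [set: mR4 R] f -> (forall j, measurable_fun [set: mR4 R] (g j)) ->
  (pint p f < +oo)%E -> 0 <= G -> (forall j, (pint p (g j) <= (G `^ p)%:E)%E) ->
  (forall j, {ae leb3, forall y : mR3 R, exists N0 : nat, forall N : nat, (N0 <= N)%N ->
    leb.-integrable `[- N%:R, N%:R] (EFin \o (fun t => g j (sw j (y, t)))) /\
    exists c, {ae leb, forall t, t \in `]- N%:R, N%:R[ ->
      f (sw j (y, t)) = c + \int[leb]_(r in `[- N%:R, t]) g j (sw j (y, r))}}) ->
  (pint (sob_conj p) f <= ((sob_exp p * G) `^ sob_conj p)%:E)%E.
Proof.
move=> hp mf mg fp G0 gp hl; have /andP[p2 p4] := hp.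
apply: (@sobolev R f g p G) => //; first by rewrite p4 andbT (lt_le_trans _ p2)// ltr1n.
move=> j M M0; apply: (@line_inequality _ j f (g j) p) (hl j) => //.
  by rewrite (lt_le_trans _ p2).
exact: sob_exp_gt2.
Qed.

Lemma sobolev_weak f (g : 'I_4 -> R4 R -> R) p (G : R) : 2 <= p < 4 ->
  (forall j, is_wpartial j f (g j)) ->
  (pint p f < +oo)%E -> 0 <= G -> (forall j, (pint p (g j) <= (G `^ p)%:E)%E) ->
  (pint (sob_conj p) f <= ((sob_exp p * G) `^ sob_conj p)%:E)%E.
Proof.
move=> hp wfg fp G0 gp; apply: (sobolev_lines hp _ _ fp G0 gp).
- by have [[]] := wfg ord0.
- by move=> j; have [_ []] := wfg j.
- by move=> j; exact: weak_line_formula.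
Qed.

Lemma sobolev_test phi p (G : R) : 2 <= p < 4 -> test_function phi ->
  0 <= G -> (forall j, (pint p (partial j phi) <= (G `^ p)%:E)%E) ->
  (pint (sob_conj p) phi <= ((sob_exp p * G) `^ sob_conj p)%:E)%E.
Proof.
move=> hp tp G0 gp; apply: (sobolev_lines hp _ _ _ G0 gp).
- exact: test_meas.
- by move=> j; exact: test_meas (test_partial j tp).
- by apply: pint_test => //; case/andP: hp => p2 _; rewrite (lt_le_trans _ p2).
- by move=> j; apply: aeW => y; exact: test_line_formula.
Qed.

Lemma LnormE q f : Lnorm leb4 q%:E (EFin \o f) = poweR (pint q f) q^-1.
Proof. by rewrite unlock. Qed.

Lemma Lnorm_le q f (e : R) : 0 < q -> 0 <= e ->
  (Lnorm leb4 q%:E (EFin \o f) <= e%:E)%E <-> (pint q f <= (e `^ q)%:E)%E.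
Proof.
move=> q0 e0; rewrite LnormE; have := pint_ge0 q f.
move: (pint q f) => I I0; split=> h.
  have := le_poweR (ltW q0) (poweR_ge0 _ _) h.
  by rewrite -poweRrM mulVf ?gt_eqF// poweRe1.
have qV : 0 <= q^-1 by rewrite invr_ge0 ltW.
have := le_poweR qV I0 h.
by rewrite poweR_EFin -powRrM mulfV ?gt_eqF// powRr1.
Qed.

Lemma Lfun_pint q f : 0 < q -> f \in Lfun leb4 q%:E ->
  measurable_fun [set: mR4 R] f /\ (pint q f < +oo)%E.
Proof.
move=> q0 /andP[/set_mem mf /set_mem fin]; split=> //.
move: fin; rewrite /= /finite_norm LnormE; have := pint_ge0 q f.
case: (pint q f) => //= [r|]; first by move=> *; rewrite ltry.
by rewrite gt_eqF// invr_gt0.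
Qed.

End Sobolev.

(** * Limits of test functions in L4 *)

Section CriticalConvergence.
Context {R : realType}.
Implicit Types (f g u : R4 R -> R) (q e : R).

(** |x + y| is at most twice the larger of |x| and |y|. *)
Lemma powR_add_le q (x y : R) : 0 <= q ->
  `|x + y| `^ q <= 2 `^ q * (`|x| `^ q + `|y| `^ q).
Proof.
move=> q0; have pow_le (a b : R) : 0 <= a -> a <= b -> a `^ q <= b `^ q.
  by move=> a0 ab; rewrite ge0_ler_powR ?nnegrE ?(le_trans a0 ab).
have h (a b : R) : `|a| <= `|b| -> `|a + b| `^ q <= 2 `^ q * (`|a| `^ q + `|b| `^ q).
  move=> ab; apply: (@le_trans _ _ ((2 * `|b|) `^ q)).
    by apply: pow_le => //; apply: le_trans (ler_normD _ _) _; rewrite mulr_natl mulr2n lerD2r.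
  by rewrite powRM// ler_wpM2l ?powR_ge0// lerDr powR_ge0.
have [/h//|/ltW yx] := leP `|x| `|y|.
by rewrite addrC [X in _ * X]addrC; exact: h.
Qed.

Lemma pint_add q f g : 0 <= q -> measurable_fun [set: mR4 R] f ->
  measurable_fun [set: mR4 R] g ->
  (pint q (fun x => (f x + g x)%R) <= (2 `^ q)%:E * (pint q f + pint q g))%E.
Proof.
move=> q0 mf mg.
have p0 (h : R4 R -> R) x : (0 <= (`|h x| `^ q)%:E)%E by rewrite lee_fin powR_ge0.
have mpf := measurable_pint q mf; have mpg := measurable_pint q mg.
have mpD := measurable_pint q (measurable_funD mf mg).
have mD := emeasurable_funD mpf mpg.
apply: (@le_trans _ _ (\int[leb4]_x ((2 `^ q)%:E * ((`|f x| `^ q)%:E + (`|g x| `^ q)%:E)))%E).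
  apply: ge0_le_integral => //; first exact: emeasurable_funM.
  by move=> x _; rewrite -EFinD -EFinM lee_fin powR_add_le.
rewrite ge0_integralZl//; last by move=> x _; rewrite adde_ge0.
by rewrite (ge0_integralD leb4 measurableT (fun x _ => p0 f x) mpf (fun x _ => p0 g x) mpg).
Qed.

Lemma pintN q f : pint q (fun x => -1 * f x) = pint q f.
Proof. by apply: eq_integral => x _; rewrite mulN1r normrN. Qed.

Lemma measurable_ccube N : measurable (@ccube R N : set (mR4 R)).
Proof.
rewrite -[ccube N]setCK; apply: measurableC; apply: open_measurable4.
by apply: closed_openC; exact: closed_ccube.
Qed.

Lemma ecvg0_le (v : nat -> \bar R) e : v n @[n --> \oo] --> 0%E -> 0 < e ->
  exists n0, forall n, (n0 <= n)%N -> (v n <= e%:E)%E.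
Proof.
move=> v0 e0; have /v0 [n0 _ h] : nbhs 0%E [set x : \bar R | (x < e%:E)%E].
  by apply: open_nbhs_nbhs; split; [exact: open_ereal_lt_ereal|rewrite /= lte_fin].
by exists n0 => n nn; apply: ltW; exact: h.
Qed.

Lemma partialB j f g x : derivable f x (basis4 j) -> derivable g x (basis4 j) ->
  partial j (fun y => f y - g y) x = partial j f x - partial j g x.
Proof. by move=> df dg; exact: deriveB. Qed.

(** Passage to the limit m -> oo in phi n - phi m. Truncated powers are
    Lipschitz, so their integrals over a compact set follow convergence in L^1
    of that set; the truncation is then removed. *)
Lemma lim_pint (phi : nat -> R4 R -> R) u q e n : 1 < q ->
  measurable_fun [set: mR4 R] u -> (forall m, measurable_fun [set: mR4 R] (phi m)) ->
  (forall K : set (R4 R), compact K ->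
    (fun m => \int[leb4]_(x in K) `|phi m x - u x|%:E)%E @ \oo --> 0%E) ->
  (exists n0, forall m, (n0 <= m)%N -> (pint q (fun x => (phi n x - phi m x)%R) <= e%:E)%E) ->
  (pint q (fun x => (phi n x - u x)%R) <= e%:E)%E.
Proof.
move=> q1 mu mphi cK [n0 hn0]; have q0 : 0 < q by exact: lt_trans q1.
have mB : measurable_fun [set: mR4 R] (fun x => phi n x - u x) by exact: measurable_funB.
apply: (@integral_trunc_le _ (mR4 R) R leb4 _ q (fun k => ccube k%:R)) => //.
- by move=> k; exact: measurable_ccube.
- move=> a b ab x h k; have /andP[h1 h2] := h k.
  rewrite (le_trans _ h1) ?lerN2 ?ler_nat//= (le_trans h2)// ler_nat//.
- apply/seteqP; split=> // x _; have : (\bigcup_n cube n%:R) x by rewrite bigcup_oobox.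
  by move=> [k _ xk]; exists k => //; exact: cube_ccube.
move=> k; set K := ccube k%:R; set M : R := k%:R.
have mK : measurable (K : set (mR4 R)) by exact: measurable_ccube.
have M0 : 0 <= M by [].
set L := q * M `^ (q - 1).
have L0 : 0 <= L by rewrite mulr_ge0 ?powR_ge0// ltW.
have mt f : measurable_fun [set: mR4 R] f -> measurable_fun (K : set (mR4 R)) (fun x => (powt M q (f x))%:E).
  move=> mf; apply: (@measurable_funS _ _ (mR4 R) _ setT) => //.
  by apply/measurable_EFinP; exact: measurable_trunc_powR.
have mn f : measurable_fun [set: mR4 R] f -> measurable_fun (K : set (mR4 R)) (fun x => `|f x|%:E).
  move=> mf; apply: (@measurable_funS _ _ (mR4 R) _ setT) => //.
  by apply/measurable_EFinP; exact: measurableT_comp.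
have pt0 f x : (0 <= (powt M q (f x))%:E)%E by rewrite lee_fin powR_ge0.
apply/lee_addgt0Pr => d d0.
have dL : 0 < d / (L + 1) by rewrite divr_gt0// ltr_wpDl.
have [n1 hn1] := ecvg0_le (cK K (compact_ccube (N := k%:R))) dL.
pose m := maxn n0 n1.
have mBm := measurable_funB (mphi n) (mphi m).
have mBu := measurable_funB (mphi m) mu.
apply: (@le_trans _ _ (\int[leb4]_(x in K) ((powt M q (phi n x - phi m x))%:E + (L%:E * `|phi m x - u x|%:E)))%E).
  apply: ge0_le_integral => //.
  - by move=> x _; exact: (pt0 (fun x => phi n x - u x)).
  - exact: mt _ mB.
  - apply: emeasurable_funD; first exact: mt _ mBm.
    by apply: emeasurable_funM => //; exact: mn _ mBu.
  move=> x _; rewrite -EFinM -EFinD lee_fin -lerBlDl.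
  apply: le_trans (ler_norm _) _.
  apply: le_trans (powt_lip _ _ q1 M0) _; rewrite -/L ler_wpM2l//.
  by rewrite opprB addrC addrA subrK distrC.
have pm0 x : K x -> (0 <= (powt M q (phi n x - phi m x))%:E)%E by rewrite lee_fin powR_ge0.
have nm0 x : K x -> (0 <= L%:E * `|phi m x - u x|%:E)%E by rewrite -EFinM lee_fin mulr_ge0.
have mnL : measurable_fun (K : set (mR4 R)) (fun x => (L%:E * `|phi m x - u x|%:E)%E).
  by apply: emeasurable_funM => //; exact: mn _ mBu.
rewrite (ge0_integralD leb4 mK pm0 (mt _ mBm) nm0 mnL).
rewrite (ge0_integralZl _ mK (mn _ mBu))//.
apply: leeD.
  apply: le_trans (hn0 m (leq_maxl _ _)).
  apply: (@le_trans _ _ (\int[leb4]_(x in K) (`|phi n x - phi m x| `^ q)%:E)%E).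
    apply: ge0_le_integral => //; first exact: mt _ mBm.
      apply: (@measurable_funS _ _ (mR4 R) _ setT) => //; exact: measurable_pint.
    move=> x _; rewrite lee_fin ge0_ler_powR ?nnegrE ?trunc_ge0 ?trunc_norm ?(ltW q0)//.
  apply: ge0_subset_integral => //; exact: measurable_pint.
apply: (@le_trans _ _ (L%:E * (d / (L + 1))%:E)%E).
  by apply: lee_wpmul2l; [rewrite lee_fin|exact: hn1 m (leq_maxr _ _)].
rewrite -EFinM lee_fin mulrCA ler_piMr ?(ltW d0)// ler_pdivrMr ?ltr_wpDl// mul1r lerDl//.
Qed.

(** By the Sobolev inequality with p = 2, whose critical exponent is 4,
    convergence of the gradients in L^2 makes the approximating test functions
    a Cauchy sequence in L^4. Convergence in L^1_loc identifies the limit. *)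
Lemma dotH1_L4 u : dotH1_scalar u -> exists phi : nat -> R4 R -> R,
  [/\ forall n, test_function (phi n),
      (forall j e, 0 < e -> exists n0, forall n, (n0 <= n)%N ->
         (pint 2 (fun x => (partial j (phi n) x - wpartial j u x)%R) <= (e `^ 2)%:E)%E),
      (forall e, 0 < e -> exists n0, forall n, (n0 <= n)%N ->
         (pint 4 (fun x => (phi n x - u x)%R) <= (e `^ 4)%:E)%E) &
      (pint 4 u < +oo)%E].
Proof.
move=> [[mu _] wu [phi [tphi dphi cphi]]]; exists phi.
have mphi n := test_meas (tphi n).
have mdphi n j := test_meas (test_partial j (tphi n)).
have mw j : measurable_fun [set: mR4 R] (wpartial j u).
  by have [_ /(Lfun_pint (ltr0n _ 2))[]] := wu j.
have d2 j e : 0 < e -> exists n0, forall n, (n0 <= n)%N ->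
    (pint 2 (fun x => (partial j (phi n) x - wpartial j u x)%R) <= (e `^ 2)%:E)%E.
  move=> e0; have [n0 hn0] := ecvg0_le (dphi j) e0.
  by exists n0 => n nn; apply/(Lnorm_le _ (ltr0n _ 2) (ltW e0)); exact: hn0.
have d4 e : 0 < e -> exists n0, forall n, (n0 <= n)%N ->
    (pint 4 (fun x => (phi n x - u x)%R) <= (e `^ 4)%:E)%E.
  (* 12 is 3 * 4: the Sobolev constant for p = 2 is 3, and the triangle
     inequality in the form of [pint_add] loses the factor sqrt 8 < 4. *)
  move=> e0; have de : 0 < e / 12 by rewrite divr_gt0.
  have /choice[n0 hn0] := fun j => d2 j _ de.
  pose n1 := (\max_j n0 j)%N; exists n1 => n nn.
  apply: (lim_pint _ mu mphi cphi) => //; first by rewrite ltr1n.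
  exists n1 => m nm.
  have e3 : 0 <= e / 3 by rewrite divr_ge0// ltW.
  have h24 : 2 <= (2:R) < 4 by rewrite lexx/= ltr_nat.
  have c4 : sob_conj 2 = 4 :> R by rewrite /sob_conj; field.
  have c3 : sob_exp 2 * (e / 3) = e :> R by rewrite /sob_exp; field.
  rewrite -[in X in (_ <= (X `^ _)%:E)%E]c3 -c4.
  apply: sobolev_test => //; first exact: testB.
  move=> j; have jn : (n0 j <= n1)%N by exact: leq_bigmax.
  have dn := hn0 j n (leq_trans jn nn); have dm := hn0 j m (leq_trans jn nm).
  have -> : partial j (fun x => phi n x - phi m x) = (fun x =>
      (partial j (phi n) x - wpartial j u x) + (-1) * (partial j (phi m) x - wpartial j u x)).
    apply/funext => x; rewrite partialB; first by ring.
      by apply: smooth_derivable; case: (tphi n).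
    by apply: smooth_derivable; case: (tphi m).
  have mBn (k : nat) := measurable_funB (mdphi k j) (mw j).
  apply: le_trans (pint_add _ (mBn n) _) _ => //.
    by apply: measurable_funM => //; exact: mBn.
  rewrite pintN.
  apply: le_trans (lee_wpmul2l _ (leeD dn dm)) _; first by rewrite lee_fin powR_ge0.
  rewrite -EFinD -EFinM lee_fin !powR_mulrn ?(ltW de)//.
  by move: (sqr_ge0 e); rewrite !expr2; lra.
split=> //; have [n0 hn0] := d4 1 ltr01.
have -> : u = (fun x => phi n0 x + -1 * (phi n0 x - u x)) by apply/funext => x; ring.
have mB := measurable_funB (mphi n0) mu.
apply: le_lt_trans (pint_add _ (mphi n0) (measurable_funM (measurable_cst _) mB)) _ => //.
rewrite lte_mul_pinfty ?lee_fin ?powR_ge0// lte_add_pinfty//; first exact: pint_test.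
rewrite pintN.
by apply: le_lt_trans (hn0 n0 (leqnn _)) _; rewrite ltry.
Qed.

End CriticalConvergence.

(** * The divergence of the tensor product *)

Section Duality.
Context {R : realType}.
Implicit Types (f g h u : R4 R -> R) (p q : R).

Lemma hoelder_pint q u h : 1 < q -> measurable_fun [set: mR4 R] u ->
  measurable_fun [set: mR4 R] h ->
  (\int[leb4]_x `|u x * h x|%:E <=
     poweR (pint q u) q^-1 * poweR (pint (q / (q - 1)) h) ((q - 1) / q))%E.
Proof.
move=> q1 mu mh; have q0 : 0 < q by exact: lt_trans q1.
have qn : q != 0 by rewrite gt_eqF.
have qm : q - 1 != 0 by rewrite gt_eqF// subr_gt0.
have a0 : 0 < q^-1 by rewrite invr_gt0.
have b0 : 0 < (q - 1) / q by rewrite divr_gt0// subr_gt0.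
have p0 r f x : (0 <= (`|f x| `^ r)%:E)%E by rewrite lee_fin powR_ge0.
have := @hoelder_ge0 _ (mR4 R) R leb4 _ _ _ _ (measurable_pint q mu) (measurable_pint (q / (q - 1)) mh)
  (fun x => p0 _ _ x) (fun x => p0 _ _ x) a0 b0 _.
have -> : q^-1 + (q - 1) / q = 1 by field.
move=> /(_ erefl); apply: le_trans; rewrite le_eqVlt; apply/orP; left; apply/eqP.
apply: eq_integral => x _; rewrite !poweR_EFin -EFinM -!powRrM mulfV// powRr1//.
by rewrite mulrA divfK// mulfV// powRr1// normrM.
Qed.

Lemma integrable_hoelder q u h : 1 < q -> measurable_fun [set: mR4 R] u ->
  measurable_fun [set: mR4 R] h -> (pint q u < +oo)%E ->
  (pint (q / (q - 1)) h < +oo)%E ->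
  leb4.-integrable [set: mR4 R] (fun x => (u x * h x)%:E).
Proof.
move=> q1 mu mh uoo hoo; apply/integrableP; split.
  by apply/measurable_EFinP; exact: measurable_funM.
apply: le_lt_trans (hoelder_pint q1 mu mh) _.
have := poweR_lty q^-1 uoo; have := poweR_lty ((q - 1) / q) hoo.
have := poweR_ge0 (pint q u) q^-1; have := poweR_ge0 (pint (q / (q - 1)) h) ((q - 1) / q).
move: (poweR _ _) (poweR _ _) => a b a0 b0 boo aoo.
by rewrite lte_mul_pinfty// ge0_fin_numE.
Qed.

Lemma cvg_hoelder q (a : nat -> R4 R -> R) u h : 1 < q ->
  (forall n, measurable_fun [set: mR4 R] (a n)) -> measurable_fun [set: mR4 R] u ->
  measurable_fun [set: mR4 R] h -> (forall n, (pint q (a n) < +oo)%E) ->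
  (pint q u < +oo)%E -> (pint (q / (q - 1)) h < +oo)%E ->
  (forall e, 0 < e -> exists n0, forall n, (n0 <= n)%N ->
     (pint q (fun x => (a n x - u x)%R) <= (e `^ q)%:E)%E) ->
  \int[leb4]_x (a n x * h x) @[n --> \oo] --> \int[leb4]_x (u x * h x).
Proof.
move=> q1 ma mu mh aoo uoo hoo cv; have q0 : 0 < q by exact: lt_trans q1.
set H := fine (poweR (pint (q / (q - 1)) h) ((q - 1) / q)).
have HE : poweR (pint (q / (q - 1)) h) ((q - 1) / q) = H%:E.
  by rewrite /H fineK// ge0_fin_numE ?poweR_ge0// poweR_lty.
have H0 : 0 <= H by rewrite /H fine_ge0// poweR_ge0.
apply/cvgrPdist_le => e e0; have e1 : 0 < e / (H + 1) by rewrite divr_gt0// ltr_wpDl.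
have [n0 hn0] := cv _ e1; exists n0 => // n nn.
have iu := integrable_hoelder q1 mu mh uoo hoo.
have ia := integrable_hoelder q1 (ma n) mh (aoo n) hoo.
rewrite distrC -RintegralB//.
have iB : leb4.-integrable [set: mR4 R] (EFin \o (fun x => a n x * h x - u x * h x)).
  by have := integrableB measurableT ia iu; congr integrable.
apply: le_trans (le_normr_Rintegral measurableT iB) _.
rewrite -lee_fin fineK; last exact: integrable_fin_num (integrable_norm iB).
have mB := measurable_funB (ma n) mu.
have -> : (\int[leb4]_x `|a n x * h x - u x * h x|%:E = \int[leb4]_x `|(a n x - u x) * h x|%:E)%E.
  by apply: eq_integral => x _; rewrite mulrBl.
apply: le_trans (hoelder_pint q1 mB mh) _; rewrite HE.
have eV : (poweR (pint q (fun x => (a n x - u x)%R)) q^-1 <= (e / (H + 1))%:E)%E.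
  by rewrite -LnormE; apply/Lnorm_le => //; [exact: ltW|exact: hn0].
apply: le_trans (lee_wpmul2r _ eV) _; first by rewrite lee_fin.
by rewrite -EFinM lee_fin mulrAC ler_pdivrMr ?ltr_wpDl// ler_wpM2l ?(ltW e0)// lerDl.
Qed.

(** Compare with the indicator of the cube where |f| <= 1 and with |f| ^ p
    elsewhere. *)
Lemma pint_lower r p f N : 0 < r -> r <= p -> measurable_fun [set: mR4 R] f ->
  supp_in N f -> (pint p f < +oo)%E -> (pint r f < +oo)%E.
Proof.
move=> r0 rp mf sN pf.
have m1 : measurable_fun [set: mR4 R] (fun x => (\1_(cube N) x : R)%:E).
  by apply/measurable_EFinP; apply: measurable_indic; exact: measurable_cube.
have p0 s x : (0 <= (`|f x| `^ s)%:E)%E by rewrite lee_fin powR_ge0.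
have i0 (x : mR4 R) : [set: mR4 R] x -> (0 <= (\1_(cube N) x : R)%:E)%E by rewrite lee_fin.
apply: (@le_lt_trans _ _ (\int[leb4]_x ((\1_(cube N) x : R)%:E + (`|f x| `^ p)%:E)))%E.
  apply: ge0_le_integral => //; first exact: measurable_pint.
    by apply: emeasurable_funD => //; exact: measurable_pint.
  move=> x _; rewrite -EFinD lee_fin indicE.
  have [xN|/sN ->] := pselect (cube N x); last by rewrite normr0 powR0 ?gt_eqF// addr_ge0 ?powR_ge0.
  rewrite mem_set//; have [x1|/ltW x1] := leP `|f x| 1.
    rewrite -[leLHS]addr0 lerD ?powR_ge0//.
    have := @ge0_ler_powR R r (ltW r0) `|f x| 1; rewrite !nnegrE powR1.
    by apply.
  by rewrite -[leLHS]add0r lerD// ler_powR.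
rewrite (ge0_integralD leb4 measurableT i0 m1 (fun x _ => p0 p x) (measurable_pint p mf)).
rewrite lte_add_pinfty// (integral_indic _ measurableT (measurable_cube N)) setIT.
exact: leb4_oobox_lty.
Qed.

Lemma pint_bounded p f (v : R4 R -> R) (M : R) : 0 < p -> measurable_fun [set: mR4 R] f ->
  measurable_fun [set: mR4 R] v -> (forall x, `|v x| <= M) ->
  (pint p f < +oo)%E -> (pint p (fun x => (f x * v x)%R) < +oo)%E.
Proof.
move=> p0 mf mv vM pf; have M0 : 0 <= M by exact: le_trans (vM 0).
apply: (@le_lt_trans _ _ ((M `^ p)%:E * pint p f)%E).
  have f0 x : [set: mR4 R] x -> (0 <= (`|f x| `^ p)%:E)%E by rewrite lee_fin powR_ge0.
  have Mp : (0 <= (M `^ p)%:E)%E by rewrite lee_fin powR_ge0.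
  rewrite /pint -(ge0_integralZl leb4 measurableT (measurable_pint p mf) f0 Mp).
  apply: ge0_le_integral => //.
  - apply: (@measurable_pint _ p (fun x => f x * v x)); exact: measurable_funM.
  - by apply: emeasurable_funM => //; exact: measurable_pint.
  move=> x _; rewrite -EFinM lee_fin normrM powRM// mulrC ler_wpM2r ?powR_ge0//.
  by rewrite ge0_ler_powR ?nnegrE ?(ltW p0).
by rewrite lte_mul_pinfty// lee_fin powR_ge0.
Qed.

Lemma test_ae0 h : loc_integrable h ->
  (forall phi, test_function phi -> \int[leb4]_x (h x * phi x) = 0) ->
  {ae leb4, forall x : mR4 R, h x = 0}.
Proof.
move=> lh h0.
have H (k : nat) : {ae leb4, forall x : mR4 R, cube k%:R x -> h x = 0}.
  apply: (dubois_reymond (loc_integrable_cube _ lh)) => a b n ab.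
  have zb i s : k%:R <= `|s| -> bump (a i) (b i) n s = 0 :> R.
    by have [] := ab i; exact: bump_supp.
  have tb : test_function (bump4 a b n).
    by apply: (test_prodf (N := k%:R)) => [i|i s]; [exact: smooth1_bump|exact: zb].
  have sb : supp_in k%:R (bump4 a b n).
    by move=> x /cubeN[i Ni]; rewrite /bump4 (prodf_split _ i) [X in _ * X](zb i _ Ni) mulr0.
  rewrite (@integral_supp _ k%:R (fun x => h x * bump4 a b n x)); last first.
    by move=> x /sb ->; rewrite mulr0.
  rewrite -(fineK (integrable_fin_num measurableT (loc_integrable_mul lh (test_cont tb) sb))).
  by congr EFin; exact: h0.
have := ae_foralln H; apply: ae_mono => x xk.
have : (\bigcup_n cube n%:R) x by rewrite bigcup_oobox.
by move=> [k _]; exact: xk.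
Qed.

End Duality.

Section TensorDivergence.
Context {R : realType}.
Implicit Types (f g h u : R4 R -> R) (p q : R).

Lemma wpartialP j f : has_wpartial j f -> is_wpartial j f (wpartial j f).
Proof. by move=> h; exact: (xgetPex (cst 0) h). Qed.

Lemma Rintegral_sum4 (F : 'I_4 -> mR4 R -> R) :
  (forall j, leb4.-integrable [set: mR4 R] (EFin \o F j)) ->
  \int[leb4]_x (\sum_j F j x) = \sum_j \int[leb4]_x F j x.
Proof.
move=> iF; have fn j := integrable_fin_num measurableT (iF j).
rewrite /Rintegral sum_fine; last by move=> j _; exact: fn.
rewrite -(integral_sum measurableT iF).
by congr fine; apply: eq_integral => x _; rewrite sumEFin.
Qed.

Lemma measurable_cut N f : measurable_fun [set: mR4 R] f -> measurable_fun [set: mR4 R] (cut N f).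
Proof.
move=> mf; apply: measurable_funM => //.
by apply: measurable_indic; exact: measurable_cube.
Qed.

Lemma loc_integrable_mul4 u f p : 2 <= p -> measurable_fun [set: mR4 R] u ->
  (pint 4 u < +oo)%E -> measurable_fun [set: mR4 R] f -> (pint p f < +oo)%E ->
  loc_integrable (fun x => u x * f x).
Proof.
move=> p2 mu u4 mf pf; have p0 : 0 < p by rewrite (lt_le_trans _ p2).
apply: cube_loc_integrable; first exact: measurable_funM.
move=> N; have mc : measurable_fun [set: mR4 R] (\1_(cube N) : mR4 R -> R).
  by apply: measurable_indic; exact: measurable_cube.
have pc : (pint p (cut N f) < +oo)%E.
  apply: (pint_bounded (M := 1) p0 mf mc) => // x.
  by rewrite indicE; case: (_ \in _); rewrite ?normr1 ?normr0.
have pc' : (pint (4 / (4 - 1)) (cut N f) < +oo)%E.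
  apply: (pint_lower _ _ (measurable_cut N mf) (@cut_supp _ N f) pc).
    by rewrite divr_gt0// subr_gt0 ltr1n.
  by apply: le_trans p2; rewrite ler_pdivrMr ?subr_gt0 ?ltr1n//; lra.
have i := integrable_hoelder (ltr1n _ 4) mu (measurable_cut N mf) u4 pc'.
have i' : leb4.-integrable (cube N) (fun x => (u x * cut N f x)%:E).
  by apply: (@integrableS _ (mR4 R) R leb4 _ _ _ measurableT _ _ i) => //; exact: measurable_cube.
apply: eq_integrable i'; first exact: measurable_cube.
by move=> x /set_mem xN; rewrite cut_in.
Qed.

Variables (p : R) (f : R4 R -> R) (d : 'I_4 -> R4 R -> R).
Hypotheses (p2 : 2 <= p).
Hypothesis wd : forall j, is_wpartial j f (d j).
Hypothesis pf : (pint p f < +oo)%E.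
Hypothesis pd : forall j, (pint p (d j) < +oo)%E.

Let p0 : 0 < p. Proof. by rewrite (lt_le_trans _ p2). Qed.
Let mf : measurable_fun [set: mR4 R] f. Proof. by have [[]] := wd ord0. Qed.
Let md j : measurable_fun [set: mR4 R] (d j). Proof. by have [_ []] := wd j. Qed.

Lemma pint_test_mul g phi r : measurable_fun [set: mR4 R] g -> (pint p g < +oo)%E ->
  test_function phi -> 0 < r -> r <= p -> (pint r (fun x => (g x * phi x)%R) < +oo)%E.
Proof.
move=> mg pg tphi r0 rp; have [N N0 sN] := test_supp tphi.
have [M M0 hM] := supp_bounded (test_cont tphi) sN.
apply: (pint_lower (p := p) (N := N) r0 rp).
- exact: measurable_funM mg (test_meas tphi).
- by move=> x /sN ->; rewrite mulr0.
- exact: pint_bounded p0 mg (test_meas tphi) hM pg.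
Qed.

Let r43 : 0 < 4 / (4 - 1) :> R. Proof. by rewrite divr_gt0// subr_gt0 ltr1n. Qed.
Let r43p : 4 / (4 - 1) <= p. Proof. by apply: le_trans p2; rewrite ler_pdivrMr ?subr_gt0 ?ltr1n//; lra. Qed.
Let r22 : 0 < 2 / (2 - 1) :> R. Proof. by rewrite divr_gt0// subr_gt0 ltr1n. Qed.
Let r22p : 2 / (2 - 1) <= p. Proof. by apply: le_trans p2; rewrite ler_pdivrMr ?subr_gt0 ?ltr1n//; lra. Qed.

(** Test the weak derivative of f on a n * phi, where the test functions a n
    approximate u, and let n tend to infinity: u and its weak derivative then
    share the product rule of smooth functions. *)
Lemma parts_limit j u phi : dotH1_scalar u -> test_function phi ->
  [/\ leb4.-integrable [set: mR4 R] (fun x => (u x * (f x * partial j phi x))%:E),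
      leb4.-integrable [set: mR4 R] (fun x => (wpartial j u x * (f x * phi x))%:E),
      leb4.-integrable [set: mR4 R] (fun x => (u x * (d j x * phi x))%:E) &
  \int[leb4]_x (u x * (f x * partial j phi x)) +
  \int[leb4]_x (wpartial j u x * (f x * phi x)) = - \int[leb4]_x (u x * (d j x * phi x))].
Proof.
move=> hu tphi; have [[mu _] wu _] := hu.
have [a [ta da ua u4]] := dotH1_L4 hu.
have [_ /(Lfun_pint (ltr0n _ 2))[mw pw]] := wu j.
have ma n := test_meas (ta n).
have mda n := test_meas (test_partial j (ta n)).
have pa n : (pint 4 (a n) < +oo)%E by exact: pint_test.
have pda n : (pint 2 (partial j (a n)) < +oo)%E by exact: pint_test _ (test_partial j (ta n)).
have tdphi := test_partial j tphi.
have mh1 : measurable_fun [set: mR4 R] (fun x => f x * partial j phi x).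
  exact: measurable_funM mf (test_meas tdphi).
have mh2 : measurable_fun [set: mR4 R] (fun x => f x * phi x).
  exact: measurable_funM mf (test_meas tphi).
have mh3 : measurable_fun [set: mR4 R] (fun x => d j x * phi x).
  exact: measurable_funM (md j) (test_meas tphi).
have ph1 := pint_test_mul mf pf tdphi r43 r43p.
have ph2 := pint_test_mul mf pf tphi r22 r22p.
have ph3 := pint_test_mul (md j) (pd j) tphi r43 r43p.
have l4 : 1 < 4 :> R by rewrite ltr1n.
have l2 : 1 < 2 :> R by rewrite ltr1n.
split.
- exact: (integrable_hoelder l4 mu mh1 u4 ph1).
- exact: (integrable_hoelder l2 mw mh2 pw ph2).
- exact: (integrable_hoelder l4 mu mh3 u4 ph3).
have c1 := cvg_hoelder l4 ma mu mh1 pa u4 ph1 ua.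
have c2 := cvg_hoelder l2 mda mw mh2 pda pw ph2 (da j).
have c3 := cvg_hoelder l4 ma mu mh3 pa u4 ph3 ua.
have cD : (\int[leb4]_x (a n x * (f x * partial j phi x)) +
    \int[leb4]_x (partial j (a n) x * (f x * phi x))) @[n --> \oo] -->
    (\int[leb4]_x (u x * (f x * partial j phi x)) +
     \int[leb4]_x (wpartial j u x * (f x * phi x)) : R) by exact: cvgD c1 c2.
have cN : (- \int[leb4]_x (a n x * (d j x * phi x))) @[n --> \oo] -->
    (- \int[leb4]_x (u x * (d j x * phi x)) : R) by exact: cvgN c3.
suff seqE n : \int[leb4]_x (a n x * (f x * partial j phi x)) +
    \int[leb4]_x (partial j (a n) x * (f x * phi x)) =
    - \int[leb4]_x (a n x * (d j x * phi x)).
  rewrite (_ : (fun n => _ + _) = (fun n => - \int[leb4]_x (a n x * (d j x * phi x)))) in cD; last first.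
    by apply/funext => n; exact: seqE.
  by rewrite -(cvg_lim (@Rhausdorff R) cD) -(cvg_lim (@Rhausdorff R) cN).
have [lf ld wf] := wd j.
have [M M0 sM] := test_supp tphi; have [M' M'0 sM'] := test_supp tdphi.
have t1 := testM (ta n) tphi.
have [L L0 sL] := test_supp (testM (ta n) tdphi).
have [L' L'0 sL'] := test_supp (testM (test_partial j (ta n)) tphi).
have i1 := loc_integrable_mul lf (test_cont (testM (ta n) tdphi)) sL.
have i2 := loc_integrable_mul lf (test_cont (testM (test_partial j (ta n)) tphi)) sL'.
transitivity (- \int[leb4]_x (d j x * (a n x * phi x))); last first.
  by rewrite /=; congr (- _); apply: eq_Rintegral => x _; ring.
rewrite -(wf _ t1).
transitivity (\int[leb4]_x (f x * (a n x * partial j phi x)) +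
   \int[leb4]_x (f x * (partial j (a n) x * phi x))).
  by rewrite /=; congr (_ + _); apply: eq_Rintegral => x _; ring.
rewrite -RintegralD//; apply: eq_Rintegral => x _.
rewrite partialM; first by ring.
  by apply: smooth_derivable; case: (ta n).
by apply: smooth_derivable; case: tphi.
Qed.

(** In the sum of [parts_limit] over j, the derivatives of U add up to its
    divergence, which is 0. *)
Lemma wdiv_tensor (U : 'I_4 -> R4 R -> R) : dotH1 U -> divergence_free U ->
  is_wdiv (fun j x => U j x * f x) (fun x => \sum_j U j x * d j x).
Proof.
move=> hU [lU _ divU].
have U4 j : (pint 4 (U j) < +oo)%E by have [a []] := dotH1_L4 (hU j).
have mU j : measurable_fun [set: mR4 R] (U j) by have [[]] := hU j.
have ww j : is_wpartial j (U j) (wpartial j (U j)).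
  by have [_ wU _] := hU j; apply: wpartialP; case: (wU j).
have lsum (F : 'I_4 -> R4 R -> R) : (forall j, loc_integrable (F j)) ->
    loc_integrable (fun x => \sum_j F j x).
  move=> lF; apply: cube_loc_integrable.
    by apply: measurable_sum => j; case: (lF j).
  move=> N; have := integrable_sum (measurable_cube N) (index_enum 'I_4) (P := predT)
    (fun j _ => loc_integrable_cube N (lF j)).
  by congr integrable; apply/funext => x; rewrite sumEFin.
have div0 : {ae leb4, forall x : mR4 R, \sum_j wpartial j (U j) x = 0}.
  apply: test_ae0; first by apply: lsum => j; have [] := ww j.
  move=> phi tphi; have [N N0 sN] := test_supp tphi.
  have i1 j : leb4.-integrable [set: mR4 R] (EFin \o (fun x => wpartial j (U j) x * phi x)).
    by have [_ lw _] := ww j; exact: loc_integrable_mul lw (test_cont tphi) sN.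
  have i2 j : leb4.-integrable [set: mR4 R] (EFin \o (fun x => U j x * partial j phi x)).
    have [N' N'0 sN'] := test_supp (test_partial j tphi).
    exact: loc_integrable_mul (lU j) (test_cont (test_partial j tphi)) sN'.
  under eq_Rintegral do rewrite mulr_suml.
  rewrite Rintegral_sum4//.
  have := divU _ tphi; rewrite Rintegral_sum4//.
  have -> : \int[leb4]_x (cst 0 x * phi x) = 0.
    by rewrite /Rintegral integral0_eq// => x _; rewrite mul0r.
  rewrite oppr0 => D; rewrite -[LHS]opprK -sumrN -[RHS]oppr0 -[in RHS]D; congr (- _).
  by apply: eq_bigr => j _; have [_ _ ->] := ww j.
split.
- by move=> j; exact: loc_integrable_mul4 p2 (mU j) (U4 j) mf pf.
- by apply: lsum => j; exact: loc_integrable_mul4 p2 (mU j) (U4 j) (md j) (pd j).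
move=> phi tphi; have P j := parts_limit j (hU j) tphi.
have i1 j : leb4.-integrable [set: mR4 R] (EFin \o (fun x => U j x * (f x * partial j phi x))).
  by case: (P j).
have i2 j : leb4.-integrable [set: mR4 R] (EFin \o (fun x => wpartial j (U j) x * (f x * phi x))).
  by case: (P j).
have i3 j : leb4.-integrable [set: mR4 R] (EFin \o (fun x => U j x * (d j x * phi x))).
  by case: (P j).
transitivity (\sum_j \int[leb4]_x (U j x * (f x * partial j phi x))).
  rewrite -Rintegral_sum4//; apply: eq_Rintegral => x _.
  by apply: eq_bigr => j _; rewrite mulrA.
transitivity (- \sum_j \int[leb4]_x (U j x * (d j x * phi x))); last first.
  rewrite -Rintegral_sum4//; congr (- _); apply: eq_Rintegral => x _.
  by rewrite mulr_suml; apply: eq_bigr => j _; rewrite mulrA.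
have Z : \sum_j \int[leb4]_x (wpartial j (U j) x * (f x * phi x)) = 0.
  rewrite -Rintegral_sum4// /Rintegral.
  have m0 : measurable_fun [set: mR4 R] (fun x => (\sum_j wpartial j (U j) x * (f x * phi x))%:E).
    by apply/measurable_EFinP; apply: measurable_sum => j; apply/measurable_EFinP; exact: measurable_int (i2 j).
  rewrite (@ae_eq_integral _ (mR4 R) R leb4 setT (cst 0%E) _ measurableT m0 (measurable_cst _)).
    by rewrite integral0.
  by apply: ae_mono div0 => x x0 _; rewrite -mulr_suml x0 mul0r.
rewrite -sumrN -[LHS]addr0 -[X in _ + X = _]Z -big_split/=; apply: eq_bigr => j _.
by case: (P j).
Qed.

Lemma wdiv_unique (F : 'I_4 -> R4 R -> R) g h : is_wdiv F g -> is_wdiv F h ->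
  {ae leb4, forall x : mR4 R, g x = h x}.
Proof.
move=> [_ lg hg] [_ lh hh].
have lB : loc_integrable (fun x => g x - h x).
  apply: cube_loc_integrable; first by apply: measurable_funB; [case: lg|case: lh].
  move=> N; have := integrableB (measurable_cube N) (loc_integrable_cube N lg) (loc_integrable_cube N lh).
  by congr integrable.
apply: ae_mono (test_ae0 lB _) => [x /eqP|phi tphi]; first by rewrite subr_eq0 => /eqP.
have [N N0 sN] := test_supp tphi.
have ig := loc_integrable_mul lg (test_cont tphi) sN.
have ih := loc_integrable_mul lh (test_cont tphi) sN.
under eq_Rintegral do rewrite mulrBl.
rewrite RintegralB//; apply/eqP; rewrite subr_eq0 -eqr_opp; apply/eqP.
by rewrite -hg// -hh.
Qed.

End TensorDivergence.

(** * The product estimate *)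

Section Estimate.
Context {R : realType}.
Implicit Types (f g h u : R4 R -> R) (p q : R).

Definition tail (n : nat) u : R4 R -> R := fun x => u x * \1_[set y | n%:R < u y] x.

Lemma measurable_tail n u : measurable_fun [set: mR4 R] u ->
  measurable_fun [set: mR4 R] (tail n u).
Proof.
move=> mu; apply: measurable_funM => //; apply: measurable_indic.
have -> : [set y : mR4 R | n%:R < u y] = setT `&` u @^-1` [set` `]n%:R, +oo[%R].
  by apply/seteqP; split=> x /=; rewrite in_itv/= andbT; [move=> ?; split|case].
by apply: mu => //; exact: measurable_itv.
Qed.

(** Dominated convergence: at each point the tail is 0 once n exceeds the
    value there. *)
Lemma pint_tail u q e : measurable_fun [set: mR4 R] u -> 0 < q ->
  (pint q u < +oo)%E -> 0 < e -> exists n, (pint q (tail n u) <= (e `^ q)%:E)%E.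
Proof.
move=> mu q0 uq e0.
have [] := @dominated_convergence _ (mR4 R) R leb4 setT measurableT
  (fun n x => (`|tail n u x| `^ q)%:E) (cst 0%E) (fun x => (`|u x| `^ q)%:E).
- by move=> n; apply: measurable_pint; exact: measurable_tail.
- exact: measurable_cst.
- apply: aeW => x _; apply: cvg_near_cst.
  exists (Num.truncn (u x)).+1 => // n /= nu.
  rewrite /tail indicE memNset ?mulr0 ?normr0 ?powR0 ?gt_eqF//= => h.
  by have := lt_trans h (truncnS_gt (u x)); rewrite ltr_nat ltnNge nu.
- apply/integrableP; split; first exact: measurable_pint.
  by under eq_integral do rewrite abse_EFin ger0_norm ?powR_ge0//.
- apply: aeW => x n _; rewrite lee_fin ger0_norm ?powR_ge0//.
  rewrite ge0_ler_powR ?nnegrE ?(ltW q0)// /tail normrM ler_piMr// indicE.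
  by case: (_ \in _); rewrite ?normr1 ?normr0.
move=> _ _; rewrite integral_cst// mul0e => c0.
have [n0 hn] := ecvg0_le c0 (powR_gt0 q e0).
by exists n0; exact: hn.
Qed.

(** The sum is at most the number of terms times the largest one. *)
Lemma ler_sum_card (I : finType) (a : I -> R) (q : R) : 0 < q ->
  `|\sum_i `|a i| | `^ q <= #|I|%:R `^ q * \sum_i `|a i| `^ q.
Proof.
move=> q0; have s0 : 0 <= \sum_i `|a i| by apply: sumr_ge0.
have [i0|] := pickP I; last first.
  move=> I0; rewrite [X in `|X|]big1 => [|i _]; last by have := I0 i.
  rewrite normr0 powR0 ?gt_eqF// mulr_ge0 ?powR_ge0//.
  by apply: sumr_ge0 => i _; exact: powR_ge0.
move=> _; have [i _ im] := @arg_maxP _ _ _ i0 xpredT (fun i => `|a i|) isT.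
have S1 : \sum_i `|a i| <= #|I|%:R * `|a i|.
  rewrite mulr_natl -sumr_const; apply: ler_sum => k _; exact: im.
apply: (@le_trans _ _ ((#|I|%:R * `|a i|) `^ q)).
  by rewrite (ger0_norm s0) ge0_ler_powR ?nnegrE ?(ltW q0) ?mulr_ge0.
rewrite powRM// ler_wpM2l ?powR_ge0// (bigD1 i)//= lerDl.
by rewrite sumr_ge0// => k _; rewrite powR_ge0.
Qed.

Lemma pint_sum (I : finType) (F : I -> R4 R -> R) q (B : R) : 0 < q -> 1 <= q ->
  (forall i, measurable_fun [set: mR4 R] (F i)) ->
  (0 < #|I|)%N -> 0 <= B -> (forall i, (pint q (F i) <= (B `^ q)%:E)%E) ->
  (pint q (fun x => (\sum_i `|F i x|)%R) <= ((#|I|%:R * #|I|%:R * B) `^ q)%:E)%E.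
Proof.
move=> q0 q1 mF I0 B0 FB.
have f0 (i : I) (x : mR4 R) : [set: mR4 R] x -> (0 <= (`|F i x| `^ q)%:E)%E.
  by rewrite lee_fin powR_ge0.
have msum : measurable_fun [set: mR4 R] (fun x => \sum_i `|F i x|).
  by apply: measurable_sum => i; exact: measurableT_comp.
have mS : measurable_fun [set: mR4 R] (fun x => \sum_i (`|F i x| `^ q)%:E)%E.
  by apply: emeasurable_sum => i; exact: measurable_pint.
have S0 (x : mR4 R) : [set: mR4 R] x -> (0 <= \sum_i (`|F i x| `^ q)%:E)%E.
  by move=> _; apply: sume_ge0 => i _; rewrite lee_fin powR_ge0.
apply: (@le_trans _ _ (\int[leb4]_x ((#|I|%:R `^ q)%:E * \sum_i (`|F i x| `^ q)%:E))%E).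
  apply: ge0_le_integral => //; first exact: (measurable_pint q msum).
    by apply: emeasurable_funM.
  by move=> x _; rewrite sumEFin -EFinM lee_fin ler_sum_card.
rewrite (ge0_integralZl leb4 measurableT mS S0); last by rewrite lee_fin powR_ge0.
rewrite (ge0_integral_sum leb4 measurableT (fun i => measurable_pint q (mF i)) f0).
apply: (@le_trans _ _ ((#|I|%:R `^ q)%:E * (#|I|%:R * B `^ q)%:E)%E).
  apply: lee_wpmul2l; first by rewrite lee_fin powR_ge0.
  apply: (@le_trans _ _ (\sum_(i : I) (B `^ q)%:E)%E); first by apply: lee_sum => i _; exact: FB.
  by rewrite sumEFin lee_fin sumr_const mulr_natl.
rewrite -EFinM lee_fin -mulrA !powRM// ?mulr_ge0// ler_wpM2l ?powR_ge0//.
rewrite ler_wpM2r ?powR_ge0// -[leLHS]powRr1// ler_powR// ler1n//.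
Qed.

Lemma norm_le_frob (I : finType) (a : I -> R) i : `|a i| <= Num.sqrt (\sum_i a i ^+ 2).
Proof.
rewrite -sqrtr_sqr ler_wsqrtr// (bigD1 i)//= lerDl.
by rewrite sumr_ge0// => k _; rewrite sqr_ge0.
Qed.

Lemma frob_le_sum (I : finType) (a : I -> R) : Num.sqrt (\sum_i a i ^+ 2) <= \sum_i `|a i|.
Proof.
have s0 : 0 <= \sum_i `|a i| by apply: sumr_ge0.
rewrite -[leRHS]ger0_norm// -sqrtr_sqr ler_wsqrtr// expr2 mulr_suml.
apply: ler_sum => i _; rewrite -real_normK ?num_real// expr2.
by rewrite ler_wpM2l// (bigD1 i)//= lerDl sumr_ge0.
Qed.

Lemma le_pint q f g : 0 <= q -> measurable_fun [set: mR4 R] f ->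
  measurable_fun [set: mR4 R] g -> (forall x, `|f x| <= `|g x|) -> (pint q f <= pint q g)%E.
Proof.
move=> q0 mf mg fg; apply: ge0_le_integral => //; try exact: measurable_pint.
by move=> x _; rewrite lee_fin ge0_ler_powR ?nnegrE.
Qed.

Lemma measurable_frob (I : finType) (F : I -> R4 R -> R) :
  (forall i, measurable_fun [set: mR4 R] (F i)) ->
  measurable_fun [set: mR4 R] (fun x => Num.sqrt (\sum_i F i x ^+ 2)).
Proof.
move=> mF; apply: measurableT_comp.
  by apply: continuous_measurable_fun => x; exact: sqrt_continuous.
by apply: measurable_sum => i; exact: measurable_funX.
Qed.

(** Hoelder's inequality with exponents 4 / p and 4 / (4 - p). *)
Lemma pint_prod p u g (a b : R) : 0 < p -> p < 4 ->
  measurable_fun [set: mR4 R] u -> measurable_fun [set: mR4 R] g -> 0 <= a -> 0 <= b ->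
  (pint 4 u <= (a `^ 4)%:E)%E -> (pint (sob_conj p) g <= (b `^ sob_conj p)%:E)%E ->
  (pint p (fun x => (u x * g x)%R) <= ((a * b) `^ p)%:E)%E.
Proof.
move=> p0 p4 mu mg a0 b0 ua gb.
have q0 : 0 < 4 - p by rewrite subr_gt0.
have qn : 4 - p != 0 by rewrite gt_eqF.
have i0 r f x : (0 <= (`|f x| `^ r)%:E)%E by rewrite lee_fin powR_ge0.
have e1 : 0 < p / 4 by rewrite divr_gt0.
have e2 : 0 < (4 - p) / 4 by rewrite divr_gt0.
have e12 : p / 4 + (4 - p) / 4 = 1 by field.
have e4 : 4 * (p / 4) = p by field.
have ec : sob_conj p * ((4 - p) / 4) = p by rewrite /sob_conj; field.
have := @hoelder_ge0 _ (mR4 R) R leb4 _ _ _ _ (measurable_pint 4 mu) (measurable_pint (sob_conj p) mg)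
  (fun x => i0 _ _ x) (fun x => i0 _ _ x) e1 e2 e12.
rewrite (_ : (\int[leb4]_x _)%E = pint p (fun x => u x * g x)); last first.
  apply: eq_integral => x _; rewrite !poweR_EFin -EFinM -!powRrM e4 ec.
  by rewrite normrM powRM.
move=> /le_trans; apply.
rewrite powRM// EFinM; apply: lee_pmul; rewrite ?poweR_ge0//.
  by apply: le_trans (le_poweR (ltW e1) (pint_ge0 _ _) ua) _; rewrite poweR_EFin -powRrM e4.
by apply: le_trans (le_poweR (ltW e2) (pint_ge0 _ _) gb) _; rewrite poweR_EFin -powRrM ec.
Qed.

End Estimate.

Section FinalEstimate.
Context {R : realType}.
Variables (U : 'I_4 -> R4 R -> R) (p : R).
Hypotheses (hU : dotH1 U) (divU : divergence_free U) (hp : 2 <= p < 4).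

Let p2 : 2 <= p. Proof. by case/andP: hp. Qed.
Let p4 : p < 4. Proof. by case/andP: hp. Qed.
Let p0 : 0 < p. Proof. by rewrite (lt_le_trans _ p2). Qed.
Let p1 : 1 <= p. Proof. by rewrite (le_trans _ p2) ?ler1n. Qed.

Let speed : R4 R -> R := fun x => \sum_j `|U j x|.
Let card1 : #|{: 'I_4 * 'I_4}|%:R = 16 :> R.
Proof. by rewrite card_prod card_ord. Qed.

Let mU j : measurable_fun [set: mR4 R] (U j). Proof. by have [[]] := hU j. Qed.

Let mspeed : measurable_fun [set: mR4 R] speed.
Proof. by apply: measurable_sum => j; exact: measurableT_comp. Qed.

Lemma pint_speed : (pint 4 speed < +oo)%E.
Proof.
have H j : exists B : R, 0 <= B /\ (pint 4 (U j) <= (B `^ 4)%:E)%E.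
  have [a [_ _ _ U4]] := dotH1_L4 (hU j).
  exists (fine (pint 4 (U j)) `^ 4^-1); split; first exact: powR_ge0.
  rewrite -powRrM mulVf// powRr1 ?fine_ge0 ?pint_ge0// fineK// ge0_fin_numE ?pint_ge0//.
have /choice[B hB] := H.
pose C := \sum_j B j.
have C0 : 0 <= C by apply: sumr_ge0 => j _; case: (hB j).
have card4 : (0 < #|{: 'I_4}|)%N by rewrite card_ord.
apply: le_lt_trans (pint_sum (ltr0n _ 4) (ler1n _ 4) mU card4 C0 _) (ltry _) => j.
have [Bj0 Bj] := hB j; apply: le_trans Bj _.
rewrite lee_fin ge0_ler_powR ?nnegrE// /C (bigD1 j)//= lerDl.
by apply: sumr_ge0 => k _; case: (hB k).
Qed.

Lemma W2p_tensor (V : 'I_4 -> R4 R -> R) : W2p p V ->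
  forall i, is_wdiv (fun j => tensor U V j i) (fun x => \sum_j U j x * wpartial j (V i) x).
Proof.
move=> [V0 V1 _] i.
have [_ pV] := Lfun_pint p0 (V0 i).
have wV j : is_wpartial j (V i) (wpartial j (V i)).
  by apply: wpartialP; case: (V1 i j).
have pdV j : (pint p (wpartial j (V i)) < +oo)%E.
  by have [_ /(Lfun_pint p0)[]] := V1 i j.
exact: (wdiv_tensor p2 wV pV pdV hU divU).
Qed.

(** Below the height n the field |U| is bounded by n and the gradient of V is
    measured in L^p; above it, |U| is small in L^4 and the gradient of V is
    measured in the critical space, where the Sobolev inequality gives control
    by the Hessian. The factor 256 is 16 * 16, from [pint_sum] over the 16
    components of the gradient. *)
Lemma tensor_bound (V : 'I_4 -> R4 R -> R) (n : nat) (e H G : R) : W2p p V ->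
  0 <= e -> (pint 4 (tail n speed) <= (e `^ 4)%:E)%E -> 0 <= H -> 0 <= G ->
  (LpN p (whess V) <= H%:E)%E -> (LpN p (wgrad V) <= G%:E)%E ->
  (LpN p (tdiv (tensor U V)) <= (e * (256 * sob_exp p * H) + n%:R * (256 * G))%:E)%E.
Proof.
move=> WV e0 en H0 G0 hH hG; have [V0 V1 V2] := WV.
have mg ij : measurable_fun [set: mR4 R] (wgrad V ij).
  by have [_ /(Lfun_pint p0)[]] := V1 ij.1 ij.2.
have mh ijk : measurable_fun [set: mR4 R] (whess V ijk).
  by have [_ /(Lfun_pint p0)[]] := V2 ijk.1.1 ijk.1.2 ijk.2.
have pg ij : (pint p (wgrad V ij) <= (G `^ p)%:E)%E.
  move/(Lnorm_le _ p0 G0): hG; apply: le_trans; apply: le_pint (ltW p0) (mg ij) (measurable_frob mg) _ => x.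
  by apply: le_trans (norm_le_frob (fun k => wgrad V k x) ij) (ler_norm _).
have ph ijk : (pint p (whess V ijk) <= (H `^ p)%:E)%E.
  move/(Lnorm_le _ p0 H0): hH; apply: le_trans; apply: le_pint (ltW p0) (mh ijk) (measurable_frob mh) _ => x.
  by apply: le_trans (norm_le_frob (fun k => whess V k x) ijk) (ler_norm _).
have se0 : 0 <= sob_exp p by rewrite /sob_exp divr_ge0 ?mulr_ge0 ?(ltW p0)// subr_ge0 ltW.
have sc1 : 1 <= sob_conj p.
  by rewrite /sob_conj ler_pdivlMr ?subr_gt0// mul1r; move: p0 p2; lra.
have pc ij : (pint (sob_conj p) (wgrad V ij) <= ((sob_exp p * H) `^ sob_conj p)%:E)%E.
  apply: (sobolev_weak (g := fun k => whess V (ij, k)) hp _ _ H0) => [k||k]; last exact: ph.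
    by apply: wpartialP; case: (V2 ij.1 ij.2 k).
  by apply: le_lt_trans (pg ij) (ltry _).
pose D x := \sum_ij `|wgrad V ij x|.
have mD : measurable_fun [set: mR4 R] D by apply: measurable_sum => ij; exact: measurableT_comp.
have c0 : (0 < #|{: 'I_4 * 'I_4}|)%N by rewrite card_prod card_ord.
have pD : (pint p D <= ((256 * G) `^ p)%:E)%E.
  have := pint_sum p0 p1 mg c0 G0 pg; rewrite card1.
  by rewrite (_ : 16 * 16 * G = 256 * G)//; ring.
have pcD : (pint (sob_conj p) D <= ((256 * sob_exp p * H) `^ sob_conj p)%:E)%E.
  have := pint_sum (lt_le_trans ltr01 sc1) sc1 mg c0 (mulr_ge0 se0 H0) pc; rewrite card1.
  by rewrite (_ : 16 * 16 * (sob_exp p * H) = 256 * sob_exp p * H)//; ring.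
have h256 : 0 <= 256 :> R := ler0n _ 256.
have sH0 : 0 <= 256 * sob_exp p * H := mulr_ge0 (mulr_ge0 h256 se0) H0.
have mtl := measurable_tail n mspeed.
pose b1 x := tail n speed x * D x; pose b2 x := n%:R * D x.
have mb1 : measurable_fun [set: mR4 R] b1 by exact: measurable_funM.
have mb2 : measurable_fun [set: mR4 R] b2 by exact: measurable_funM.
have Nb1 : (Lnorm leb4 p%:E (EFin \o b1) <= (e * (256 * sob_exp p * H))%:E)%E.
  by apply/(Lnorm_le _ p0); [exact: mulr_ge0|exact: pint_prod].
have Nb2 : (Lnorm leb4 p%:E (EFin \o b2) <= (n%:R * (256 * G))%:E)%E.
  apply/(Lnorm_le _ p0); first exact: mulr_ge0 (ler0n _ n) (mulr_ge0 h256 G0).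
  have i0 (x : mR4 R) : [set: mR4 R] x -> (0 <= (`|D x| `^ p)%:E)%E by rewrite lee_fin powR_ge0.
  have -> : pint p b2 = ((n%:R `^ p)%:E * pint p D)%E.
    rewrite /pint -(ge0_integralZl leb4 measurableT (measurable_pint p mD) i0); last by rewrite lee_fin powR_ge0.
    by apply: eq_integral => x _; rewrite /b2 normrM ger0_norm// powRM.
  rewrite (powRM p (ler0n _ n) (mulr_ge0 h256 G0)) EFinM; apply: lee_wpmul2l; last exact: pD.
  by rewrite lee_fin powR_ge0.
rewrite EFinD; apply: le_trans (leeD Nb1 Nb2).
apply: le_trans (minkowski_EFin leb4 mb1 mb2 p1).
pose T i x := \sum_j U j x * wpartial j (V i) x.
have wT i : is_wdiv (fun j => tensor U V j i) (T i) by exact: W2p_tensor.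
have wt i : is_wdiv (fun j => tensor U V j i) (tdiv (tensor U V) i).
  have ex : has_wdiv (fun j => tensor U V j i) by exists (T i).
  exact: (xgetPex (cst 0) ex).
have mt i : measurable_fun [set: mR4 R] (tdiv (tensor U V) i) by have [_ []] := wt i.
have mTi i : measurable_fun [set: mR4 R] (T i) by have [_ []] := wT i.
have tT : {ae leb4, forall x : mR4 R, forall i, tdiv (tensor U V) i x = T i x}.
  by apply: ae_forall_ord => i; exact: wdiv_unique (wt i) (wT i).
have bnd x : Num.sqrt (\sum_i T i x ^+ 2) <= b1 x + b2 x.
  apply: le_trans (frob_le_sum _) _; apply: (@le_trans _ _ (speed x * D x)).
    rewrite /speed /D mulr_suml -(pair_bigA _ (fun i j => `|wpartial j (V i) x|)) /=.
    apply: (@le_trans _ _ (\sum_i \sum_j `|U j x| * `|wpartial j (V i) x|)).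
      apply: ler_sum => i _; apply: le_trans (ler_norm_sum _ _ _) _.
      by apply: ler_sum => j _; rewrite normrM.
    rewrite exchange_big; apply: ler_sum => j _; rewrite -mulr_sumr ler_wpM2l//.
    by apply: ler_sum => i _; rewrite (bigD1 j)//= lerDl sumr_ge0.
  have D0 : 0 <= D x by apply: sumr_ge0.
  rewrite /b1 /b2 -mulrDl ler_wpM2r// /tail indicE.
  have [h|h] := ltP n%:R (speed x); first by rewrite mem_set// mulr1 lerDl.
  by rewrite memNset ?mulr0 ?add0r//= => /(le_lt_trans h); rewrite ltxx.
have mF := measurable_frob mt; have mFT := measurable_frob mTi.
have e1 : pint p (fun x => Num.sqrt (\sum_i tdiv (tensor U V) i x ^+ 2)) =
    pint p (fun x => Num.sqrt (\sum_i T i x ^+ 2)).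
  apply: ae_eq_integral => //; [exact: measurable_pint|exact: measurable_pint|].
  by apply: ae_mono tT => x h _; under eq_bigr do rewrite h.
rewrite /LpN !LnormE [X in (poweR X _ <= _)%E]e1.
apply: le_poweR; [by rewrite invr_ge0 ltW|exact: pint_ge0|].
apply: le_pint (ltW p0) mFT (measurable_funD mb1 mb2) _ => x.
rewrite (ger0_norm (sqrtr_ge0 _)); exact: le_trans (bnd x) (ler_norm _).
Qed.

End FinalEstimate.

Theorem lemma4p4 (R : realType) (U : 'I_4 -> R4 R -> R) (p eps : R)
    (hU : dotH1 U) (divU : divergence_free U)
    (hp : 2 <= p < 4) (heps : 0 < eps) :
  exists C : R, 0 < C /\
    forall V : 'I_4 -> R4 R -> R, W2p p V ->
      has_tdiv (tensor U V) /\
      (LpN p (tdiv (tensor U V))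
         <= eps%:E * dotW2pN p V + C%:E * LpN p (wgrad V))%E.
Proof.
have /andP[p2 p4] := hp.
have s0 : 0 < 256 * sob_exp p.
  exact: mulr_gt0 (ltr0n _ 256) (lt_trans (ltr0n _ 2) (sob_exp_gt2 hp)).
have e0 : 0 < eps / (256 * sob_exp p) by rewrite divr_gt0.
have mspeed : measurable_fun [set: mR4 R] (fun x => \sum_j `|U j x|).
  by apply: measurable_sum => j; apply: measurableT_comp => //; have [[]] := hU j.
(* The height of the cut is chosen from eps, p and U alone. *)
have [n hn] := pint_tail mspeed (ltr0n _ 4) (pint_speed hU) e0.
have C0 : 0 < n%:R * 256 + 1 :> R.
  exact: ltr_wpDl (mulr_ge0 (ler0n _ n) (ler0n _ 256)) ltr01.
exists (n%:R * 256 + 1); split=> //.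
move=> V WV; split.
  by move=> i; eexists; exact: (W2p_tensor hU divU hp WV).
have hess0 : (0 <= dotW2pN p V)%E by rewrite /dotW2pN /LpN Lnorm_ge0.
have grad0 : (0 <= LpN p (wgrad V))%E by rewrite /LpN Lnorm_ge0.
have bound := @tensor_bound _ U p hU divU hp V n _ _ _ WV (ltW e0) hn.
move: hess0 grad0 bound; rewrite -/(dotW2pN p V).
case: (dotW2pN p V) => [H| |] //; last first.
  by move=> _ G0 _; rewrite gt0_muley ?lte_fin// addye ?leey// -ltNye (lt_le_trans _ (mule_ge0 _ G0)) ?lee_fin ?(ltW C0)// ltNy0.
case: (LpN p (wgrad V)) => [G| |] //; last first.
  by move=> _ _ _; rewrite gt0_muley ?lte_fin// addey ?leey.
rewrite !lee_fin => H0 G0 /(_ H G H0 G0 (lexx _) (lexx _)) /le_trans; apply.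
rewrite -!EFinM -EFinD lee_fin; apply: lerD.
  by rewrite mulrA (divfK (lt0r_neq0 s0)).
by rewrite mulrA ler_wpM2r// lerDl.
Qed.
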